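(* There is a randomized algorithm which, given parameters $\varepsilon>0$, $\rho>0$, $\delta\in(0,1)$ and a set $P\subset\mathbb{R}^2$ of $n$ points, runs in time $$O\left(n+\frac{1}{\varepsilon^2\rho}\left(\log\frac{1}{\rho}+\log\frac{1}{\delta}\right)\log\left(\frac{1}{\varepsilon\rho}\log\frac{1}{\delta}\right)\right)$$ and outputs a point $x'\in\mathbb{R}^2$ such that, with probability at least $1-\delta$, $$\bar{G}_P(x')\ge(1-\varepsilon)\,\bar{G}_P(x^* )$$ whenever $\bar{G}_P(x^* )\ge\rho$, where $x^*=\arg\max_{x\in\mathbb{R}^2}\bar{G}_P(x)$.
   Context: For $x,y\in\mathbb{R}^d$ the Gaussian kernel is $K(x,y)=e^{-\|x-y\|^2}$ (Euclidean norm). For a finite point set $Q\subset\mathbb{R}^d$, the Gaussian kernel density estimate is $\bar{G}_Q(x)=\frac{1}{|Q|}\sum_{p\in Q}K(p,x)$. The lower bound $\rho$ on the maximum density is given to the algorithm. *)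

(* Defs.v *)
From HB Require Import structures.
From mathcomp Require Import all_boot all_order all_algebra finmap.
From mathcomp Require Import all_classical all_reals all_analysis.

Set Implicit Arguments.
Unset Strict Implicit.
Unset Printing Implicit Defensive.

Import Order.TTheory GRing.Theory Num.Theory.
Local Open Scope ring_scope.

Section KDE.
Context {R : realType} {d : nat}.
Implicit Types (x y : 'rV[R]_d) (Q : {fset 'rV[R]_d}).

(* The library norm `|x| on row vectors is the sup norm, hence this one. *)
Definition euclidean_norm x : R := Num.sqrt (\sum_(i < d) x ord0 i ^+ 2).

Definition gaussian_kernel x y : R := expR (- euclidean_norm (x - y) ^+ 2).

Definition kde Q x : R :=
  (#|` Q|)%:R^-1 * \sum_(p <- enum_fset Q) gaussian_kernel p x.

Definition is_argmax (f : 'rV[R]_d -> R) x := forall y, f y <= f x.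

End KDE.

(* A randomized real RAM.

  Programs are finite syntax, independent of the input size, of the parameters
  and of the real numbers involved. The memory consists of named arrays of
  natural numbers and named arrays of reals; a scalar variable is a cell with
  a constant index. Each elementary step costs 1. An expression is part of
  the program text, so that evaluating it takes a number of operations which
  is a constant of the program.

  Two standard restrictions keep unit cost meaningful: natural numbers can only
  be added, subtracted (truncated) and halved, so they have at most linearly
  many bits in the running time; and there is no conversion from reals to
  natural numbers (no floor function). The only real literals are natural
  numbers. *)

Inductive nexp :=
  | NConst of nat
  | NGet of nat & nexp              (* array name, index *)
  | NAdd of nexp & nexp
  | NSub of nexp & nexp
  | NHalf of nexp.

Inductive rexp :=
  | RNat of nexp
  | RGet of nat & nexp              (* array name, index *)
  | RAdd of rexp & rexp
  | RSub of rexp & rexp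
  | RMul of rexp & rexp
  | RDiv of rexp & rexp
  | RExp of rexp
  | RLn of rexp.

Inductive bexp :=
  | NLt of nexp & nexp
  | RLt of rexp & rexp
  | BNot of bexp
  | BAnd of bexp & bexp.

Inductive cmd :=
  | Skip
  | NSet of nat & nexp & nexp       (* array name, index, value *)
  | RSet of nat & nexp & rexp       (* array name, index, value *)
  | Draw of nat & nexp & nexp       (* array name, index, k: uniform in [0, k[ *)
  | Seq of cmd & cmd
  | If of bexp & cmd & cmd
  | While of bexp & cmd.

Section Semantics.
Context {R : realType}.

Record store := Store {
  nmem : nat -> nat -> nat;
  rmem : nat -> nat -> R
}.

Definition upd (T : Type) (m : nat -> nat -> T) (a i : nat) (v : T) :=
  fun b j => if (b == a) && (j == i) then v else m b j.

Definition nset (s : store) a i v := Store (upd (nmem s) a i v) (rmem s).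
Definition rset (s : store) a i v := Store (nmem s) (upd (rmem s) a i v).

Fixpoint neval (s : store) (e : nexp) : nat :=
  match e with
  | NConst n => n
  | NGet a i => nmem s a (neval s i)
  | NAdd e1 e2 => (neval s e1 + neval s e2)%N
  | NSub e1 e2 => (neval s e1 - neval s e2)%N
  | NHalf e1 => (neval s e1)./2
  end.

(* Division by 0 and the logarithm of a nonpositive number return 0. *)
Fixpoint reval (s : store) (e : rexp) : R :=
  match e with
  | RNat e1 => (neval s e1)%:R
  | RGet a i => rmem s a (neval s i)
  | RAdd e1 e2 => reval s e1 + reval s e2
  | RSub e1 e2 => reval s e1 - reval s e2
  | RMul e1 e2 => reval s e1 * reval s e2
  | RDiv e1 e2 => reval s e1 / reval s e2
  | RExp e1 => expR (reval s e1)
  | RLn e1 => ln (reval s e1)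
  end.

Fixpoint beval (s : store) (b : bexp) : bool :=
  match b with
  | NLt e1 e2 => (neval s e1 < neval s e2)%N
  | RLt e1 e2 => reval s e1 < reval s e2
  | BNot b1 => ~~ beval s b1
  | BAnd b1 b2 => beval s b1 && beval s b2
  end.

(* A configuration is the list of commands still to be run and the memory. *)
Definition config := (seq cmd * store)%type.

Inductive outcome :=
  | Halted of store
  | Next of config
  | Branch (m : nat) of ('I_m.+1 -> config).  (* m.+1 equiprobable successors *)

(* [Draw a i k] with k = 0 stores 0. *)
Definition step (c : config) : outcome :=
  let: (l, s) := c in
  match l with
  | [::] => Halted s
  | Skip :: l' => Next (l', s)
  | NSet a i e :: l' => Next (l', nset s a (neval s i) (neval s e))
  | RSet a i e :: l' => Next (l', rset s a (neval s i) (reval s e))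
  | Draw a i k :: l' =>
      @Branch (neval s k).-1 (fun v => (l', nset s a (neval s i) v))
  | Seq c1 c2 :: l' => Next (c1 :: c2 :: l', s)
  | If b c1 c2 :: l' => Next ((if beval s b then c1 else c2) :: l', s)
  | While b c1 :: l' =>
      Next (if beval s b then c1 :: While b c1 :: l' else l', s)
  end.

(* Every run from [c], whatever the random draws, halts in at most [t] steps. *)
Fixpoint halts_within (t : nat) (c : config) : Prop :=
  match step c with
  | Halted _ => True
  | Next c' => if t is t'.+1 then halts_within t' c' else False
  | Branch m f => if t is t'.+1 then forall v, halts_within t' (f v) else False
  end.

(* The probability that a run from [c] halts in at most [t] steps in a memory
   satisfying [E]. *)
Fixpoint prob (t : nat) (c : config) (E : store -> Prop) : R :=
  match step c with
  | Halted s => (`[< E s >])%:R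
  | Next c' => if t is t'.+1 then prob t' c' E else 0
  | Branch m f =>
      if t is t'.+1 then (m.+1)%:R^-1 * \sum_v prob t' (f v) E else 0
  end.

(* Array 0 of naturals holds the number of points; array 0 of reals holds the
   parameters; arrays 1 and 2 of reals hold the coordinates of the points. All
   other cells contain 0. *)
Definition input (eps rho delta : R) (s : seq 'rV[R]_2) : store :=
  Store
    (fun a i => if (a == 0%N) && (i == 0%N) then size s else 0%N)
    (fun a i => match a with
      | 0 => nth 0 [:: eps; rho; delta] i
      | 1 => (nth 0 s i) ord0 ord0
      | 2 => (nth 0 s i) ord0 ord_max
      | _ => 0
      end).

Definition start (A : cmd) (eps rho delta : R) (s : seq 'rV[R]_2) : config :=
  ([:: A], input eps rho delta s).

(* The output is read in the first two cells of array 0 of reals. *)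
Definition output (s : store) : 'rV[R]_2 := \row_(j < 2) rmem s 0 j.

(* Logarithms in asymptotic bounds are, as usual, bounded below by a positive
   constant: otherwise the expression below is negative or undefined for rho
   above 1 or delta close to 1. *)
Definition log1 (x : R) : R := Num.max 1 (ln x).

Definition time_bound (n : nat) (eps rho delta : R) : R :=
  n%:R + 1 / (eps ^+ 2 * rho) * (log1 (1 / rho) + log1 (1 / delta))
         * log1 (1 / (eps * rho) * log1 (1 / delta)).

End Semantics.

(* Main.v *)
Require Import Defs.
From mathcomp Require Import all_boot all_order all_algebra finmap.
From mathcomp Require Import all_classical all_reals all_analysis.
From mathcomp Require Import zify ring lra.

(**
The algorithm draws A = O((1/rho) log (1/delta)) points of P as anchors and an
independent sample Q of N = O((1/(eps^2 rho)) (log (1/rho) + log (1/delta)))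
points, with replacement.

Search region. Let z maximize the density G. A Gaussian of twice the variance is
dominated by a convergent sum of lattice translates of K, so its density is at
most a constant times G(z); hence the points farther than a constant from z
contribute at most G(z)/2, and an anchor lies within distance 4 (in both
coordinates) of z with probability at least rho/2. As
G(z + d) >= (1 - 2|d|^2) G(z), a square grid of step proportional to sqrt eps
around such an anchor contains a near-optimal candidate.

Sampling error. A union bound over the 1/eps candidates of an anchor would cost a
factor log (1/eps) in N. Instead the error is chained through dyadic grids: the
increments of the kernel between consecutive levels decay geometrically, so
Bernstein's inequality at level l has an exponent growing like (9/4)^l, against
4^l candidates.

Evaluation. There is no floor function, so Q is bucketed by sorting all its
coordinates and extracting greedily a net of intervals of length
h = O(sqrt eps). In a product of two intervals the points are replaced by their
centroid with multiplicity: first order terms cancel and the relative error is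
O(h^2) = O(eps). An anchor only looks at the intervals at distance
O(sqrt (log (1/eps))), that is at O((1/eps) log (1/eps)) cells for each of its
O(1/eps) candidates.
*)

Set Implicit Arguments.
Unset Strict Implicit.
Unset Printing Implicit Defensive.

Import Order.TTheory GRing.Theory Num.Theory.
Local Open Scope ring_scope.

(* Memory layout: [v...] are arrays of naturals (scalars, except [vidx] and
   [vbase]) and [w...] are arrays of reals (scalars from [wz] on). *)
Local Notation vidx := 1%N (only parsing).
Local Notation vbase := 2%N (only parsing).
Local Notation vM := 3%N (only parsing).
Local Notation vkM := 4%N (only parsing).
Local Notation vR := 5%N (only parsing).
Local Notation vkR := 6%N (only parsing).
Local Notation vA := 7%N (only parsing).
Local Notation vkA := 8%N (only parsing).
Local Notation vN := 9%N (only parsing).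
Local Notation vkN := 10%N (only parsing).
Local Notation vD := 11%N (only parsing).
Local Notation vkD := 12%N (only parsing).
Local Notation vdraw := 13%N (only parsing).
Local Notation vpass := 14%N (only parsing).
Local Notation vwidth := 15%N (only parsing).
Local Notation vblocks := 16%N (only parsing).
Local Notation vblock := 17%N (only parsing).
Local Notation vbegin := 18%N (only parsing).
Local Notation vleft := 19%N (only parsing).
Local Notation vmiddle := 20%N (only parsing).
Local Notation vright := 21%N (only parsing).
Local Notation vend := 22%N (only parsing).
Local Notation vt := 23%N (only parsing).
Local Notation vm := 24%N (only parsing).
Local Notation vround := 25%N (only parsing).
Local Notation vlo := 26%N (only parsing).
Local Notation vhi := 27%N (only parsing).
Local Notation vmid := 28%N (only parsing).
Local Notation vsample := 29%N (only parsing).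
Local Notation vkx := 30%N (only parsing).
Local Notation vky := 31%N (only parsing).
Local Notation vacc := 32%N (only parsing).
Local Notation va := 33%N (only parsing).
Local Notation vlox := 34%N (only parsing).
Local Notation vhix := 35%N (only parsing).
Local Notation vloy := 36%N (only parsing).
Local Notation vhiy := 37%N (only parsing).
Local Notation vi := 38%N (only parsing).
Local Notation vj := 39%N (only parsing).
Local Notation vu := 40%N (only parsing).
Local Notation vv := 41%N (only parsing).
Local Notation vcell := 42%N (only parsing).
Local Notation wX := 1%N (only parsing).
Local Notation wY := 2%N (only parsing).
Local Notation wV := 3%N (only parsing).
Local Notation wT := 4%N (only parsing).
Local Notation wL := 5%N (only parsing).
Local Notation wW := 6%N (only parsing).
Local Notation wSX := 7%N (only parsing).
Local Notation wSY := 8%N (only parsing).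
Local Notation wz := 9%N (only parsing).
Local Notation wh := 10%N (only parsing).
Local Notation wbest := 13%N (only parsing).
Local Notation wbx := 14%N (only parsing).
Local Notation wby := 15%N (only parsing).
Local Notation wax := 16%N (only parsing).
Local Notation way := 17%N (only parsing).
Local Notation wcx := 18%N (only parsing).
Local Notation wcy := 19%N (only parsing).
Local Notation wacc := 20%N (only parsing).

(** * A cost-aware program logic *)

(** The proof compares the reported candidate with one fixed good candidate, so the two directions
    of the sampling error are treated differently. A lower deviation matters only at a single grid
    point near the maximizer, where one Bernstein bound suffices. Upper deviations must be excluded
    at every candidate of every anchor, and only these are chained. The errors due to centroids and
    to the truncated window are measured against the sum of the wide kernel, the square root of K:
    it absorbs polynomial factors, and its density is at most 36 times the maximum.

    All randomness sits in one loop that draws the [A + N] indices. The rest of the run is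
    deterministic, so the success probability is bounded below by the proportion of good index
    sequences, in which anchors and samples are independent.

    Sizes are rounded up to powers of two found by doubling. This replaces the missing floor, makes
    the candidate grids dyadic, and lets merge sort and binary search run a fixed number of
    rounds. *)

Fixpoint nmods (c : cmd) : seq nat :=
  match c with
  | NSet a _ _ | Draw a _ _ => [:: a]
  | Seq c1 c2 | If _ c1 c2 => nmods c1 ++ nmods c2
  | While _ c1 => nmods c1
  | _ => [::]
  end.

Fixpoint rmods (c : cmd) : seq nat :=
  match c with
  | RSet a _ _ => [:: a]
  | Seq c1 c2 | If _ c1 c2 => rmods c1 ++ rmods c2
  | While _ c1 => rmods c1
  | _ => [::]
  end.

(** Commands without loops or draws: their effect is the total function [denote] and [cost] bounds
    their steps, so such blocks are discharged by computation. *)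
Fixpoint straight (c : cmd) : bool :=
  match c with
  | Skip | NSet _ _ _ | RSet _ _ _ => true
  | Seq c1 c2 | If _ c1 c2 => straight c1 && straight c2
  | _ => false
  end.

Fixpoint cost (c : cmd) : nat :=
  match c with
  | Seq c1 c2 => (cost c1 + cost c2).+1
  | If _ c1 c2 => (maxn (cost c1) (cost c2)).+1
  | _ => 1
  end.

Definition nvar (v : nat) : nexp := NGet v (NConst 0).
Definition nassign (v : nat) (e : nexp) : cmd := NSet v (NConst 0) e.
Definition rvar (v : nat) : rexp := RGet v (NConst 0).
Definition rassign (v : nat) (e : rexp) : cmd := RSet v (NConst 0) e.
Definition nsucc (e : nexp) : nexp := NAdd e (NConst 1).

Definition for_loop (v : nat) (lo hi : nexp) (body : cmd) : cmd :=
  Seq (nassign v lo)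
      (While (NLt (nvar v) hi) (Seq body (nassign v (nsucc (nvar v))))).

Section Hoare.
Context {R : realType}.
Implicit Types (s : @store R) (c : cmd) (Q : @store R -> Prop).

Fixpoint denote c s : store :=
  match c with
  | NSet a i e => nset s a (neval s i) (neval s e)
  | RSet a i e => rset s a (neval s i) (reval s e)
  | Seq c1 c2 => denote c2 (denote c1 s)
  | If b c1 c2 => if beval s b then denote c1 s else denote c2 s
  | _ => s
  end.

Definition agree (na ra : seq nat) s s' : Prop :=
  (forall a, a \notin na -> nmem s' a = nmem s a) /\
  (forall a, a \notin ra -> rmem s' a = rmem s a).

Definition frame c := agree (nmods c) (rmods c).

Lemma agree_trans na ra s2 s1 s3 :
  agree na ra s1 s2 -> agree na ra s2 s3 -> agree na ra s1 s3.
Proof.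
move=> [n12 r12] [n23 r23]; split=> a ha; first by rewrite n23 ?n12.
by rewrite r23 ?r12.
Qed.

Lemma agree_sub na ra na' ra' s s' :
  {subset na <= na'} -> {subset ra <= ra'} ->
  agree na ra s s' -> agree na' ra' s s'.
Proof.
move=> sn sr [fn fr]; split=> a ha.
  by apply: fn; apply: contra ha; apply: sn.
by apply: fr; apply: contra ha; apply: sr.
Qed.

Lemma frame_seql c1 c2 s s' : frame c1 s s' -> frame (Seq c1 c2) s s'.
Proof. by apply: agree_sub => a /= h; rewrite mem_cat h. Qed.

Lemma frame_seqr c1 c2 s s' : frame c2 s s' -> frame (Seq c1 c2) s s'.
Proof. by apply: agree_sub => a /= h; rewrite mem_cat h orbT. Qed.

Lemma frame_nassign v e s x : frame (nassign v e) s (nset s v 0 x).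
Proof.
split=> a //= ; rewrite inE => hav; apply: funext => j.
by rewrite /upd (negPf hav).
Qed.

Fixpoint stepn (k : nat) (cf : @config R) : option config :=
  if k is k'.+1 then
    if step cf is Next cf' then stepn k' cf' else None
  else Some cf.

Lemma stepn_add k j cf cf' :
  stepn k cf = Some cf' -> stepn (k + j) cf = stepn j cf'.
Proof.
elim: k cf => [|k IH] cf /=; first by case=> ->.
by case: (step cf) => //= cf1; apply: IH.
Qed.

(* Quantifying over the continuation [l] is what makes the rules compose. *)
Definition exec c s (t : nat) Q : Prop :=
  exists k s', [/\ (k <= t)%N, forall l, stepn k (c :: l, s) = Some (l, s'),
                   frame c s s' & Q s'].

Lemma exec_weaken c s t t' Q Q' :
  exec c s t Q -> (t <= t')%N -> (forall s', frame c s s' -> Q s' -> Q' s') ->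
  exec c s t' Q'.
Proof.
move=> [k [s' [kt st fr q]]] tt' qq'; exists k, s'.
by split=> //; [exact: leq_trans kt tt' | exact: qq'].
Qed.

Lemma exec_seq t1 t2 c1 c2 s t Q :
  exec c1 s t1 (fun s1 => exec c2 s1 t2 Q) -> (t1 + t2 < t)%N ->
  exec (Seq c1 c2) s t Q.
Proof.
move=> [k1 [s1 [kt1 st1 fr1 [k2 [s2 [kt2 st2 fr2 q]]]]]] ht.
exists (k1 + k2).+1, s2; split=> //.
- by apply: leq_trans ht; rewrite ltnS leq_add.
- by move=> l; rewrite /= (stepn_add _ (st1 _)) st2.
- apply: agree_trans (frame_seql _ fr1) _; exact: frame_seqr.
Qed.

Lemma denote_frame c s : straight c -> frame c s (denote c s).
Proof.
elim: c s => //= [a i e|a i e|c1 IH1 c2 IH2|b c1 IH1 c2 IH2] s.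
- move=> _; split=> b //=; rewrite inE => hab; apply: funext => j.
  by rewrite /upd (negPf hab).
- move=> _; split=> b //=; rewrite inE => hab; apply: funext => j.
  by rewrite /upd (negPf hab).
- move=> /andP[h1 h2]; apply: agree_trans (frame_seql _ (IH1 s h1)) _.
  exact/frame_seqr/IH2.
- move=> /andP[h1 h2]; case: ifP => _.
    exact: (frame_seql c2 (IH1 s h1)).
  exact: (frame_seqr c1 (IH2 s h2)).
Qed.

Lemma exec_straight c s t Q :
  straight c -> (cost c <= t)%N -> Q (denote c s) -> exec c s t Q.
Proof.
move=> hc ht hq.
suff [k [hk st]] : exists k, (k <= cost c)%N /\
    forall l, stepn k (c :: l, s) = Some (l, denote c s).
  exists k, (denote c s); split=> //; first exact: leq_trans hk ht.
  exact: denote_frame.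
elim: c s hc {ht hq} => //=.
- by move=> s _; exists 1%N.
- by move=> a i e s _; exists 1%N.
- by move=> a i e s _; exists 1%N.
- move=> c1 IH1 c2 IH2 s /andP[/(IH1 s)[k1 [hk1 st1]]].
  move=> /(IH2 (denote c1 s))[k2 [hk2 st2]]; exists (k1 + k2).+1; split.
    by rewrite ltnS leq_add.
  by move=> l /=; rewrite (stepn_add _ (st1 _)) st2.
- move=> b c1 IH1 c2 IH2 s /andP[/(IH1 s)[k1 [hk1 st1]]].
  move=> /(IH2 s)[k2 [hk2 st2]]; case: (boolP (beval s b)) => hb.
    exists k1.+1; split; first by rewrite ltnS leq_max hk1.
    by move=> l /=; rewrite hb st1.
  exists k2.+1; split; first by rewrite ltnS leq_max hk2 orbT.
  by move=> l /=; rewrite (negPf hb) st2.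
Qed.

Lemma exec_straight_seq t2 c1 c2 s t Q :
  straight c1 -> exec c2 (denote c1 s) t2 Q -> (cost c1 + t2 < t)%N ->
  exec (Seq c1 c2) s t Q.
Proof. by move=> h1 h2; apply: exec_seq; apply: exec_straight h1 _ h2. Qed.

(** The index of the invariant bounds the remaining iterations, so termination and cost come from
    one induction. Each round adds a test to the body, and the failing test adds one more step. *)
Lemma exec_while (b : bexp) body s (t : nat) (I : nat -> @store R -> Prop) :
  forall n, I n s ->
  (forall n s', frame body s s' -> I n s' ->
     if beval s' b then exists2 n', n = n'.+1 & exec body s' t (I n')
     else True) ->
  exec (While b body) s (n * t.+1).+1
    (fun s' => ~~ beval s' b /\ exists n', (n' <= n)%N /\ I n' s').
Proof.
move=> n In step_I.
suff H : forall n s1, frame body s s1 -> I n s1 ->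
    exec (While b body) s1 (n * t.+1).+1
      (fun s' => ~~ beval s' b /\ exists n', (n' <= n)%N /\ I n' s').
  exact: H.
move=> {In}; elim=> [|n1 IH] s1 fr In; have := step_I _ _ fr In;
  case: ifPn => [bt [n' // en' ex1]|bf _].
- exists 1%N, s1; split=> //; first by move=> l /=; rewrite (negPf bf).
  by split=> //; exists 0%N.
- case: en' ex1 => <- [k [s2 [hk st fr2 In2]]].
  have [k' [s3 [hk' st' fr3 [bf [n3 [hn3 In3]]]]]] := IH _ (agree_trans fr fr2) In2.
  exists (k + k').+1, s3; split.
  + by rewrite ltnS mulSn addSnnS leq_add.
  + by move=> l; rewrite /= bt (stepn_add _ (st _)) st'.
  + exact: agree_trans fr2 fr3.
  + by split=> //; exists n3; split=> //; exact: leqW.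
- exists 1%N, s1; split=> //; first by move=> l /=; rewrite (negPf bf).
  by split=> //; exists n1.+1.
Qed.

(** The three extra steps per round are the test, the [Seq] and the increment; the three at the end
    are the outer [Seq], the initialization and the failing test. The invariant must survive a
    change of [v] because the increment follows the body. *)
Lemma exec_for (I : nat -> @store R -> Prop) (l H t v : nat) lo hi body s T Q :
  v \notin nmods body ->
  neval s lo = l -> (l <= H)%N ->
  (forall i s' x, I i s' -> I i (nset s' v 0 x)) ->
  (forall s', agree (v :: nmods body) (rmods body) s s' -> neval s' hi = H) ->
  I l s ->
  (forall i s', (l <= i < H)%N -> agree (v :: nmods body) (rmods body) s s' ->
     nmem s' v 0 = i -> I i s' -> exec body s' t (I i.+1)) ->
  ((H - l) * (t + 3) + 3 <= T)%N ->
  (forall s', agree (v :: nmods body) (rmods body) s s' -> I H s' -> Q s') ->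
  exec (for_loop v lo hi body) s T Q.
Proof.
move=> hv elo lH Iv ehi Il Ibody hT HQ.
pose W := While (NLt (nvar v) hi) (Seq body (nassign v (nsucc (nvar v)))).
have sub0 : forall s1 s2, frame body s1 s2 ->
    agree (v :: nmods body) (rmods body) s1 s2.
  by move=> s1 s2; apply: agree_sub => a h //; rewrite inE h orbT.
have sub1 : forall s1 x, agree (v :: nmods body) (rmods body) s1 (nset s1 v 0 x).
  move=> s1 x; apply: agree_sub (frame_nassign v (NConst 0) s1 x) => a //=.
  by rewrite !inE => ->.
have loop : forall d i s1, (H - i)%N = d -> (l <= i <= H)%N ->
    agree (v :: nmods body) (rmods body) s s1 -> nmem s1 v 0 = i -> I i s1 ->
    exec W s1 (d * (t + 3)).+1 (I H).
  elim=> [|d IH] i s1 hd /andP[hl hi'] fr ev Ii.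
    have eiH : i = H by apply/eqP; rewrite eqn_leq hi' -subn_eq0 hd.
    exists 1%N, s1; split=> // [r /=|]; last by rewrite -eiH.
    by rewrite (ehi _ fr) ev eiH ltnn.
  have iH : (i < H)%N by rewrite -subn_gt0 hd.
  have [k1 [s2 [hk1 st1 fr1 I2]]] := Ibody i s1 ltac:(by rewrite hl iH) fr ev Ii.
  pose s3 := nset s2 v 0 i.+1.
  have ev2 : nmem s2 v 0 = i by rewrite (fr1.1 v hv).
  have fr3 : agree (v :: nmods body) (rmods body) s1 s3.
    by apply: agree_trans (sub0 _ _ fr1) _; exact: sub1.
  have [k [s4 [hk st fr4 I4]]] := IH i.+1 s3 ltac:(lia) ltac:(lia)
    (agree_trans fr fr3) ltac:(by rewrite /= /upd !eqxx) (Iv _ _ _ I2).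
  exists (k1 + (k.+1)).+2, s4; split=> //.
  - by rewrite mulSn; lia.
  - move=> r; rewrite /= (ehi _ fr) ev iH /= (stepn_add _ (st1 _)) /=.
    by rewrite ev2 addn1 st.
  - apply: agree_trans fr4; apply: agree_sub fr3 => a //=.
    by rewrite !mem_cat !inE => /orP[->|->]; rewrite ?orbT.
    by rewrite mem_cat => ->.
have [k [s' [hk st fr IH]]] := loop (H - l)%N l (nset s v 0 l) erefl
  ltac:(by rewrite leqnn lH) (sub1 s l) ltac:(by rewrite /= /upd !eqxx)
  (Iv _ _ _ Il).
have fr' : agree (v :: nmods body) (rmods body) s s'.
  apply: agree_trans (sub1 s l) _; apply: agree_sub fr => a //=.
    by rewrite mem_cat !inE orbC.
  by rewrite mem_cat orbF.
exists k.+2, s'; split.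
- by apply: leq_trans hT; rewrite addnC !addSn add0n ltnS ltnS (leq_trans hk).
- by move=> r /=; rewrite elo; apply: st.
- apply: agree_sub fr' => a /=; last by rewrite cats0.
  by rewrite !inE mem_cat => /orP[->|->]; rewrite ?orbT.
- exact: HQ.
Qed.

End Hoare.

(** * Averages over independent draws *)

Section Averages.
Context {R : realType}.

(* [m] is the number of outcomes minus one, as in [Branch]. *)
Fixpoint avg (m k : nat) (F : seq nat -> R) : R :=
  if k is k'.+1 then
    m.+1%:R^-1 * \sum_(v < m.+1) avg m k' (fun w => F ((v : nat) :: w))
  else F [::].

Lemma le_avg m k F1 F2 :
  (forall w, size w = k -> F1 w <= F2 w) -> avg m k F1 <= avg m k F2.
Proof.
elim: k F1 F2 => [|k IH] F1 F2 h /=; first exact: h.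
rewrite ler_pM2l ?invr_gt0 ?ltr0n //; apply: ler_sum => v _.
by apply: IH => w ew; apply: h; rewrite /= ew.
Qed.

Lemma eq_avg m k F1 F2 :
  (forall w, size w = k -> F1 w = F2 w) -> avg m k F1 = avg m k F2.
Proof.
by move=> h; apply/le_anti/andP; split; apply: le_avg => w /h ->.
Qed.

Lemma avgD m k F1 F2 : avg m k (fun w => F1 w + F2 w) = avg m k F1 + avg m k F2.
Proof.
elim: k F1 F2 => //= k IH F1 F2.
by rewrite -mulrDr -big_split /=; congr (_ * _); apply: eq_bigr => v _.
Qed.

Lemma avgZ m k c F : avg m k (fun w => c * F w) = c * avg m k F.
Proof.
elim: k F => //= k IH F.
by rewrite mulrCA; congr (_ * _); rewrite mulr_sumr; apply: eq_bigr => v _.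
Qed.

Lemma avg_cst m k c : avg m k (fun=> c) = c.
Proof.
elim: k => //= k IH; rewrite (eq_bigr (fun=> c)) => [|v _]; last exact: IH.
by rewrite sumr_const card_ord -[c *+ _]mulr_natl mulKf // pnatr_eq0.
Qed.

Lemma avg_sum m k (I : Type) (r : seq I) (P : pred I) (F : I -> seq nat -> R) :
  avg m k (fun w => \sum_(i <- r | P i) F i w) = \sum_(i <- r | P i) avg m k (F i).
Proof.
elim: r => [|i r IH].
  by rewrite big_nil -[RHS](avg_cst m k); apply: eq_avg => w _; rewrite big_nil.
rewrite big_cons -IH; case: ifP => Pi.
  by rewrite -avgD; apply: eq_avg => w _; rewrite big_cons Pi.
by apply: eq_avg => w _; rewrite big_cons Pi.
Qed.

Lemma avg_cat m k1 k2 F :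
  avg m (k1 + k2) F = avg m k1 (fun w1 => avg m k2 (fun w2 => F (w1 ++ w2))).
Proof.
elim: k1 F => //= k1 IH F; congr (_ * _); apply: eq_bigr => v _; exact: IH.
Qed.

(** Independence of the draws. Both the exponential moment in Bernstein's inequality and the
    probability that all anchors miss reduce to it. *)
Lemma avg_prod m k (f : nat -> R) :
  avg m k (fun w => \prod_(v <- w) f v) =
  (m.+1%:R^-1 * \sum_(v < m.+1) f v) ^+ k.
Proof.
elim: k => [|k IH] /=; first by rewrite big_nil.
rewrite exprS -mulrA mulr_suml; congr (_ * _); apply: eq_bigr => v _.
by rewrite -IH -avgZ; apply: eq_avg => w _; rewrite big_cons.
Qed.

End Averages.

(** * The loop that draws the indices *)

Section DrawLoop.
Context {R : realType}.
Implicit Types (s : @store R) (E : @store R -> Prop) (l : seq cmd).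

Lemma step_prob k cf cf' T E : stepn k cf = Some cf' ->
  prob (k + T) cf E = prob T cf' E.
Proof.
elim: k cf => [|k IH] cf /=; first by case=> ->.
by case: (step cf) => // cf1; apply: IH.
Qed.

Lemma step_halts k cf cf' T : stepn k cf = Some cf' ->
  @halts_within R T cf' -> halts_within (k + T) cf.
Proof.
elim: k cf => [|k IH] cf /=; first by case=> ->.
by case: (step cf) => // cf1; apply: IH.
Qed.

Lemma exec_final c s t Q : exec c s t Q ->
  forall T, (t <= T)%N -> halts_within T ([:: c], s) /\
    forall E, (forall s', Q s' -> E s') -> prob T ([:: c], s) E = 1.
Proof.
move=> [k [s' [kt st _ q]]] T tT; rewrite -(subnKC (leq_trans kt tT)); split.
  by apply: (step_halts (st [::])); case: (T - k)%N.
move=> E QE; rewrite (step_prob _ _ (st [::])).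
by case: (T - k)%N => [|j] /=; rewrite asboolT //; exact: QE.
Qed.

Definition drawn (v : nat) s (w : seq nat) s' : Prop :=
  [/\ agree [:: v; 1%N] [::] s s', nmem s' v 0 = size w &
      forall i, (i < size w)%N -> nmem s' 1 i = nth 0%N w i].

(** The loop branches exactly as [avg] does, so a lower bound [g w] on the success probability after
    each sequence [w] averages to one before the loop. A draw costs four steps: test, [Seq], [Draw],
    increment. The counter must differ from array 0, which holds the number of points, and from
    array 1, which receives the draws. *)
Lemma draw_loop (v H m : nat) hi l s T E (g : seq nat -> R) :
  v != 1%N -> v != 0%N -> nmem s 0 0 = m.+1 ->
  (forall s', agree [:: v; 1%N] [::] s s' -> neval s' hi = H) ->
  (forall w s', size w = H -> drawn v s w s' ->
     halts_within T (l, s') /\ g w <= prob T (l, s') E) ->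
  let L := for_loop v (NConst 0) hi (Draw 1 (nvar v) (nvar 0)) in
  halts_within (4 * H + 3 + T) (L :: l, s) /\
  avg m H g <= prob (4 * H + 3 + T) (L :: l, s) E.
Proof.
move=> v1 v0 sz ehi Hl L.
pose W := While (NLt (nvar v) hi)
  (Seq (Draw 1 (nvar v) (nvar 0)) (nassign v (nsucc (nvar v)))).
suff loop k : forall w s1, (size w + k)%N = H -> drawn v s w s1 ->
    halts_within (4 * k + 1 + T) (W :: l, s1) /\
    avg m k (fun w' => g (w ++ w')) <= prob (4 * k + 1 + T) (W :: l, s1) E.
  have [] := loop H [::] (nset s v 0 0) erefl.
    split=> //; last by rewrite /= /upd !eqxx.
    split=> // a; rewrite !inE negb_or => /andP[av _] /=; apply: funext => j.
    by rewrite /upd (negPf av).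
  rewrite (_ : 4 * H + 3 + T = 2 + (4 * H + 1 + T))%N; last lia.
  by move=> h1 h2; split.
elim: k => [|k IH] w s1 ek [fr ev ei].
  rewrite addn0 in ek; have [h1 h2] := Hl w s1 ek (And3 fr ev ei).
  rewrite (_ : 4 * 0 + 1 + T = T.+1)%N /=; last lia.
  by rewrite (ehi _ fr) ev ek ltnn cats0.
rewrite (_ : 4 * k.+1 + 1 + T = (4 * k + 1 + T).+4)%N /=; last lia.
rewrite (ehi _ fr) ev (_ : (size w < H)%N = true) /=; last lia.
have -> : nmem s1 0 0 = m.+1 by rewrite fr.1 ?sz // !inE eq_sym (negPf v0).
have dr (x : nat) : drawn v s (rcons w x)
    (nset (nset s1 1 (size w) x) v 0 (size w).+1).
  split.
  - split=> a; last by move=> h; rewrite /= fr.2.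
    rewrite !inE negb_or => /andP[av a1]; rewrite -fr.1; last first.
      by rewrite !inE negb_or av.
    by apply: funext => j /=; rewrite /upd (negPf av) (negPf a1).
  - by rewrite /= /upd !eqxx size_rcons.
  - move=> i; rewrite size_rcons ltnS leq_eqVlt nth_rcons /= /upd.
    rewrite [X in if X && _ then _ else _]eq_sym (negPf v1) /=.
    by case: ltngtP => //= h _; apply: ei.
have eqv : (v == 1%N) = false by apply/negbTE.
have st (x : nat) : (upd (nmem s1) 1 (size w) x v 0 + 1)%N = (size w).+1.
  by rewrite /upd eqv /= ev addn1.
have szr (x : nat) : (size (rcons w x) + k)%N = H by rewrite size_rcons; lia.
split=> [x|].
  by have := (IH _ _ (szr x) (dr x)).1; rewrite /= ev st.
rewrite ler_pM2l ?invr_gt0 ?ltr0n //; apply: ler_sum => x _.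
have := (IH _ _ (szr x) (dr x)).2; rewrite /= ev st; apply: le_trans.
by apply: le_avg => w' _; rewrite cat_rcons.
Qed.

End DrawLoop.

(** * The program *)

Definition take_cell (v : nat) : cmd :=
  Seq (RSet wT (nvar vt) (RGet wV (nvar v))) (nassign v (nsucc (nvar v))).

Definition merge_step : cmd :=
  If (BAnd (NLt (nvar vleft) (nvar vmiddle))
        (BNot (BAnd (NLt (nvar vright) (nvar vend))
                    (RLt (RGet wV (nvar vright)) (RGet wV (nvar vleft))))))
     (take_cell vleft) (take_cell vright).

Definition merge_init : cmd :=
  Seq (nassign vleft (nvar vbegin))
  (Seq (nassign vmiddle (NAdd (nvar vbegin) (nvar vwidth)))
  (Seq (nassign vright (nvar vmiddle))
       (nassign vend (NAdd (nvar vmiddle) (nvar vwidth))))).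

Definition merge_block : cmd :=
  Seq merge_init
  (Seq (for_loop vt (nvar vbegin) (nvar vend) merge_step)
       (nassign vbegin (nvar vend))).

Definition sort_pass : cmd :=
  Seq (Seq (nassign vbegin (NConst 0)) (nassign vblocks (NHalf (nvar vblocks))))
  (Seq (for_loop vblock (NConst 0) (nvar vblocks) merge_block)
  (Seq (for_loop vt (NConst 0) (nvar vD) (RSet wV (nvar vt) (RGet wT (nvar vt))))
       (nassign vwidth (NAdd (nvar vwidth) (nvar vwidth))))).

Definition merge_sort : cmd :=
  Seq (Seq (nassign vwidth (NConst 1)) (nassign vblocks (nvar vD)))
      (for_loop vpass (NConst 0) (nvar vkD) sort_pass).

Section Sort.
Context {R : realType}.
Implicit Types (s : @store R) (f g : nat -> R).

Definition sorted_on f (b e : nat) : Prop :=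
  forall x y, (b <= x)%N -> (x <= y)%N -> (y < e)%N -> f x <= f y.

(** An inclusion of values suffices in place of a permutation: the sorted array only serves to build
    a net that catches every coordinate. *)
Definition covers f g (b e : nat) : Prop :=
  forall x, (b <= x < e)%N -> exists2 y, (b <= y < e)%N & g y = f x.

Lemma merge_block_spec (b w : nat) s :
  nmem s vbegin 0 = b -> nmem s vwidth 0 = w ->
  sorted_on (rmem s wV) b (b + w) ->
  sorted_on (rmem s wV) (b + w) (b + w + w) ->
  exec merge_block s (w * 20 + 20) (fun s' =>
    [/\ nmem s' vbegin 0 = (b + w + w)%N,
        sorted_on (rmem s' wT) b (b + w + w),
        covers (rmem s wV) (rmem s' wT) b (b + w + w) &
        forall x, ~~ (b <= x < b + w + w)%N -> rmem s' wT x = rmem s wT x]).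
Proof.
move=> eb ew so1 so2.
set s0 := denote merge_init s.
have [e0 w0] : nmem s0 vbegin 0 = b /\ nmem s0 vwidth 0 = w by [].
have i0 : nmem s0 vleft 0 = b by rewrite /s0 /= /upd /= eb.
have e10 : nmem s0 vmiddle 0 = (b + w)%N by rewrite /s0 /= /upd /= eb ew.
have j0 : nmem s0 vright 0 = (b + w)%N by rewrite /s0 /= /upd /= eb ew.
have e20 : nmem s0 vend 0 = (b + w + w)%N by rewrite /s0 /= /upd /= eb ew.
have V0 : rmem s0 = rmem s by [].
apply: (exec_straight_seq (t2 := w * 20 + 10)) => //; last by rewrite /=; lia.
rewrite -/s0; clearbody s0.
(* Position [t] is the next one to be written. Everything written is below everything still to be
   taken, and the consumed entries all occur among the written ones. *)
pose I (t : nat) s' := let i := nmem s' vleft 0 in let j := nmem s' vright 0 in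
  [/\ (b <= i <= b + w)%N, (b + w <= j <= b + w + w)%N & (i + j = t + b + w)%N] /\
  [/\ sorted_on (rmem s' wT) b t,
      forall u, (b <= u < t)%N -> forall x,
        (i <= x < b + w)%N || (j <= x < b + w + w)%N -> rmem s' wT u <= rmem s wV x,
      forall x, (b <= x < i)%N || (b + w <= x < j)%N ->
        exists2 u, (b <= u < t)%N & rmem s' wT u = rmem s wV x &
      forall x, ~~ (b <= x < t)%N -> rmem s' wT x = rmem s wT x].
apply: (exec_seq (t1 := w * 20 + 5) (t2 := 1)); last lia.
apply: (exec_for (I := I) (l := b) (H := (b + w + w)%N) (t := 4)) => //.
- by lia.
- by move=> s' fr /=; rewrite fr.1.
- rewrite /I i0 j0 V0; split; first by split; lia.
  by split=> // [x y|u|x] *; lia.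
- move=> t s' /andP[bt te] fr et [[hi hj hij] [so ub cov out]].
  have e1 : nmem s' vmiddle 0 = (b + w)%N by rewrite fr.1.
  have e2 : nmem s' vend 0 = (b + w + w)%N by rewrite fr.1.
  have V' : rmem s' wV = rmem s wV by rewrite fr.2 // V0.
  move: hi hj hij ub cov; set i := nmem s' vleft 0; set j := nmem s' vright 0.
  move=> hi hj hij ub cov.
  (* Both branches at once: [k] is the head being copied, [i'] and [j'] are the heads afterwards. *)
  have key (k i' j' : nat) (s1 : store) : nmem s1 vleft 0 = i' -> nmem s1 vright 0 = j' ->
      (rmem s1 wT = fun x => if x == t then rmem s wV k else rmem s' wT x) ->
      (k = i /\ i' = i.+1 /\ j' = j \/ k = j /\ i' = i /\ j' = j.+1) ->
      (i' <= b + w)%N -> (j' <= b + w + w)%N ->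
      (forall x, (i <= x < b + w)%N || (j <= x < b + w + w)%N ->
         rmem s wV k <= rmem s wV x) ->
      I t.+1 s1.
    move=> ei' ej' eT hk hi' hj' kmin; rewrite /I ei' ej' eT; split; first by split; lia.
    split.
    - move=> x y bx xy; rewrite ltnS leq_eqVlt => /orP[/eqP yt|yt].
        rewrite yt eqxx; case: eqP => // xt; apply: ub; first lia.
        by case: hk => -[-> [? ?]]; lia.
      by rewrite !ifN; [exact: so|lia|lia].
    - move=> u hu x hx; case: eqP => [_|ut]; first by apply: kmin; lia.
      by apply: ub; lia.
    - move=> x hx; case: (x =P k) => [->|xk].
        by exists t; [lia|rewrite eqxx].
      have [|u hu <-] := cov x; first lia.
      by exists u; [lia|rewrite ifN //; lia].
    - move=> x hx; rewrite ifN; last lia.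
      by apply: out; lia.
  apply: exec_straight => //.
  have eT v : v = vleft \/ v = vright -> rmem (denote (take_cell v) s') wT =
      fun x => if x == t then rmem s wV (nmem s' v 0%N) else rmem s' wT x.
    by move=> hv; apply: funext => x; rewrite /= /upd /= et V'; case: hv => ->.
  have take_i : (i < b + w)%N -> ((j < b + w + w)%N -> rmem s wV i <= rmem s wV j) ->
      I t.+1 (denote (take_cell vleft) s').
    move=> ib hle; apply: (key i i.+1 j) => //.
    + by rewrite /= /upd /= addn1.
    + by rewrite eT //; left.
    + by left.
    + by lia.
    + move=> x /orP[hx|hx]; first by apply: so1; lia.
      apply: (le_trans (hle _)); first lia.
      by apply: so2; lia.
  have take_j : (j < b + w + w)%N -> ((i < b + w)%N -> rmem s wV j <= rmem s wV i) ->
      I t.+1 (denote (take_cell vright) s').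
    move=> jb hle; apply: (key j i j.+1) => //.
    + by rewrite /= /upd /= addn1.
    + by rewrite eT //; right.
    + by right.
    + by lia.
    + move=> x /orP[hx|hx]; last by apply: so2; lia.
      apply: (le_trans (hle _)); first lia.
      by apply: so1; lia.
  have -> : denote merge_step s' =
      if (i < b + w)%N && ~~ ((j < b + w + w)%N && (rmem s wV j < rmem s wV i))
      then denote (take_cell vleft) s' else denote (take_cell vright) s'.
    by rewrite /= e1 e2 V'.
  case: ifP => [/andP[h1 h2]|/negbT h].
    apply: take_i => // jb; move: h2; rewrite jb /= -leNgt; exact.
  have jb : (j < b + w + w)%N.
    rewrite ltnNge; apply/negP => jb; move: h; rewrite (_ : (i < b + w)%N); last lia.
    by rewrite (_ : (j < b + w + w)%N = false) //; lia.
  apply: take_j => // ib; move: h; rewrite ib jb /= negbK; exact: ltW.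
- by lia.
- move=> s1 fr [[hi hj hij] [so ub cov out]].
  apply: exec_straight => //=; split.
  + by rewrite /upd /= fr.1.
  + by [].
  + move=> x hx; have [|u hu eu] := cov x; first lia.
    by exists u.
  + by [].
Qed.

Lemma covers_trans g f h (b e : nat) :
  covers f g b e -> covers g h b e -> covers f h b e.
Proof.
move=> fg gh x /fg[y /gh[z hz <-] <-].
by exists z.
Qed.

Lemma sort_pass_spec (w nb : nat) s :
  (0 < w)%N -> nmem s vwidth 0 = w -> nmem s vblocks 0 = nb.*2 ->
  nmem s vD 0 = (nb * (w + w))%N ->
  (forall q, (q < nb.*2)%N -> sorted_on (rmem s wV) (q * w) (q * w + w)) ->
  exec sort_pass s (30 * (nb * (w + w)) + 30) (fun s' =>
    [/\ nmem s' vwidth 0 = (w + w)%N, nmem s' vblocks 0 = nb,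
        forall q, (q < nb)%N ->
          sorted_on (rmem s' wV) (q * (w + w)) (q * (w + w) + (w + w)) &
        covers (rmem s wV) (rmem s' wV) 0 (nb * (w + w))]).
Proof.
move=> w0 ew enb eD so.
apply: (exec_straight_seq (t2 := 30 * (nb * (w + w)) + 25)) => //=; last by lia.
set s0 := nset _ vblocks 0 _.
have fr0 : agree [:: vbegin; vblocks] [::] s s0.
  split=> // a; rewrite !inE negb_or => /andP[/negPf ab /negPf an].
  by apply: funext => j; rewrite /s0 /= /upd ab an.
have {}enb : nmem s0 vblocks 0 = nb by rewrite /s0 /= /upd /= enb doubleK.
have eb : nmem s0 vbegin 0 = 0%N by [].
have {}ew : nmem s0 vwidth 0 = w by rewrite fr0.1.
have {}eD : nmem s0 vD 0 = (nb * (w + w))%N by rewrite fr0.1.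
have V0 : rmem s0 = rmem s by [].
clearbody s0; rewrite -V0 in so *; clear s fr0 V0; rename s0 into s.
pose I (q : nat) s' := [/\ nmem s' vbegin 0 = (q * (w + w))%N,
  forall q', (q' < q)%N ->
     sorted_on (rmem s' wT) (q' * (w + w)) (q' * (w + w) + (w + w)) &
  covers (rmem s wV) (rmem s' wT) 0 (q * (w + w))].
(* As [w] is positive, [20 w + 23] is at most [22 (w + w)]. *)
have hT : (nb * (w * 20 + 20 + 3) + 3 <= 22 * (nb * (w + w)) + 3)%N.
  rewrite leq_add2r [leqRHS]mulnCA leq_mul2l.
  by apply/orP; right; lia.
apply: (exec_seq (t1 := 22 * (nb * (w + w)) + 3) (t2 := 4 * (nb * (w + w)) + 10));
  last by lia.
apply: (exec_for (I := I) (l := 0%N) (H := nb) (t := (w * 20 + 20)%N)) => //.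
- by move=> s' fr /=; rewrite fr.1.
- move=> q s' /andP[_ qn] fr eq [Ib Iso Icov].
  have V' : rmem s' wV = rmem s wV by rewrite fr.2.
  have w' : nmem s' vwidth 0 = w by rewrite fr.1.
  have so1 : sorted_on (rmem s' wV) (q * (w + w)) (q * (w + w) + w).
    by rewrite V' (_ : q * (w + w) = q.*2 * w)%N; [apply: so|]; lia.
  have so2 : sorted_on (rmem s' wV) (q * (w + w) + w) (q * (w + w) + w + w).
    by rewrite V' (_ : q * (w + w) + w = q.*2.+1 * w)%N; [apply: so|]; lia.
  have := merge_block_spec Ib w' so1 so2; rewrite V' -addnA.
  move=> H; apply: (exec_weaken H) => // s3 fr3 [b3 soB cov1 out1].
  have T' x : (x < q * (w + w))%N -> rmem s3 wT x = rmem s' wT x.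
    by move=> hx; apply: out1; lia.
  rewrite /I mulSn [(w + w + _)%N]addnC; split; first by rewrite b3 addnA.
  + move=> q'; rewrite ltnS leq_eqVlt => /orP[/eqP -> //|q'q].
    have hq : (q' * (w + w) + (w + w) <= q * (w + w))%N.
      by rewrite addnC -mulSn leq_mul2r q'q orbT.
    by move=> x y bx xy ye; rewrite !T'; [apply: (Iso q')|lia|lia].
  + move=> x /andP[_ hx]; case: (ltnP x (q * (w + w))) => hxq.
      have [|y hy ey] := Icov x; first by rewrite hxq.
      by exists y; [lia|rewrite T' //; lia].
    have [|y hy ey] := cov1 x; first by rewrite hxq.
    by exists y => //; lia.
- by rewrite subn0.
move=> s1 fr1 [b1 so1 cov1].
have eD1 : nmem s1 vD 0 = (nb * (w + w))%N by rewrite fr1.1.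
pose J (t : nat) s' := forall x, (x < t)%N -> rmem s' wV x = rmem s1 wT x.
apply: (exec_seq (t1 := 4 * (nb * (w + w)) + 3) (t2 := 1)); last lia.
apply: (exec_for (I := J) (l := 0%N) (H := (nb * (w + w))%N) (t := 1%N)) => //.
- by move=> s' fr /=; rewrite fr.1.
- move=> t s' /andP[_ tn] fr et Jt; apply: exec_straight => // x.
  rewrite ltnS /= /upd /= et; case: eqP => [-> _|xt hx]; first by rewrite fr.2.
  by apply: Jt; lia.
- by lia.
move=> s2 fr2 J2; apply: exec_straight => //=; rewrite /upd /=.
have {}ew : nmem s2 vwidth 0 = w by rewrite fr2.1 // fr1.1.
split; first by rewrite ew.
- by rewrite fr2.1 // fr1.1.
- move=> q qn x y bx xy ye.
  have hq : (q * (w + w) + (w + w) <= nb * (w + w))%N.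
    by rewrite addnC -mulSn leq_mul2r qn orbT.
  by rewrite !J2; [apply: (so1 q)|lia|lia].
- move=> x hx; have [y hy ey] := cov1 x hx.
  by exists y => //; rewrite J2.
Qed.

Lemma merge_sort_spec (k : nat) s :
  nmem s vD 0 = (2 ^ k)%N -> nmem s vkD 0 = k ->
  exec merge_sort s (k.+1 * (70 * 2 ^ k)) (fun s' =>
    sorted_on (rmem s' wV) 0 (2 ^ k) /\ covers (rmem s wV) (rmem s' wV) 0 (2 ^ k)).
Proof.
move=> eD ek.
have k0 : (0 < 2 ^ k)%N by rewrite expn_gt0.
pose I (p : nat) s' := [/\ nmem s' vwidth 0 = (2 ^ p)%N, nmem s' vblocks 0 = (2 ^ (k - p))%N,
  forall q, (q < 2 ^ (k - p))%N -> sorted_on (rmem s' wV) (q * 2 ^ p) (q * 2 ^ p + 2 ^ p)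
  & covers (rmem s wV) (rmem s' wV) 0 (2 ^ k)].
apply: (exec_straight_seq (t2 := (k * (30 * 2 ^ k + 30 + 3) + 3)%N)) => //; last first.
  by rewrite mulSn /= ; nia.
apply: (exec_for (I := I) (l := 0%N) (H := k) (t := 30 * 2 ^ k + 30)) => //.
- by move=> s' fr /=; rewrite fr.1.
- rewrite /I; split; first by [].
  + by rewrite /= /upd /= eD subn0.
  + move=> q _ x y; rewrite expn0 muln1 => bx xy ye.
    by rewrite (_ : x = y) //; lia.
  + by move=> x hx; exists x.
- move=> p s' /andP[_ pk] fr ep [Iw Inb Iso Icov].
  have ekp : (2 ^ (k - p) = (2 ^ (k - p.+1)).*2)%N.
    by rewrite -mul2n -expnS subnSK.
  have e2p : (2 ^ p + 2 ^ p = 2 ^ p.+1)%N by rewrite addnn -mul2n -expnS.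
  have ekk : (2 ^ (k - p.+1) * (2 ^ p + 2 ^ p) = 2 ^ k)%N.
    by rewrite e2p -expnD subnK.
  have p0 : (0 < 2 ^ p)%N by rewrite expn_gt0.
  rewrite ekp in Inb Iso.
  have D' : nmem s' vD 0 = (2 ^ (k - p.+1) * (2 ^ p + 2 ^ p))%N by rewrite fr.1 // ekk.
  have := sort_pass_spec p0 Iw Inb D' Iso; rewrite ekk.
  move=> H; apply: (exec_weaken H) => // s1 _ [h1 h2 h3 h4].
  rewrite /I -e2p; split=> //; exact: covers_trans Icov h4.
- by rewrite subn0.
move=> s' _ [_ _ so cov]; split=> //.
by have := so 0%N; rewrite subnn mul0n add0n; apply.
Qed.

End Sort.

(** * Greedy net of intervals and binary search in it *)

Definition net_step : cmd :=
  If (BAnd (NLt (NConst 0) (nvar vm))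
           (RLt (RGet wV (nvar vt))
                (RAdd (RGet wL (NSub (nvar vm) (NConst 1))) (rvar wh))))
     Skip
     (Seq (RSet wL (nvar vm) (RGet wV (nvar vt))) (nassign vm (nsucc (nvar vm)))).

Definition build_net : cmd :=
  Seq (nassign vm (NConst 0))
      (for_loop vt (NConst 0) (nvar vD) net_step).

Definition search_step : cmd :=
  If (NLt (nvar vlo) (nvar vhi))
     (Seq (nassign vmid (NHalf (NAdd (nvar vlo) (nvar vhi))))
          (If (RLt (rvar wz) (RGet wL (nvar vmid)))
              (nassign vhi (nvar vmid))
              (nassign vlo (nsucc (nvar vmid)))))
     Skip.

Definition search : cmd :=
  Seq (Seq (nassign vlo (NConst 0)) (nassign vhi (nvar vm)))
      (for_loop vround (NConst 0) (nsucc (nvar vkD)) search_step).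

Section Net.
Context {R : realType}.
Implicit Types (s : @store R) (L : nat -> R).

Definition spaced (h : R) L (m : nat) : Prop :=
  forall i, (i.+1 < m)%N -> L i + h <= L i.+1.

Definition netted (h : R) L (m : nat) (x : R) : Prop :=
  exists2 i, (i < m)%N & L i <= x < L i + h.

Definition is_rank L (m : nat) (z : R) (r : nat) : Prop :=
  (r <= m)%N /\ forall i, (i < m)%N -> (i < r)%N = (L i <= z).

Lemma build_net_spec (D : nat) (h : R) s :
  0 < h -> nmem s vD 0 = D -> rmem s wh 0 = h -> sorted_on (rmem s wV) 0 D ->
  exec build_net s (10 * D + 10) (fun s' =>
    let m := nmem s' vm 0 in let L := rmem s' wL in
    [/\ (m <= D)%N, spaced h L m &
        forall x, (x < D)%N -> netted h L m (rmem s wV x)]).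
Proof.
move=> h0 eD eh so.
(* The last clause records that the newest left end is an entry already read; sortedness then puts
   it below the entry under examination. *)
pose I (t : nat) s' := let m := nmem s' vm 0 in let L := rmem s' wL in
  [/\ (m <= t)%N, spaced h L m,
      forall x, (x < t)%N -> netted h L m (rmem s wV x) &
      (0 < m)%N -> exists2 u, (u < t)%N & L m.-1 = rmem s wV u].
apply: (exec_straight_seq (t2 := 10 * D + 5)) => //=; last lia.
apply: (exec_for (I := I) (l := 0%N) (H := D) (t := 7%N)) => //.
- by move=> s' fr /=; rewrite fr.1.
- move=> t s' /andP[_ tD] fr et.
  have V' : rmem s' wV = rmem s wV by rewrite fr.2.
  have h' : rmem s' wh 0 = h by rewrite fr.2.
  rewrite /I; set m := nmem s' vm 0; set L := rmem s' wL.
  move=> [mt sp cov last]; apply: exec_straight => //.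
  have -> : denote net_step s' =
      if (0 < m)%N && (rmem s wV t < L m.-1 + h) then s' else
      nset (rset s' wL m (rmem s wV t)) vm 0 m.+1.
    by rewrite /= V' h' et subn1 addn1.
  case: ifP => [/andP[m0 hlt]|/negbT hn].
    rewrite -/m -/L; split=> //; first by apply: leqW.
      move=> x; rewrite ltnS leq_eqVlt => /orP[/eqP ->|]; last exact: cov.
      exists m.-1; first by rewrite prednK.
      rewrite hlt andbT; have [u ut ->] := last m0.
      by apply: so => //; lia.
    by move=> /last[u ut eu]; exists u => //; exact: leqW.
  rewrite /= /upd /=; set L' := fun j => _.
  have L'L i : (i < m)%N -> L' i = L i by move=> im; rewrite /L' ifN //; lia.
  have L'm : L' m = rmem s wV t by rewrite /L' eqxx.
  split=> //.
  - move=> i; rewrite ltnS => im; rewrite (L'L i im).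
    move: im; rewrite leq_eqVlt => /orP[/eqP em|im]; last by rewrite L'L // sp.
    rewrite em L'm; move: hn; rewrite -em /= -leNgt; exact.
  - move=> x; rewrite ltnS leq_eqVlt => /orP[/eqP ->|xt].
      by exists m => //; rewrite L'm lexx ltrDl.
    by have [i im hi] := cov x xt; exists i; [exact: leqW|rewrite L'L].
  - by exists t.
- by lia.
by move=> s' _ [].
Qed.

Lemma spaced_mono (h : R) L (m : nat) i j : 0 <= h -> spaced h L m ->
  (i <= j)%N -> (j < m)%N -> L i + h * (j - i)%:R <= L j.
Proof.
move=> h0 sp; elim: j => [|j IH]; first by case: i => // _ _; rewrite subnn mulr0 addr0.
rewrite leq_eqVlt => /orP[/eqP -> _|ij jm]; first by rewrite subnn mulr0 addr0.
rewrite subSn // -natr1 mulrDr mulr1 addrA.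
by apply: le_trans (sp j jm); rewrite lerD2r IH //; lia.
Qed.

Lemma search_spec (k m : nat) (h z : R) s :
  0 < h -> nmem s vkD 0 = k -> nmem s vm 0 = m -> (m <= 2 ^ k)%N ->
  spaced h (rmem s wL) m -> rmem s wz 0 = z ->
  exec search s (k.+1 * 20) (fun s' => is_rank (rmem s wL) m z (nmem s' vlo 0)).
Proof.
move=> h0 ek em mk sp ez.
set L := rmem s wL in sp *.
(* After [k] rounds [hi - lo] is at most 1; the extra round brings it to 0. *)
pose I (p : nat) s' := let lo := nmem s' vlo 0 in let hi := nmem s' vhi 0 in
  [/\ (lo <= hi <= m)%N, ((hi - lo) * 2 ^ p <= 2 ^ k)%N,
      forall i, (i < lo)%N -> L i <= z &
      forall i, (hi <= i < m)%N -> z < L i].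
have mono i j : (i <= j)%N -> (j < m)%N -> L i <= L j.
  move=> ij jm; apply: le_trans (spaced_mono (ltW h0) sp ij jm).
  by rewrite lerDl mulr_ge0 // ltW.
apply: (exec_straight_seq (t2 := (k.+1 * 10 + 3)%N)) => //=; last lia.
apply: (exec_for (I := I) (l := 0%N) (H := k.+1) (t := 7%N)) => //.
- by move=> s' fr /=; rewrite fr.1 //= /upd /= ek addn1.
- rewrite /I /= /upd /= em; split => //; first by rewrite expn0 muln1 subn0.
  by move=> i; lia.
- move=> p s' /andP[_ pk] fr ep.
  have L' : rmem s' wL = L by rewrite fr.2.
  have z' : rmem s' wz 0 = z by rewrite fr.2.
  rewrite /I; set lo := nmem s' vlo 0; set hi := nmem s' vhi 0.
  move=> [hlo hd h1 h2]; apply: exec_straight => //.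
  pose mid := ((lo + hi)./2)%N.
  have -> : denote search_step s' =
      if (lo < hi)%N then
        if z < L mid then nset (nset s' vmid 0 mid) vhi 0 mid
        else nset (nset s' vmid 0 mid) vlo 0 mid.+1
      else s'.
    by rewrite /= /upd /= L' z' addn1.
  have emid : (mid = (lo + hi)./2)%N by [].
  have [p1 e2] : (0 < 2 ^ p)%N /\ (2 ^ p.+1 = 2 * 2 ^ p)%N.
    by rewrite expn_gt0 expnS.
  rewrite e2; case: ifP => lohi.
    have mlo : (lo <= mid < hi)%N by lia.
    case: ltP => hz; rewrite /= /upd /= -/lo -/hi.
      split=> //; first by lia.
        have: ((mid - lo) * 2 <= hi - lo)%N by lia.
        move=> hh; apply: leq_trans hd; rewrite mulnA leq_mul2r hh orbT //.
      move=> i /andP[mi im]; apply: (lt_le_trans hz); exact: mono.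
    split=> //; first by lia.
      have: ((hi - mid.+1) * 2 <= hi - lo)%N by lia.
      move=> hh; apply: leq_trans hd; rewrite mulnA leq_mul2r hh orbT //.
    move=> i; rewrite ltnS => im; apply: le_trans hz; apply: mono => //; lia.
  rewrite -/lo -/hi; split=> //.
  by rewrite (_ : hi - lo = 0)%N //; lia.
move=> s' _ [/andP[lohi him] hd h1 h2]; split; first by apply: leq_trans him.
have ehi : nmem s' vhi 0 = nmem s' vlo 0.
  apply/eqP; rewrite eqn_leq lohi andbT; apply: contraTT hd; rewrite -!ltnNge.
  rewrite -subn_gt0 expnS => hd; apply: (@leq_trans (1 * (2 * 2 ^ k))).
    by rewrite mul1n mul2n -addnn -addn1 leq_add2l expn_gt0.
  by rewrite leq_mul2r hd orbT.
move=> i im; apply/idP/idP => [/h1 //|]; apply: contraTT; rewrite -leqNgt -ltNge => hi.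
by apply: h2; rewrite ehi hi.
Qed.

End Net.

(** * Loading the samples and filing them into cells *)

Definition sample_coord (w : nat) : rexp :=
  RGet w (NGet vidx (NAdd (nvar vA) (nvar vsample))).

Definition load : cmd :=
  Seq (rassign wh (RDiv (RNat (NConst 1)) (RNat (nvar vM))))
      (for_loop vsample (NConst 0) (nvar vN)
        (Seq (RSet wV (nvar vsample) (sample_coord wX))
             (RSet wV (NAdd (nvar vN) (nvar vsample)) (sample_coord wY)))).

(* [vbase] tabulates the multiples of [D], since the language cannot multiply
   natural numbers; cell [(u, v)] is stored at index [u * D + v]. *)
Definition make_base : cmd :=
  Seq (nassign vacc (NConst 0))
      (for_loop vsample (NConst 0) (nvar vD)
        (Seq (NSet vbase (nvar vsample) (nvar vacc))
             (nassign vacc (NAdd (nvar vacc) (nvar vD))))).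

Definition search_at (e : rexp) (out : nat) : cmd :=
  Seq (rassign wz e) (Seq search (nassign out (nvar vlo))).

Definition add_to (w : nat) (e : rexp) : cmd :=
  RSet w (nvar vcell) (RAdd (RGet w (nvar vcell)) e).

Definition file_sample : cmd :=
  Seq (nassign vcell (NAdd (NGet vbase (NSub (nvar vkx) (NConst 1)))
                           (NSub (nvar vky) (NConst 1))))
  (Seq (add_to wW (RNat (NConst 1)))
  (Seq (add_to wSX (sample_coord wX)) (add_to wSY (sample_coord wY)))).

Definition locate_step : cmd :=
  Seq (search_at (sample_coord wX) vkx)
  (Seq (search_at (sample_coord wY) vky) file_sample).

Definition locate : cmd :=
  for_loop vsample (NConst 0) (nvar vN) locate_step.

(** The result of [search] as a function of the real alone, so that estimates can be stated without
    reference to a run. *)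
Definition rank {R : realType} (L : nat -> R) (m : nat) (z : R) : nat :=
  count (fun i => L i <= z) (iota 0 m).

Section Cells.
Context {R : realType}.
Implicit Types (s : @store R) (L : nat -> R).

Lemma is_rankE L m z r : is_rank L m z r -> r = rank L m z.
Proof.
move=> [rm hr]; rewrite /rank -(subnKC rm) iotaD count_cat add0n.
rewrite (@eq_in_count _ _ predT) => [|i]; last first.
  by rewrite mem_iota add0n /= => ir; rewrite -hr ?ir //; lia.
rewrite [X in (_ + X)%N](@eq_in_count _ _ pred0) => [|i]; last first.
  rewrite mem_iota /= => ir; rewrite -hr; last lia.
  by apply/negbTE; lia.
by rewrite count_predT count_pred0 size_iota addn0.
Qed.

(** Spacing makes [L] nondecreasing, so the left ends that are at most [z] form an initial
    segment. *)
Lemma rankP (h : R) L m z : 0 <= h -> spaced h L m -> is_rank L m z (rank L m z).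
Proof.
move=> h0; elim: m => [|m IH] sp; first by split.
have [r [rm hr]] : exists r, is_rank L m z r.
  by exists (rank L m z); apply: IH => i im; apply: sp; exact: leqW.
suff [r' hr'] : exists r', is_rank L m.+1 z r' by rewrite -(is_rankE hr').
case: (leP (L m) z) => hz.
  exists m.+1; split=> // i im; rewrite im.
  suff : L i <= z by move=> ->.
  apply: le_trans hz; apply: le_trans (spaced_mono (i := i) h0 sp im (ltnSn m)).
  by rewrite lerDl mulr_ge0.
exists r; split; first exact: leqW.
move=> i; rewrite ltnS leq_eqVlt => /orP[/eqP ->|]; last exact: hr.
by rewrite leNgt hz ltnNge rm.
Qed.

(** Later left ends are at least [h] further right, hence beyond [x]: the interval that contains [x]
    is the last one to start at or before [x]. *)
Lemma is_rank_netted (h : R) L m x r : 0 < h -> spaced h L m ->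
  is_rank L m x r -> netted h L m x -> (r.-1 < m)%N /\ L r.-1 <= x < L r.-1 + h.
Proof.
move=> h0 sp [rm hr] [i im /andP[h1 h2]].
have ir : (i < r)%N by rewrite hr.
suff -> : r.-1 = i by rewrite im h1 h2.
apply/eqP; rewrite eqn_leq andbC -ltnS prednK ?ir ?(leq_ltn_trans _ ir) //=.
rewrite leqNgt; apply/negP => hlt.
have r1m : (r.-1 < m)%N by lia.
have : L r.-1 <= x by rewrite -hr //; lia.
apply/negP; rewrite -ltNge (lt_le_trans h2) //.
apply: le_trans (spaced_mono (ltW h0) sp (ltnW hlt) r1m).
by rewrite lerD2l ler_peMr ?(ltW h0) // ler1n; lia.
Qed.

Variables (M Rr A N D k : nat) (idx : nat -> nat) (X Y : nat -> R).

Definition env s : Prop :=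
  [/\ nmem s vM 0 = M, nmem s vR 0 = Rr, nmem s vA 0 = A & nmem s vN 0 = N] /\
  [/\ nmem s vD 0 = D, nmem s vkD 0 = k, nmem s vidx = idx, rmem s wX = X
    & rmem s wY = Y].

Lemma env_agree na ra s s' : agree na ra s s' ->
  [&& vM \notin na, vR \notin na, vA \notin na, vN \notin na, vD \notin na,
      vkD \notin na, vidx \notin na, wX \notin ra & wY \notin ra] ->
  env s -> env s'.
Proof.
move=> [fn fr] /and5P[h1 h2 h3 h4 /and5P[h5 h6 h7 h8 h9]].
by rewrite /env !fn // !fr.
Qed.

(** The first [A] drawn indices are the anchors; the samples are the [N] that follow. *)
Definition sx (i : nat) : R := X (idx (A + i)%N).
Definition sy (i : nat) : R := Y (idx (A + i)%N).
Let h : R := 1 / M%:R.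

Lemma load_spec s : D = N.*2 -> env s ->
  exec load s (8 * D + 10) (fun s' =>
    [/\ rmem s' wh 0 = h,
        forall i, (i < N)%N -> rmem s' wV i = sx i &
        forall i, (i < N)%N -> rmem s' wV (N + i)%N = sy i]).
Proof.
move=> eD es.
pose I (n : nat) s' := (forall i, (i < n)%N -> rmem s' wV i = sx i) /\
   (forall i, (i < n)%N -> rmem s' wV (N + i)%N = sy i).
apply: (exec_straight_seq (t2 := (N * 6 + 3)%N)) => //=; last by lia.
set s1 := rset s _ _ _.
have es1 : env s1 by [].
have h1 : rmem s1 wh 0 = h by rewrite /s1 /= /upd /=; case: es => -[-> _ _ _] _.
clearbody s1.
apply: (exec_for (I := I) (l := 0%N) (H := N) (t := 3%N)) => //.
- by move=> s' fr /=; rewrite fr.1 //; case: es1 => -[].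
- move=> n s' /andP[_ nN] fr en [I1 I2].
  have [[_ _ eA eN] [_ _ ei eX eY]] := env_agree fr isT es1.
  have E : rmem (denote (Seq (RSet wV (nvar vsample) (sample_coord wX))
             (RSet wV (NAdd (nvar vN) (nvar vsample)) (sample_coord wY))) s') wV =
     fun j => if j == (N + n)%N then sy n else if j == n then sx n else rmem s' wV j.
    by apply: funext => j; rewrite /= /upd /= en eA eN ei eX eY.
  apply: exec_straight => //; rewrite /I E; split=> i; rewrite ltnS => hi.
    rewrite ifN; last lia.
    by case: eqP => [-> //|/eqP ne]; apply: I1; lia.
  rewrite eqn_add2l; case: eqP => [-> //|/eqP ne].
  by rewrite ifN; [apply: I2; lia | lia].
- by rewrite subn0.
- move=> s' fr [I1 I2]; split=> //.
  by rewrite fr.2.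
Qed.

Lemma make_base_spec s : env s ->
  exec make_base s (8 * D + 10) (fun s' =>
    forall u, (u < D)%N -> nmem s' vbase u = (u * D)%N).
Proof.
move=> es.
pose I (n : nat) s' := (forall u, (u < n)%N -> nmem s' vbase u = (u * D)%N) /\
  nmem s' vacc 0 = (n * D)%N.
apply: (exec_straight_seq (t2 := (D * 6 + 3)%N)) => //=; last by lia.
apply: (exec_for (I := I) (l := 0%N) (H := D) (t := 3%N)) => //.
- by move=> s' fr /=; rewrite fr.1 //; case: es => _ [].
- move=> n s' /andP[_ nN] fr en [I1 I2].
  have eD : nmem s' vD 0 = D by rewrite fr.1 //; case: es => _ [].
  apply: exec_straight => //; split=> /=; last by rewrite /upd /= I2 eD mulSn addnC.
  move=> u; rewrite ltnS /upd /= en I2.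
  by case: eqP => [-> //|/eqP ne hu]; apply: I1; lia.
- by rewrite subn0.
- by move=> s' _ [].
Qed.

Lemma search_at_spec (L : nat -> R) (m : nat) (e : rexp) (out : nat) (z : R) s :
  0 < h -> env s -> nmem s vm 0 = m -> (m <= 2 ^ k)%N -> spaced h L m ->
  rmem s wL = L -> reval s e = z ->
  exec (search_at e out) s (k.+1 * 20 + 5) (fun s' =>
    nmem s' out 0 = rank L m z).
Proof.
move=> h0 es em mk sp eL ez.
apply: (exec_straight_seq (t2 := (k.+1 * 20 + 3)%N)) => //=; last lia.
rewrite ez; set s1 := rset _ _ _ _.
have fr1 : agree [::] [:: wz] s s1.
  split=> // a; rewrite inE => /negPf az; apply: funext => j.
  by rewrite /s1 /= /upd az.
apply: (exec_seq (t1 := (k.+1 * 20)%N) (t2 := 1)); last lia.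
have ek : nmem s1 vkD 0 = k by case: es => _ [].
have eL1 : rmem s1 wL = L by rewrite fr1.2.
have := search_spec h0 ek em mk; rewrite eL1 => /(_ z sp)H.
have z1 : rmem s1 wz 0 = z by rewrite /s1 /= /upd eqxx.
apply: (exec_weaken (H z1)) => // s2 fr2 hr.
by apply: exec_straight => //=; rewrite /upd !eqxx /= (is_rankE hr).
Qed.

Variables (L : nat -> R) (m : nat).
Hypotheses (h0 : 0 < h) (mD : (m <= D)%N) (Dk : (D <= 2 ^ k)%N) (spL : spaced h L m).
Hypotheses (netx : forall i, (i < N)%N -> netted h L m (sx i)).
Hypotheses (nety : forall i, (i < N)%N -> netted h L m (sy i)).

Definition kx (i : nat) := (rank L m (sx i)).-1.
Definition ky (i : nat) := (rank L m (sy i)).-1.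

(** For [f] equal to 1, [sx] and [sy] this is the multiplicity of a cell and the two coordinate sums
    whose ratios to it give the centroid. *)
Definition tab (f : nat -> R) (n u v : nat) : R :=
  \sum_(i < n) (if (kx i == u) && (ky i == v) then f i else 0).

Definition env_net s : Prop :=
  [/\ env s, nmem s vm 0 = m, rmem s wL = L &
      forall u, (u < D)%N -> nmem s vbase u = (u * D)%N].

Definition tables (n : nat) s : Prop :=
  forall u v, (u < D)%N -> (v < D)%N ->
  [/\ rmem s wW (u * D + v)%N = tab (fun=> 1) n u v,
      rmem s wSX (u * D + v)%N = tab sx n u v &
      rmem s wSY (u * D + v)%N = tab sy n u v].

Lemma env_net_agree na ra s s' : agree na ra s s' ->
  [&& vM \notin na, vR \notin na, vA \notin na, vN \notin na, vD \notin na,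
      vkD \notin na, vidx \notin na, wX \notin ra & wY \notin ra] ->
  [&& vm \notin na, vbase \notin na & wL \notin ra] ->
  env_net s -> env_net s'.
Proof.
move=> fr h1 /and3P[h2 h3 h4] [es em eL eb].
split; first exact: env_agree fr h1 es.
- by rewrite fr.1.
- by rewrite fr.2.
- by move=> u uD; rewrite fr.1 // eb.
Qed.

Lemma locate_spec s : env_net s -> tables 0 s ->
  exec locate s (N * (k.+1 * 40 + 30) + 3) (tables N).
Proof.
move=> es ts.
apply: (exec_for (I := tables) (l := 0%N) (H := N) (t := (k.+1 * 40 + 20)%N)) => //.
- by move=> s' fr /=; rewrite fr.1 //; case: es => -[] [].
- move=> n s' /andP[_ nN] fr en tn.
  have es' := env_net_agree fr isT isT es.
  have [e1 em eL eb] := es'.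
  have mk : (m <= 2 ^ k)%N := leq_trans mD Dk.
  apply: (exec_seq (t1 := (k.+1 * 20 + 5)%N) (t2 := (k.+1 * 20 + 14)%N)); last lia.
  have ez : reval s' (sample_coord wX) = sx n.
    by rewrite /=; case: e1 => -[_ _ -> _] [_ _ -> -> _]; rewrite en.
  apply: (exec_weaken (search_at_spec vkx h0 e1 em mk spL eL ez)) => // s1 fr1 ekx.
  have es1 := env_net_agree fr1 isT isT es'.
  have [e11 em1 eL1 eb1] := es1.
  have en1 : nmem s1 vsample 0 = n by rewrite fr1.1.
  apply: (exec_seq (t1 := (k.+1 * 20 + 5)%N) (t2 := 8)); last lia.
  have ez1 : reval s1 (sample_coord wY) = sy n.
    by rewrite /=; case: e11 => -[_ _ -> _] [_ _ -> _ ->]; rewrite en1.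
  apply: (exec_weaken (search_at_spec vky h0 e11 em1 mk spL eL1 ez1)) => // s2 fr2 eky.
  have [[[_ _ eA _] [_ _ ei eX eY]] _ _ eb2] := env_net_agree fr2 isT isT es1.
  have en2 : nmem s2 vsample 0 = n by rewrite fr2.1.
  have {}ekx : nmem s2 vkx 0 = rank L m (sx n) by rewrite fr2.1.
  have [kxm _] := is_rank_netted h0 spL (rankP _ (ltW h0) spL) (netx nN).
  have [kym _] := is_rank_netted h0 spL (rankP _ (ltW h0) spL) (nety nN).
  have kxD : (kx n < D)%N := leq_trans kxm mD.
  have kyD : (ky n < D)%N := leq_trans kym mD.
  apply: exec_straight => //.
  set c := (kx n * D + ky n)%N.
  have E : [/\ rmem (denote file_sample s2) wW =
        fun j => if j == c then rmem s2 wW c + 1 else rmem s2 wW j,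
      rmem (denote file_sample s2) wSX =
        fun j => if j == c then rmem s2 wSX c + sx n else rmem s2 wSX j &
      rmem (denote file_sample s2) wSY =
        fun j => if j == c then rmem s2 wSY c + sy n else rmem s2 wSY j].
    have ec : (nmem s2 vbase (nmem s2 vkx 0 - 1) + (nmem s2 vky 0 - 1) = c)%N.
      by rewrite ekx eky !subn1 eb2.
    by split; apply: funext => j; rewrite /= /upd /= ec ?eA ?ei ?eX ?eY ?en2.
  move=> u v uD vD.
  have [E1 E2 E3] := E; rewrite {}E1 {}E2 {}E3.
  (* Division by [D] with remainder recovers a cell from its index. *)
  have ecuv : ((u * D + v)%N == c) = (kx n == u) && (ky n == v).
    apply/eqP/andP => [ee|[/eqP <- /eqP <-] //].
    have D0 : (0 < D)%N by lia.
    have := congr1 (divn^~ D) ee; have := congr1 (modn^~ D) ee.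
    rewrite /c /= !modnMDl !divnMDl // !divn_small // !modn_small // !addn0.
    by move=> -> ->; rewrite !eqxx.
  have [t1 t2 t3] := tn u v uD vD.
  have T w : w != wz -> rmem s2 w = rmem s' w.
    by move=> wwz; rewrite fr2.2 ?fr1.2 //= inE.
  rewrite /tab !big_ord_recr /= -!/(tab _ _ _ _) ecuv.
  case: ifP => [huv|_]; last by rewrite !addr0 !T.
  move: ecuv; rewrite huv => /eqP <-.
  by rewrite !T // t1 t2 t3.
- by rewrite subn0; lia.
Qed.

End Cells.

(** * Scanning the candidates of every anchor *)

Definition rsq (e : rexp) : rexp := RMul e e.

(** In an empty cell the divisions by 0 return 0 and the factor [W] cancels the term, so no test is
    made. *)
Definition term_exp : rexp :=
  let W := RGet wW (nvar vcell) in
  RMul W (RExp (RSub (RNat (NConst 0))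
    (RAdd (rsq (RSub (RDiv (RGet wSX (nvar vcell)) W) (rvar wcx)))
          (rsq (RSub (RDiv (RGet wSY (nvar vcell)) W) (rvar wcy)))))).

Definition estimate : cmd :=
  Seq (rassign wacc (RNat (NConst 0)))
    (for_loop vu (nvar vlox) (nvar vhix)
      (for_loop vv (nvar vloy) (nvar vhiy)
        (Seq (nassign vcell (NAdd (NGet vbase (nvar vu)) (nvar vv)))
             (rassign wacc (RAdd (rvar wacc) term_exp))))).

Definition grid_exp (w v : nat) : rexp :=
  RAdd (RSub (rvar w) (RNat (NConst 4)))
       (RMul (RNat (NConst 8)) (RDiv (RNat (nvar v)) (RNat (nvar vM)))).

Definition keep_best : cmd :=
  If (RLt (rvar wbest) (rvar wacc))
     (Seq (rassign wbest (rvar wacc))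
     (Seq (rassign wbx (rvar wcx)) (rassign wby (rvar wcy))))
     Skip.

Definition try_row : cmd :=
  Seq (rassign wcx (grid_exp wax vi))
      (for_loop vj (NConst 0) (nvar vM)
        (Seq (rassign wcy (grid_exp way vj)) (Seq estimate keep_best))).

Definition find_window : cmd :=
  let r := RNat (nvar vR) in
  Seq (Seq (rassign wax (RGet wX (NGet vidx (nvar va))))
           (rassign way (RGet wY (NGet vidx (nvar va)))))
  (Seq (search_at (RSub (rvar wax) r) vlox)
  (Seq (search_at (RAdd (rvar wax) r) vhix)
  (Seq (search_at (RSub (rvar way) r) vloy)
       (search_at (RAdd (rvar way) r) vhiy)))).

Definition scan : cmd :=
  Seq (rassign wbest (RSub (RNat (NConst 0)) (RNat (NConst 1))))
      (for_loop va (NConst 0) (nvar vA)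
        (Seq find_window (for_loop vi (NConst 0) (nvar vM) try_row))).

Definition cell_term {R : realType} (w x y cx cy : R) : R :=
  w * expR (0 - ((x / w - cx) * (x / w - cx) + (y / w - cy) * (y / w - cy))).

(** The half-length 4 is the distance within which an anchor counts as near the maximizer. Point [i]
    of the grid with [2 M] steps is within one of its steps of point [i./2] of the grid with [M]
    steps, as chaining requires. *)
Definition grid_pt {R : realType} (M : nat) (c : R) (i : nat) : R :=
  c - 4%:R + 8%:R * (i%:R / M%:R).

Section Scan.
Context {R : realType}.
Implicit Types s : @store R.

Variables (M Rr A N D k : nat) (idx : nat -> nat) (X Y : nat -> R).
Variables (L : nat -> R) (m : nat).
Let h : R := 1 / M%:R.
Hypotheses (h0 : 0 < h) (mD : (m <= D)%N) (Dk : (D <= 2 ^ k)%N) (spL : spaced h L m).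

Let T1 := tab A idx X Y L m (fun=> 1) N.
Let TX := tab A idx X Y L m (sx A idx X) N.
Let TY := tab A idx X Y L m (sy A idx Y) N.

Definition window_sum (lox hix loy hiy : nat) (cx cy : R) : R :=
  \sum_(lox <= u < hix) \sum_(loy <= v < hiy)
    cell_term (T1 u v) (TX u v) (TY u v) cx cy.

Definition local_estimate (ax ay cx cy : R) : R :=
  window_sum (rank L m (ax - Rr%:R)) (rank L m (ax + Rr%:R))
             (rank L m (ay - Rr%:R)) (rank L m (ay + Rr%:R)) cx cy.

Definition env_tab s : Prop :=
  env_net M Rr A N D k idx X Y L m s /\ tables A D idx X Y L m N s.

Lemma env_tab_agree na ra s s' : agree na ra s s' ->
  [&& vM \notin na, vR \notin na, vA \notin na, vN \notin na, vD \notin na,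
      vkD \notin na, vidx \notin na, wX \notin ra & wY \notin ra] ->
  [&& vm \notin na, vbase \notin na & wL \notin ra] ->
  [&& wW \notin ra, wSX \notin ra & wSY \notin ra] ->
  env_tab s -> env_tab s'.
Proof.
move=> fr h1 h2 /and3P[h3 h4 h5] [es ts].
split; first exact: env_net_agree fr h1 h2 es.
by move=> u v uD vD; have := ts u v uD vD; rewrite !fr.2.
Qed.

Lemma estimate_spec (lox hix loy hiy : nat) (cx cy : R) s :
  env_tab s -> nmem s vlox 0 = lox -> nmem s vhix 0 = hix ->
  nmem s vloy 0 = loy -> nmem s vhiy 0 = hiy ->
  (lox <= hix <= m)%N -> (loy <= hiy <= m)%N ->
  rmem s wcx 0 = cx -> rmem s wcy 0 = cy ->
  exec estimate s ((hix - lox) * ((hiy - loy) * 8 + 8) + 8) (fun s' =>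
    rmem s' wacc 0 = window_sum lox hix loy hiy cx cy).
Proof.
move=> es e1 e2 e3 e4 hx hy ex ey.
pose t := fun u v => cell_term (T1 u v) (TX u v) (TY u v) cx cy.
pose I (n : nat) s' := rmem s' wacc 0 = \sum_(lox <= u < n) \sum_(loy <= v < hiy) t u v.
apply: (exec_straight_seq (t2 := ((hix - lox) * ((hiy - loy) * 8 + 3 + 3) + 3)%N)) => //=; last lia.
set s1 := rset _ _ _ _.
have fr1 : agree [::] [:: wacc] s s1.
  split=> // a; rewrite inE => /negPf az; apply: funext => j.
  by rewrite /s1 /= /upd az.
have es1 := env_tab_agree fr1 isT isT isT es.
have I1 : I lox s1 by rewrite /I /s1 /= /upd /= big_geq.
have {ex}ex : rmem s1 wcx 0 = cx by [].
have {ey}ey : rmem s1 wcy 0 = cy by [].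
clearbody s1.
apply: (exec_for (I := I) (l := lox) (H := hix) (t := ((hiy - loy) * 8 + 3)%N)) => //.
- by rewrite /= fr1.1.
- by lia.
- by move=> s' fr /=; rewrite fr.1 ?fr1.1.
- move=> u s' /andP[lu uh] fr eu Iu.
  pose J (n : nat) s'' := rmem s'' wacc 0 =
    \sum_(lox <= u < u) \sum_(loy <= v < hiy) t u v + \sum_(loy <= v < n) t u v.
  apply: (exec_for (I := J) (l := loy) (H := hiy) (t := 3%N)) => //.
  + by rewrite /= fr.1 ?fr1.1.
  + by lia.
  + by move=> s'' fr' /=; rewrite fr'.1 // fr.1 // fr1.1.
  + by rewrite /J [X in _ + X]big_geq // addr0.
  + move=> v s'' /andP[lv vh] fr' ev Jv.
    have eu'' : nmem s'' vu 0 = u by rewrite fr'.1.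
    have [[_ _ _ eb] tb] := env_tab_agree fr' isT isT isT
      (env_tab_agree fr isT isT isT es1).
    have uD : (u < D)%N by lia.
    have vD : (v < D)%N by lia.
    have [t1 t2 t3] := tb u v uD vD.
    have ex'' : rmem s'' wcx 0 = cx by rewrite fr'.2 // fr.2.
    have ey'' : rmem s'' wcy 0 = cy by rewrite fr'.2 // fr.2.
    apply: exec_straight => //; rewrite /J /= /upd /= big_nat_recr //=.
    by rewrite eu'' ev eb // t1 t2 t3 ex'' ey'' Jv addrA.
  + by lia.
  + move=> s'' fr' Jv; rewrite /I big_nat_recr //=.
Qed.

(** The left ends counted by the difference lie in a half-open interval of length at most [2 Rr] and
    are at least [1 / M] apart; its open end is why [2 Rr M] needs no added 1. *)
Lemma window_width (z1 z2 : R) : z1 <= z2 <= z1 + 2%:R * Rr%:R ->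
  (rank L m z1 <= rank L m z2 <= m)%N /\
  (rank L m z2 - rank L m z1 <= 2 * Rr * M)%N.
Proof.
move=> /andP[z12 zR].
have [r1 h1] := rankP z1 (ltW h0) spL; have [r2 h2] := rankP z2 (ltW h0) spL.
move: r1 h1 r2 h2; set a := rank L m z1; set b := rank L m z2 => am ha bm hb.
have ab : (a <= b)%N.
  rewrite leqNgt; apply/negP => ba; have bm' : (b < m)%N := leq_trans ba am.
  have : L b <= z2 by apply: le_trans z12; rewrite -ha.
  by rewrite -hb // ltnn.
rewrite ab bm; split=> //.
case: (ltnP a b) => [{}ab|]; last by lia.
have e1 : z1 < L a by rewrite ltNge -ha ?ltnn //; lia.
have e2 : L b.-1 <= z2 by rewrite -hb; lia.
have := spaced_mono (ltW h0) spL (_ : a <= b.-1)%N (_ : b.-1 < m)%N.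
move=> /(_ ltac:(lia) ltac:(lia)) e3.
have M0 : 0 < M%:R :> R by move: h0; rewrite /h mul1r invr_gt0.
have : (b.-1 - a)%:R < 2%:R * Rr%:R * M%:R :> R.
  rewrite -ltr_pdivrMr // mulrC -[M%:R^-1]mul1r -/h; lra.
by rewrite -!natrM ltr_nat; lia.
Qed.

Let px a := X (idx a).
Let py a := Y (idx a).

Definition cand_value (a i j : nat) : R :=
  local_estimate (px a) (py a) (grid_pt M (px a) i) (grid_pt M (py a) j).

Definition window (a : nat) s : Prop :=
  [/\ nmem s vlox 0 = rank L m (px a - Rr%:R), nmem s vhix 0 = rank L m (px a + Rr%:R),
      nmem s vloy 0 = rank L m (py a - Rr%:R) & nmem s vhiy 0 = rank L m (py a + Rr%:R)]
  /\ rmem s wax 0 = px a /\ rmem s way 0 = py a.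

Lemma window_agree na ra a s s' : agree na ra s s' ->
  [&& vlox \notin na, vhix \notin na, vloy \notin na & vhiy \notin na] ->
  (wax \notin ra) && (way \notin ra) -> window a s -> window a s'.
Proof.
move=> [fn fr] /and4P[h1 h2 h3 h4] /andP[h5 h6].
by rewrite /window !fn // !fr.
Qed.

Lemma find_window_spec (a : nat) s : env_tab s -> nmem s va 0 = a ->
  exec find_window s (k.+1 * 80 + 40) (window a).
Proof.
move=> es ea.
have mk : (m <= 2 ^ k)%N := leq_trans mD Dk.
apply: (exec_straight_seq (t2 := k.+1 * 80 + 30)%N) => //; last by rewrite /=; lia.
have := denote_frame (c := Seq (rassign wax (RGet wX (NGet vidx (nvar va))))
  (rassign way (RGet wY (NGet vidx (nvar va))))) s isT.
set s1 := denote _ _ => fr1.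
have x1 : rmem s1 wax 0 = px a /\ rmem s1 way 0 = py a.
  case: es => -[[_ [_ _ ei eX eY]] _ _ _] _.
  by rewrite /s1 /= /upd /= ea ei eX eY.
have {es ea}es : env_tab s1 := env_tab_agree fr1 isT isT isT es.
clearbody s1; case: x1 => x1 y1.
have [e1 em1 eL1 _] := es.1.
have R1 : nmem s1 vR 0 = Rr by case: e1 => -[].
apply: (exec_seq (t1 := k.+1 * 20 + 5) (t2 := k.+1 * 60 + 20)%N); last lia.
apply: (exec_weaken (search_at_spec vlox h0 e1 em1 mk spL eL1 erefl)) => // s2 fr2 E1.
rewrite /= x1 R1 in E1.
have es2 := env_tab_agree fr2 isT isT isT es; have [e2 em2 eL2 _] := es2.1.
have R2 : nmem s2 vR 0 = Rr by case: e2 => -[].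
have x2 : rmem s2 wax 0 = px a by rewrite fr2.2.
have y2 : rmem s2 way 0 = py a by rewrite fr2.2.
apply: (exec_seq (t1 := k.+1 * 20 + 5) (t2 := k.+1 * 40 + 12)%N); last lia.
apply: (exec_weaken (search_at_spec vhix h0 e2 em2 mk spL eL2 erefl)) => // s3 fr3 E2.
rewrite /= x2 R2 in E2.
have es3 := env_tab_agree fr3 isT isT isT es2; have [e3 em3 eL3 _] := es3.1.
have R3 : nmem s3 vR 0 = Rr by case: e3 => -[].
have x3 : rmem s3 wax 0 = px a by rewrite fr3.2.
have y3 : rmem s3 way 0 = py a by rewrite fr3.2.
apply: (exec_seq (t1 := k.+1 * 20 + 5) (t2 := k.+1 * 20 + 5)%N); last lia.
apply: (exec_weaken (search_at_spec vloy h0 e3 em3 mk spL eL3 erefl)) => // s4 fr4 E3.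
rewrite /= y3 R3 in E3.
have es4 := env_tab_agree fr4 isT isT isT es3; have [e4 em4 eL4 _] := es4.1.
have R4 : nmem s4 vR 0 = Rr by case: e4 => -[].
have x4 : rmem s4 wax 0 = px a by rewrite fr4.2.
have y4 : rmem s4 way 0 = py a by rewrite fr4.2.
apply: (exec_weaken (search_at_spec vhiy h0 e4 em4 mk spL eL4 erefl)) => // s5 fr5 E4.
rewrite /= y4 R4 in E4.
split; last by rewrite !fr5.2.
split=> //.
- by rewrite fr5.1 // fr4.1 // fr3.1.
- by rewrite fr5.1 // fr4.1.
- by rewrite fr5.1.
Qed.

(* The visited candidates are those preceding [(a, i, j)] lexicographically;
   the initial value -1 lies below every estimate. *)
Definition best_so_far (a i j : nat) s : Prop :=
  (forall a' i' j', (i' < M)%N -> (j' < M)%N ->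
     [|| a' < a, (a' == a) && (i' < i) | [&& a' == a, i' == i & j' < j]]%N ->
     cand_value a' i' j' <= rmem s wbest 0) /\
  (rmem s wbest 0 = -1 \/ exists a' i' j', [/\ [&& a' < A, i' < M & j' < M]%N,
     rmem s wbest 0 = cand_value a' i' j',
     rmem s wbx 0 = grid_pt M (px a') i' & rmem s wby 0 = grid_pt M (py a') j']).

Lemma keep_best_spec a i j s : (a < A)%N -> (i < M)%N -> (j < M)%N ->
  rmem s wacc 0 = cand_value a i j ->
  rmem s wcx 0 = grid_pt M (px a) i -> rmem s wcy 0 = grid_pt M (py a) j ->
  best_so_far a i j s -> best_so_far a i j.+1 (denote keep_best s).
Proof.
move=> aA iM jM eacc ex ey [h1 h2].
have seen a' i' j' : [|| a' < a, (a' == a) && (i' < i) |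
    [&& a' == a, i' == i & j' < j.+1]]%N ->
    [|| a' < a, (a' == a) && (i' < i) | [&& a' == a, i' == i & j' < j]]%N \/
    [/\ a' = a, i' = i & j' = j].
  rewrite ltnS [(j' <= j)%N]leq_eqVlt => /or3P[->|->|].
  - by left.
  - by left; rewrite orbT.
  - move=> /and3P[/eqP -> /eqP -> /orP[/eqP ->|->]]; first by right.
    by left; rewrite !eqxx !orbT.
rewrite /keep_best [denote _ _]/= eacc; case: ltP => hlt.
  split; rewrite /= /upd /= ?eacc.
    move=> a' i' j' hi hj /seen[hs|[-> -> ->] //].
    by apply: le_trans (ltW hlt); exact: h1.
  by right; exists a, i, j; rewrite aA iM jM.
by split=> // a' i' j' hi hj /seen[hs|[-> -> ->] //]; apply: h1.
Qed.

Lemma best_agree na ra a i j s s' : agree na ra s s' ->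
  [&& wbest \notin ra, wbx \notin ra & wby \notin ra] ->
  best_so_far a i j s -> best_so_far a i j s'.
Proof. by move=> [_ fr] /and3P[h1 h2 h3]; rewrite /best_so_far !fr. Qed.

Let w := (2 * Rr * M)%N.
Let te := (w * (w * 8 + 8) + 8)%N.

Lemma try_row_spec a i s : (a < A)%N -> (i < M)%N -> nmem s vi 0 = i ->
  env_tab s -> window a s -> best_so_far a i 0 s ->
  exec try_row s (M * (te + 20) + 10) (best_so_far a i M).
Proof.
move=> aA iM ei es ws bs.
apply: (exec_straight_seq (t2 := (M * (te + 12 + 3) + 3)%N)) => //; last by rewrite /=; lia.
have := denote_frame (c := rassign wcx (grid_exp wax vi)) s isT.
set s1 := denote _ _ => fr1.
have x1 : rmem s1 wcx 0 = grid_pt M (px a) i.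
  by rewrite /s1 /= /upd /= ei ws.2.1; case: es => -[[[-> _ _ _] _] _ _ _] _.
have {}es := env_tab_agree fr1 isT isT isT es.
have {}ws := window_agree fr1 isT isT ws.
have {}bs := best_agree fr1 isT bs.
clearbody s1; clear fr1 ei s.
apply: (exec_for (I := best_so_far a i) (l := 0%N) (H := M) (t := (te + 12)%N)) => //.
- by move=> s' fr; have [[[[]]]] := env_tab_agree fr isT isT isT es.
- move=> j s' /andP[_ jM] fr ej bj.
  apply: (exec_straight_seq (t2 := (te + 8)%N)) => //; last by rewrite /=; lia.
  have := denote_frame (c := rassign wcy (grid_exp way vj)) s' isT.
  set s2 := denote _ _ => fr2.
  have ws' := window_agree fr isT isT ws.
  have es' := env_tab_agree fr isT isT isT es.
  have y2 : rmem s2 wcy 0 = grid_pt M (py a) j.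
    by rewrite /s2 /= /upd /= ej ws'.2.2; case: es' => -[[[-> _ _ _] _] _ _ _] _.
  have x2 : rmem s2 wcx 0 = grid_pt M (px a) i by rewrite fr2.2 // fr.2.
  have es2 := env_tab_agree fr2 isT isT isT es'.
  have [[w1 w2 w3 w4] _] := window_agree fr2 isT isT ws'.
  have b2 := best_agree fr2 isT bj.
  apply: (exec_seq (t1 := te) (t2 := 7)); last lia.
  have [|hx wx] := @window_width (px a - Rr%:R) (px a + Rr%:R).
    by have := ler0n R Rr; lra.
  have [|hy wy] := @window_width (py a - Rr%:R) (py a + Rr%:R).
    by have := ler0n R Rr; lra.
  have := estimate_spec es2 w1 w2 w3 w4 hx hy x2 y2.
  move=> H; apply: (exec_weaken H) => [|s3 fr3 E].
    by rewrite /te leq_add2r leq_mul // leq_add2r leq_mul2r wy orbT.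
  apply: exec_straight => //.
  apply: keep_best_spec => //.
  + by rewrite fr3.2.
  + by rewrite fr3.2.
  + exact: best_agree fr3 isT b2.
- by rewrite subn0.
Qed.

Lemma scan_spec s : (0 < A)%N -> env_tab s ->
  exec scan s (A * (k.+1 * 80 + M * (M * (te + 20) + 15) + 60) + 10) (fun s' =>
    exists a i j, [/\ [&& a < A, i < M & j < M]%N,
      rmem s' wbx 0 = grid_pt M (px a) i, rmem s' wby 0 = grid_pt M (py a) j &
      forall a' i' j', [&& a' < A, i' < M & j' < M]%N ->
        cand_value a' i' j' <= cand_value a i j]).
Proof.
move=> A0 es.
pose tr := (M * (te + 20) + 10)%N.
apply: (exec_straight_seq (t2 := (A * ((k.+1 * 80 + 40 + (M * (tr + 3) + 3)).+1 + 3) + 3)%N)) => //;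
  last by rewrite /= /tr; nia.
have := denote_frame (c := rassign wbest (RSub (RNat (NConst 0)) (RNat (NConst 1)))) s isT.
set s1 := denote _ _ => fr1.
have b1 : best_so_far 0 0 0 s1.
  split; first by move=> a i j _ _; rewrite !ltn0 !andbF.
  by left; rewrite /s1 /= /upd /= sub0r.
have {}es := env_tab_agree fr1 isT isT isT es.
clearbody s1; clear fr1 s.
apply: (exec_for (I := fun a => best_so_far a 0 0) (l := 0%N) (H := A)
  (t := (k.+1 * 80 + 40 + (M * (tr + 3) + 3)).+1)) => //.
- by move=> s' fr; have [[[[]]]] := env_tab_agree fr isT isT isT es.
- move=> a s' /andP[_ aA] fr ea ba.
  have es' := env_tab_agree fr isT isT isT es.
  apply: (exec_seq (t1 := k.+1 * 80 + 40) (t2 := (M * (tr + 3) + 3)%N)); last lia.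
  apply: (exec_weaken (find_window_spec es' ea)) => // s2 fr2 ws.
  have es2 := env_tab_agree fr2 isT isT isT es'.
  have b2 := best_agree fr2 isT ba.
  apply: (exec_for (I := fun i => best_so_far a i 0) (l := 0%N) (H := M) (t := tr)) => //.
  + by move=> s3 fr3; have [[[[]]]] := env_tab_agree fr3 isT isT isT es2.
  + move=> i s3 /andP[_ iM] fr3 ei bi.
    have es3 := env_tab_agree fr3 isT isT isT es2.
    have ws3 := window_agree fr3 isT isT ws.
    apply: (exec_weaken (try_row_spec aA iM ei es3 ws3 bi)) => // s4 _ [c1 c2].
    split=> // a' i' j' hi hj hseen; apply: c1 => //.
    move: hseen; rewrite ltn0 !andbF orbF ltnS [(i' <= i)%N]leq_eqVlt hj andbT.
    by move=> /orP[->|/andP[-> /orP[->|->]]]; rewrite ?orbT.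
  + by rewrite subn0.
  + move=> s3 _ [c1 c2]; split=> // a' i' j' hi hj hseen; apply: c1 => //.
    move: hseen; rewrite !ltn0 !andbF !orbF ltnS leq_eqVlt hi andbT.
    by move=> /orP[->|->]; rewrite ?orbT.
- by rewrite subn0.
move=> s' _ [c1 c2].
(* With [M = 0] the width [h = 1 / M] would be 0. *)
have M0 : (0 < M)%N.
  by rewrite lt0n; apply: contraTN h0 => /eqP M0; rewrite /h M0 invr0 mulr0 ltxx.
have val0 a i j : 0 <= cand_value a i j.
  apply: sumr_ge0 => u _; apply: sumr_ge0 => v _; rewrite mulr_ge0 ?expR_ge0 //.
  by apply: sumr_ge0 => n _; case: ifP.
have best0 : 0 <= rmem s' wbest 0.
  by apply: le_trans (val0 0%N 0%N 0%N) _; apply: c1 => //; rewrite A0.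
case: c2 => [e|[a [i [j [h1 h2 h3 h4]]]]]; first by move: best0; rewrite e ler0N1.
exists a, i, j; split=> // a' i' j' /and3P[ha hi hj].
by rewrite -h2; apply: c1 => //; rewrite ha.
Qed.

End Scan.

(** * The deterministic phase as a whole *)

Definition process : cmd :=
  Seq load (Seq merge_sort (Seq build_net (Seq make_base (Seq locate (Seq scan
    (Seq (RSet 0 (NConst 0) (rvar wbx)) (RSet 0 (NConst 1) (rvar wby)))))))).

(** Reals cannot be converted to naturals, so a size is found by doubling until it reaches the real.
    The exponent is recorded because that of the sample size gives the number of rounds of sorting
    and searching. *)
Definition pow2_above (v kv : nat) (e : rexp) : cmd :=
  Seq (Seq (nassign v (NConst 1)) (nassign kv (NConst 0)))
      (While (RLt (RNat (nvar v)) e)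
         (Seq (nassign v (NAdd (nvar v) (nvar v))) (nassign kv (nsucc (nvar kv))))).

Section Process.
Context {R : realType}.
Implicit Types s : @store R.

Variables (M Rr A N k : nat) (idx : nat -> nat) (X Y : nat -> R).

Let h : R := 1 / M%:R.
Let w := (2 * Rr * M)%N.
Let te := (w * (w * 8 + 8) + 8)%N.

(** All that the accuracy proof learns about a run: some net catches the samples, and the output
    maximizes the estimates built on that net. *)
Definition process_post s' : Prop :=
  exists (L : nat -> R) (m : nat),
  [/\ spaced h L m,
      forall i, (i < N)%N -> netted h L m (sx A idx X i),
      forall i, (i < N)%N -> netted h L m (sy A idx Y i) &
      exists a i j, [/\ [&& a < A, i < M & j < M]%N,
      rmem s' 0 0 = grid_pt M (X (idx a)) i, rmem s' 0 1 = grid_pt M (Y (idx a)) j &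
      forall a' i' j', [&& a' < A, i' < M & j' < M]%N ->
        cand_value M Rr A N idx X Y L m a' i' j' <=
        cand_value M Rr A N idx X Y L m a i j]].

Lemma process_spec s : (0 < M)%N -> (0 < A)%N -> (2 ^ k = N.*2)%N ->
  env M Rr A N (2 ^ k) k idx X Y s ->
  (forall w, w \in [:: wW; wSX; wSY] -> rmem s w = fun=> 0) ->
  exec process s (k.+1 * (200 * 2 ^ k) +
     A * (k.+1 * 80 + M * (M * (te + 20) + 15) + 60) + 100) process_post.
Proof.
move=> M0 A0 eD es z0.
have h0 : 0 < h by rewrite /h divr_gt0 // ltr0n.
set ts := (A * _)%N.
have D0 : (0 < 2 ^ k)%N by rewrite expn_gt0.
apply: (exec_seq (t1 := 8 * 2 ^ k + 10)
  (t2 := (k.+1 * (180 * 2 ^ k) + ts + 80)%N)); last nia.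
apply: (exec_weaken (load_spec eD es)) => // s1 fr1 [eh V1x V1y].
have {}es := env_agree fr1 isT es.
have {}z0 u : u \in [:: wW; wSX; wSY] -> rmem s1 u = fun=> 0.
  move=> hu; rewrite fr1.2 ?z0 //.
  by move: hu; rewrite !inE => /or3P[] /eqP ->.
clear fr1 s.
apply: (exec_seq (t1 := k.+1 * (70 * 2 ^ k))
  (t2 := (k.+1 * (100 * 2 ^ k) + ts + 70)%N)); last nia.
have [eD1 ek1] : nmem s1 vD 0 = (2 ^ k)%N /\ nmem s1 vkD 0 = k by case: es => _ [].
apply: (exec_weaken (merge_sort_spec eD1 ek1)) => // s2 fr2 [so cov].
have {}es := env_agree fr2 isT es.
have {}z0 u : u \in [:: wW; wSX; wSY] -> rmem s2 u = fun=> 0.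
  move=> hu; rewrite fr2.2 ?z0 //.
  by move: hu; rewrite !inE => /or3P[] /eqP ->.
have {}eh : rmem s2 wh 0 = h by rewrite fr2.2.
clear fr2 eD1 ek1.
apply: (exec_seq (t1 := (10 * 2 ^ k + 10)%N)
  (t2 := (k.+1 * (80 * 2 ^ k) + ts + 50)%N)); last nia.
have eD2 : nmem s2 vD 0 = (2 ^ k)%N by case: es => _ [].
apply: (exec_weaken (build_net_spec h0 eD2 eh so)) => // s3 fr3 [].
set m := nmem s3 vm 0; set L := rmem s3 wL => mD sp net.
have {}es := env_agree fr3 isT es.
have {}z0 u : u \in [:: wW; wSX; wSY] -> rmem s3 u = fun=> 0.
  move=> hu; rewrite fr3.2 ?z0 //.
  by move: hu; rewrite !inE => /or3P[] /eqP ->.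
have netx i : (i < N)%N -> netted h L m (sx A idx X i).
  move=> iN; have [|j /net hj ej] := cov i; first by rewrite eD; lia.
  by rewrite -V1x // -ej.
have nety i : (i < N)%N -> netted h L m (sy A idx Y i).
  move=> iN; have [|j /net hj ej] := cov (N + i)%N; first by rewrite eD; lia.
  by rewrite -V1y // -ej.
clear fr3 eD2 eh.
apply: (exec_seq (t1 := (8 * 2 ^ k + 10)%N)
  (t2 := (k.+1 * (70 * 2 ^ k) + ts + 40)%N)); last nia.
apply: (exec_weaken (make_base_spec es)) => // s4 fr4 eb.
have {}es := env_agree fr4 isT es.
have {}z0 u : u \in [:: wW; wSX; wSY] -> rmem s4 u = fun=> 0.
  by move=> hu; rewrite fr4.2 ?z0.
have en : env_net M Rr A N (2 ^ k) k idx X Y L m s4.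
  by split=> //; [rewrite fr4.1|rewrite fr4.2].
have t0 : tables A (2 ^ k) idx X Y L m 0 s4.
  by move=> u v _ _; rewrite /tab !big_ord0 !z0 // !inE.
apply: (exec_seq (t1 := (N * (k.+1 * 40 + 30) + 3)%N)
  (t2 := (ts + 20)%N)); last by nia.
apply: (exec_weaken (locate_spec h0 mD (leqnn _) sp netx nety en t0)) => // s5 fr5 tN.
have {}en := env_net_agree fr5 isT isT en.
apply: (exec_seq (t1 := (ts + 10)%N) (t2 := 5)); last lia.
apply: (exec_weaken (scan_spec h0 mD (leqnn _) sp A0 (conj en tN))) => // s6 fr6.
move=> [a [i [j [hb hx hy hmax]]]].
apply: exec_straight => //; exists L, m; split=> //.
by exists a, i, j.
Qed.

End Process.

Lemma pow2_above_spec {R : realType} (v kv J : nat) (e : rexp) (x : R)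
    (s : @store R) :
  v != kv -> (forall s', rmem s' = rmem s -> reval s' e = x) ->
  x <= (2 ^ J)%:R -> (forall j, (j < J)%N -> (2 ^ j)%:R < x) ->
  exec (pow2_above v kv e) s (J * 5 + 10) (fun s' =>
    nmem s' v 0 = (2 ^ J)%N /\ nmem s' kv 0 = J).
Proof.
move=> vkv ee xJ minJ.
pose I (n : nat) (s' : @store R) := [/\ (n <= J)%N, nmem s' v 0 = (2 ^ (J - n))%N &
   nmem s' kv 0 = (J - n)%N].
have nvk : (kv == v) = false by rewrite eq_sym; apply/negbTE.
have nkv : (v == kv) = false by apply/negbTE.
apply: (exec_straight_seq (t2 := (J * 5).+1)) => //=; last by lia.
set s1 := nset _ kv 0 _.
have rs1 : rmem s1 = rmem s by [].
have I1 : I J s1 by rewrite /I /s1 /= /upd subnn nkv !eqxx.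
clearbody s1.
have step_I n s' : frame (Seq (nassign v (NAdd (nvar v) (nvar v)))
      (nassign kv (nsucc (nvar kv)))) s1 s' -> I n s' ->
   if beval s' (RLt (RNat (nvar v)) e) then
     exists2 n', n = n'.+1 & exec (Seq (nassign v (NAdd (nvar v) (nvar v)))
      (nassign kv (nsucc (nvar kv)))) s' 4 (I n') else True.
  move=> fr [nJ ev ek]; case: ifP => //=; rewrite ev ee; last first.
    by rewrite -rs1; apply: funext => a; rewrite fr.2.
  case: n nJ ev ek => [|n] nJ ev ek; first by rewrite subn0 ltNge xJ.
  move=> _; exists n => //; apply: exec_straight => //.
  have eJ : (J - n = (J - n.+1).+1)%N by lia.
  rewrite /I eJ /= /upd !eqxx nkv nvk /= ev ek; split; first exact: ltnW.
    by rewrite addnn -mul2n -expnS.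
  by rewrite addn1.
apply: (exec_weaken (exec_while I1 step_I)) => // s' fr [].
rewrite [beval _ _]/= ee; last by rewrite -rs1; apply: funext => a; rewrite fr.2.
move=> h1 [n [nJ [_ ev ek]]]; suff n0 : n = 0%N by rewrite ev ek n0 subn0.
apply/eqP; rewrite -leqn0 leqNgt; apply/negP => n0; move/negP: h1; apply.
by rewrite ev; apply: minJ; lia.
Qed.

(** * Choice of the sizes and the complete program *)

Definition peps : rexp := RGet 0 (NConst 0).
Definition prho : rexp := RGet 0 (NConst 1).
Definition pdelta : rexp := RGet 0 (NConst 2).
Definition rnat (n : nat) : rexp := RNat (NConst n).
(** The language has no square root; on positive arguments this is one. *)
Definition rsqrt (e : rexp) : rexp := RExp (RDiv (RLn e) (rnat 2)).
Definition log_inv (e : rexp) : rexp := RLn (RDiv (rnat 1) e).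

(** The net width is [1 / M] and the grid step [8 / M]; 256 makes [eps * M ^+ 2] at least [2 ^+ 16],
    which turns both into errors of order [eps]. *)
Definition exp_M : rexp := RDiv (rnat 256) (rsqrt peps).
(** The radius of the window. It is such that the factor [expR (- (Rr - 5) ^+ 2 / 2)], lost outside,
    is at most [eps / 128]. *)
Definition exp_R : rexp :=
  rsqrt (RAdd (rnat 80) (RMul (rnat 4) (log_inv peps))).
(** An anchor is near the maximizer with probability at least [rho / 2]; this many anchors all miss
    with probability at most [delta / 2]. *)
Definition exp_A : rexp :=
  RDiv (RMul (rnat 4) (RAdd (rnat 1) (log_inv pdelta))) prho.
(** [RExp (rnat 40)] is at least [2 ^ 40] with a small literal: 33 comes from the Bernstein exponent
    and 7 from the confidence [2 ^+ 7] times the sum of logarithms. The logarithm of [1 / rho] pays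
    for the union over the anchors. *)
Definition exp_N : rexp :=
  RDiv (RMul (RExp (rnat 40))
          (RAdd (rnat 1) (RAdd (log_inv prho) (log_inv pdelta))))
       (RMul (RMul peps peps) prho).

Definition setup : cmd :=
  Seq (pow2_above vM vkM exp_M)
  (Seq (pow2_above vR vkR exp_R)
  (Seq (pow2_above vA vkA exp_A)
  (Seq (pow2_above vN vkN exp_N)
       (Seq (nassign vD (NAdd (nvar vN) (nvar vN)))
            (nassign vkD (nsucc (nvar vkN))))))).

Definition draw_indices : cmd :=
  for_loop vdraw (NConst 0) (NAdd (nvar vA) (nvar vN))
    (Draw vidx (nvar vdraw) (nvar 0)).

(** For [eps >= 1] every output is good, and for [rho > 1] the premise fails since a density is at
    most 1; both cases stop at once. Elsewhere the logarithms of [1 / eps] and [1 / rho] are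
    nonnegative. *)
Definition mode_finder : cmd :=
  If (BAnd (RLt peps (rnat 1)) (BNot (RLt (rnat 1) prho)))
     (Seq setup (Seq draw_indices process))
     Skip.

Section Run.
Context {R : realType}.
Implicit Types s : @store R.

Lemma prob_ge0 T c (E : store -> Prop) : 0 <= prob T c E :> R.
Proof.
elim: T c => [|T IH] c /=; case: (step c) => // m f.
by rewrite mulr_ge0 ?invr_ge0 ?ler0n // sumr_ge0.
Qed.

Definition real_M (eps : R) : R := 256%:R / expR (ln eps / 2%:R).
Definition real_R (eps : R) : R := expR (ln (80%:R + 4%:R * ln (1 / eps)) / 2%:R).
Definition real_A (rho delta : R) : R := 4%:R * (1 + ln (1 / delta)) / rho.
Definition real_N (eps rho delta : R) : R :=
  expR 40%:R * (1 + (ln (1 / rho) + ln (1 / delta))) / (eps * eps * rho).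

Definition least_pow2 (x : R) (J : nat) : Prop :=
  x <= (2 ^ J)%:R /\ forall j, (j < J)%N -> (2 ^ j)%:R < x.

Lemma least_pow2_exists x : exists J, least_pow2 x J.
Proof.
have ex : exists J, x <= (2 ^ J)%:R.
  exists (Num.truncn x).+1; apply: ltW.
  apply: lt_le_trans (truncnS_gt x) _.
  by rewrite ler_nat ltnW // ltn_expl.
exists (ex_minn ex); case: ex_minnP => J xJ minJ; split=> // j jJ.
by rewrite ltNge; apply: contraL jJ => /minJ; rewrite -leqNgt.
Qed.

Variables (eps rho delta : R) (kM kR kA kN : nat).
Hypothesis hM : least_pow2 (real_M eps) kM.
Hypothesis hR : least_pow2 (real_R eps) kR.
Hypothesis hA : least_pow2 (real_A rho delta) kA.
Hypothesis hN : least_pow2 (real_N eps rho delta) kN.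
Let M := (2 ^ kM)%N.
Let Rr := (2 ^ kR)%N.
Let A := (2 ^ kA)%N.
Let N := (2 ^ kN)%N.

Lemma setup_spec (s0 : seq 'rV[R]_2) :
  exec setup (input eps rho delta s0) (kM * 5 + kR * 5 + kA * 5 + kN * 5 + 50)
    (fun s' => [/\ nmem s' vM 0 = M, nmem s' vR 0 = Rr, nmem s' vA 0 = A & nmem s' vN 0 = N]
       /\ nmem s' vD 0 = (2 ^ kN.+1)%N /\ nmem s' vkD 0 = kN.+1).
Proof.
set s := input _ _ _ _.
have [hM1 hM2] := hM; have [hR1 hR2] := hR; have [hA1 hA2] := hA.
have [hN1 hN2] := hN.
apply: (exec_seq (t1 := kM * 5 + 10) (t2 := kR * 5 + kA * 5 + kN * 5 + 38)%N); last lia.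
have rs1 s' : rmem s' = rmem s -> reval s' exp_M = real_M eps by move=> /= ->.
apply: (exec_weaken (pow2_above_spec (v := vM) (kv := vkM) isT rs1 hM1 hM2)) => // s1 fr1 [e1 _].
apply: (exec_seq (t1 := kR * 5 + 10) (t2 := kA * 5 + kN * 5 + 27)%N); last lia.
have r1 : rmem s1 = rmem s by apply: funext => a; rewrite fr1.2.
have rs2 s' : rmem s' = rmem s1 -> reval s' exp_R = real_R eps by rewrite r1 => /= ->.
apply: (exec_weaken (pow2_above_spec (v := vR) (kv := vkR) isT rs2 hR1 hR2)) => // s2 fr2 [e2 _].
apply: (exec_seq (t1 := kA * 5 + 10) (t2 := kN * 5 + 16)%N); last lia.
have r2 : rmem s2 = rmem s by rewrite -r1; apply: funext => a; rewrite fr2.2.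
have rs3 s' : rmem s' = rmem s2 -> reval s' exp_A = real_A rho delta by rewrite r2 => /= ->.
apply: (exec_weaken (pow2_above_spec (v := vA) (kv := vkA) isT rs3 hA1 hA2)) => // s3 fr3 [e3 _].
apply: (exec_seq (t1 := kN * 5 + 10) (t2 := 5)%N); last lia.
have r3 : rmem s3 = rmem s by rewrite -r2; apply: funext => a; rewrite fr3.2.
have rs4 s' : rmem s' = rmem s3 -> reval s' exp_N = real_N eps rho delta by rewrite r3 => /= ->.
apply: (exec_weaken (pow2_above_spec (v := vN) (kv := vkN) isT rs4 hN1 hN2)) => // s4 fr4 [e4 e5].
apply: exec_straight => //=; rewrite /upd /= e4 e5 addn1 addnn -mul2n -expnS.
split=> //; split=> //.
- by rewrite fr4.1 // fr3.1 // fr2.1.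
- by rewrite fr4.1 // fr3.1.
- by rewrite fr4.1.
Qed.

Let w := (2 * Rr * M)%N.
Let te := (w * (w * 8 + 8) + 8)%N.

(** Independent of the number of points, since only the drawn ones are read. *)
Definition run_time : nat :=
  (kM * 5 + kR * 5 + kA * 5 + kN * 5 + 60) + 4 * (A + N) +
  (kN.+2 * (200 * 2 ^ kN.+1) +
     A * (kN.+2 * 80 + M * (M * (te + 20) + 15) + 60) + 100).

Definition point_coord (s0 : seq 'rV[R]_2) (j : 'I_2) (i : nat) : R :=
  (nth 0 s0 i) ord0 j.

Lemma start_accept (s0 : seq 'rV[R]_2) T E : eps < 1 -> rho <= 1 ->
  prob T.+2 (start mode_finder eps rho delta s0) E =
    prob T ([:: setup; Seq draw_indices process], input eps rho delta s0) E /\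
  (halts_within T ([:: setup; Seq draw_indices process], input eps rho delta s0) ->
   halts_within T.+2 (start mode_finder eps rho delta s0)).
Proof. by move=> e1 r1 /=; rewrite e1 ltNge r1. Qed.

(** Reduces probability on runs to counting: [good] speaks of the drawn sequence only, and after the
    draws the run is deterministic, so the event has conditional probability 1 on good sequences. *)
Lemma run_spec (s0 : seq 'rV[R]_2) (good : seq nat -> bool) E :
  eps < 1 -> rho <= 1 -> s0 != [::] ->
  (forall u idx s', size u = (A + N)%N ->
     (forall i, (i < A + N)%N -> idx i = nth 0%N u i) ->
     process_post M Rr A N idx (point_coord s0 ord0) (point_coord s0 ord_max) s' ->
     good u -> E s') ->
  halts_within run_time (start mode_finder eps rho delta s0) /\
  avg (size s0).-1 (A + N) (fun u => (good u)%:R) <=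
    prob run_time (start mode_finder eps rho delta s0) E.
Proof.
move=> e1 r1 s00 goodE.
have [k1 [s1 [hk1 st1 fr1 [[m1 m2 m3 m4] [m5 m6]]]]] := setup_spec s0.
pose tp := (kN.+2 * (200 * 2 ^ kN.+1) +
     A * (kN.+2 * 80 + M * (M * (te + 20) + 15) + 60) + 100)%N.
have [T [eT tT]] : exists T,
    (run_time = (k1 + (4 * (A + N) + 3 + T).+1).+2)%N /\ (tp <= T)%N.
  exists (run_time - (k1 + (4 * (A + N) + 3)).+3)%N.
  by rewrite /run_time -/tp; split; lia.
rewrite eT.
have [-> hh] := start_accept s0 (k1 + (4 * (A + N) + 3 + T).+1) E e1 r1.
rewrite (step_prob _ _ (st1 _)).
have hd := @draw_loop R vdraw (A + N) (size s0).-1 (NAdd (nvar vA) (nvar vN)) [:: process] s1 T E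
  (fun u => (good u)%:R) isT isT.
have sz : nmem s1 0 0 = (size s0).-1.+1.
  by rewrite fr1.1 //= prednK // lt0n size_eq0.
have ehi s' : agree [:: vdraw; vidx] [::] s1 s' -> neval s' (NAdd (nvar vA) (nvar vN)) = (A + N)%N.
  by move=> fr /=; rewrite !fr.1 // m3 m4.
have body u s' : size u = (A + N)%N -> drawn vdraw s1 u s' ->
    halts_within T ([:: process], s') /\ (good u)%:R <= prob T ([:: process], s') E.
  move=> su [fr _ hu].
  have es : env M Rr A N (2 ^ kN.+1) kN.+1 (nmem s' vidx) (point_coord s0 ord0) (point_coord s0 ord_max) s'.
    split; first by rewrite !fr.1.
    split=> //; first by rewrite fr.1.
    - by rewrite fr.1.
    - by rewrite fr.2 // fr1.2.
    - by rewrite fr.2 // fr1.2.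
  have z0 v : v \in [:: wW; wSX; wSY] -> rmem s' v = fun=> 0.
    by rewrite !inE => /or3P[] /eqP ->; rewrite fr.2 // fr1.2.
  have M0 : (0 < M)%N by rewrite expn_gt0.
  have A0 : (0 < A)%N by rewrite expn_gt0.
  have e2 : (2 ^ kN.+1 = N.*2)%N by rewrite expnS mul2n.
  have [h1 h2] := exec_final (process_spec M0 A0 e2 es z0) tT.
  split=> //; case: (boolP (good u)) => gu; last exact: prob_ge0.
  by rewrite h2 // => s2; move=> H; apply: (goodE u (nmem s' vidx)) => // i; rewrite -su; apply: hu.
have [g1 g2] := hd sz ehi body.
split; last exact: g2.
apply: hh; apply: (step_halts (st1 _)); exact: g1.
Qed.

Lemma start_reject (s0 : seq 'rV[R]_2) : ~~ ((eps < 1) && (rho <= 1)) ->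
  halts_within 2 (start mode_finder eps rho delta s0) /\
  forall E, E (input eps rho delta s0) ->
    prob 2 (start mode_finder eps rho delta s0) E = 1.
Proof.
rewrite leNgt => h /=; rewrite (negPf h) /=; split=> // E hE.
by rewrite asboolT.
Qed.

End Run.

(** * Gaussian estimates and concentration *)

Section Gauss.
Context {R : realType}.
Implicit Types (u v a b x y : R).

(** [expR x <= 1 / (1 - x)], and multiplying the right-hand side by [1 - x] gives
    [1 + x ^+ 2 * (1 - 2 * x)]. Large negative [x] are included. *)
Lemma expR_le_quadratic x : x <= 2^-1 -> expR x <= 1 + x + 2 * x ^+ 2.
Proof.
move=> hx.
have h1 : 0 < 1 - x by lra.
have h2 : 1 - x <= expR (- x) by apply: expR_ge1Dx.
have : expR x <= (1 - x)^-1.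
  by rewrite -[x]opprK expRN opprK lef_pV2 ?posrE ?expR_gt0.
move/le_trans; apply.
rewrite -[leLHS]mul1r ler_pdivrMr //; nra.
Qed.

Lemma expR_nat_ge (n : nat) : (2 ^ n)%:R <= expR n%:R :> R.
Proof.
rewrite -[n%:R]mulr1 mulrC -[1 * _]mulrC expRM_natl natrX.
by rewrite lerXn2r ?nnegrE ?expR_ge0 // (le_trans _ (expR_ge1Dx 1)) //; lra.
Qed.

Definition gk u v : R := expR (- (u ^+ 2 + v ^+ 2)).
(** The square root of [gk], a Gaussian of twice the variance. Writing [gk] as [gkw] squared leaves
    one factor to absorb polynomials or distance. *)
Definition gkw u v : R := expR (- (u ^+ 2 + v ^+ 2) / 2).

Lemma gk_ge0 u v : 0 <= gk u v. Proof. exact: expR_ge0. Qed.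
Lemma gk_le1 u v : gk u v <= 1.
Proof. by rewrite -expR0 ler_expR; have := sqr_ge0 u; have := sqr_ge0 v; lra. Qed.
Lemma gkw_ge0 u v : 0 <= gkw u v. Proof. exact: expR_ge0. Qed.
Lemma gkw_le1 u v : gkw u v <= 1.
Proof. by rewrite -expR0 ler_expR; have := sqr_ge0 u; have := sqr_ge0 v; lra. Qed.

(* With [a <= b] the two exponents, the difference is at most
   [(b - a) exp (- a)], and [b <= 2 a + 4 e ^+ 2]. *)
Lemma gk_lipschitz u v u' v' e : `|u - u'| <= e -> `|v - v'| <= e -> e <= 4 ->
  (gk u v - gk u' v') ^+ 2 <= 268 * e ^+ 2 * (gk u v + gk u' v').
Proof.
wlog hab : u v u' v' / u ^+ 2 + v ^+ 2 <= u' ^+ 2 + v' ^+ 2.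
  move=> H hu hv he; case: (leP (u ^+ 2 + v ^+ 2) (u' ^+ 2 + v' ^+ 2)) => hab.
    exact: H.
  rewrite -sqrrN opprB [_ + gk u' v']addrC.
  by apply: H (ltW hab) _ _ he; rewrite distrC.
move=> hu hv he; rewrite /gk.
have e0 : 0 <= e := le_trans (normr_ge0 _) hu.
have {}hu : (u - u') ^+ 2 <= e ^+ 2 by rewrite -[_ ^+ 2]real_normK ?num_real // lerXn2r ?nnegrE.
have {}hv : (v - v') ^+ 2 <= e ^+ 2 by rewrite -[_ ^+ 2]real_normK ?num_real // lerXn2r ?nnegrE.
set a := u ^+ 2 + v ^+ 2 in hab *; set b := u' ^+ 2 + v' ^+ 2 in hab *.
have a0 : 0 <= a by rewrite addr_ge0 ?sqr_ge0.
have hb : b <= 2 * a + 4 * e ^+ 2.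
  have h1 := sqr_ge0 (2 * u - u'); have h2 := sqr_ge0 (2 * v - v').
  rewrite /a /b; nra.
have hd : (b - a) ^+ 2 <= 4 * e ^+ 2 * (a + b).
  have -> : b - a = - ((u - u') * (u + u') + (v - v') * (v + v')) by rewrite /a /b; ring.
  set p := u - u' in hu *; set q := v - v' in hv *.
  have h1 : (p * (u + u')) ^+ 2 <= e ^+ 2 * (u + u') ^+ 2.
    by rewrite exprMn ler_wpM2r ?sqr_ge0.
  have h2 : (q * (v + v')) ^+ 2 <= e ^+ 2 * (v + v') ^+ 2.
    by rewrite exprMn ler_wpM2r ?sqr_ge0.
  have h3 : e ^+ 2 * ((u + u') ^+ 2 + (v + v') ^+ 2) <= e ^+ 2 * (2 * (a + b)).
    apply: ler_wpM2l; first exact: sqr_ge0.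
    have h3 := sqr_ge0 (u - u'); have h4 := sqr_ge0 (v - v'); rewrite /a /b; nra.
  have h4 := sqr_ge0 (p * (u + u') - q * (v + v')).
  rewrite sqrrN; nra.
have E : expR (- b) = expR (- a) * expR (- (b - a)) by rewrite -expRD; congr expR; ring.
set x := expR (- a) in E *; have x0 : 0 < x by exact: expR_gt0.
have x1 : x * (1 + a) <= 1.
  have := expR_ge1Dx a; rewrite /x expRN => h.
  by rewrite mulrC ler_pdivrMr ?expR_gt0 // mul1r.
have y0 : 0 <= expR (- b) by exact: expR_ge0.
have y1 : expR (- b) <= x by rewrite ler_expR lerN2.
have y2 : x - expR (- b) <= x * (b - a).
  have := expR_ge1Dx (- (b - a)); rewrite E => h; nra.
have e16 : e ^+ 2 <= 16 by nra.
have h1 : (x - expR (- b)) ^+ 2 <= (x * (b - a)) ^+ 2.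
  rewrite lerXn2r ?nnegrE //; first lra.
  by rewrite mulr_ge0 ?(ltW x0) // subr_ge0.
apply: (le_trans h1); rewrite exprMn.
(* Here [a + b <= 3 a + 4 e ^+ 2] and [e <= 4]. Then [x (1 + a) <= 1] bounds [x (3 a + 64)] by 67,
   and 268 is 4 times 67. *)
have h2 : x ^+ 2 * (b - a) ^+ 2 <= x ^+ 2 * (4 * e ^+ 2 * (3 * a + 64)).
  apply: ler_wpM2l; first exact: sqr_ge0.
  apply: (le_trans hd); apply: ler_wpM2l; first by rewrite mulr_ge0 ?sqr_ge0.
  lra.
apply: (le_trans h2).
have h3 : x * (3 * a + 64) <= 67 by nra.
have -> : x ^+ 2 * (4 * e ^+ 2 * (3 * a + 64)) = (4 * e ^+ 2 * x) * (x * (3 * a + 64)) by ring.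
have h4 : 0 <= 4 * e ^+ 2 * x by rewrite !mulr_ge0 ?sqr_ge0 // ltW.
apply: (@le_trans _ _ (4 * e ^+ 2 * x * 67)); first exact: ler_wpM2l.
have h5 : 0 <= e ^+ 2 * expR (- b) by rewrite mulr_ge0 ?sqr_ge0.
nra.
Qed.

End Gauss.

Section Concentration.
Context {R : realType}.
Variable m : nat.

Definition mean (f : nat -> R) : R := m.+1%:R^-1 * \sum_(v < m.+1) f v.

Lemma le_mean f g : (forall v, f v <= g v) -> mean f <= mean g.
Proof.
by move=> h; rewrite ler_wpM2l ?invr_ge0 ?ler0n //; apply: ler_sum => v _; exact: h.
Qed.

Lemma meanD f g : mean (fun v => f v + g v) = mean f + mean g.
Proof. by rewrite /mean big_split mulrDr. Qed.

Lemma meanZ c f : mean (fun v => c * f v) = c * mean f.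
Proof. by rewrite /mean -mulr_sumr mulrCA. Qed.

Lemma meanB f g : mean (fun v => f v - g v) = mean f - mean g.
Proof. by rewrite /mean big_split sumrN mulrDr mulrN. Qed.

Lemma mean_sum (I : finType) (F : I -> nat -> R) :
  mean (fun v => \sum_i F i v) = \sum_i mean (F i).
Proof. by rewrite /mean exchange_big mulr_sumr. Qed.

Lemma mean_cst c : mean (fun=> c) = c.
Proof.
by rewrite /mean sumr_const card_ord -[c *+ _]mulr_natl mulKf // pnatr_eq0.
Qed.

(** The exponential moment method, with the parameter [l] left free for the caller:
    [expR (l f) <= 1 + l f + 2 (l f) ^+ 2] costs [2 l ^+ 2 V] per draw, half of the [4 l ^+ 2 V]
    gained from the deviation. *)
Lemma bernstein (f : nat -> R) (b V l : R) (N : nat) :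
  (forall v, `|f v| <= b) -> mean (fun v => f v ^+ 2) <= V -> 0 <= l ->
  l * b <= 2^-1 ->
  avg m N (fun w => (N%:R * (mean f + 4 * l * V) < \sum_(v <- w) f v)%R%:R) <=
  expR (- (2 * N%:R * l ^+ 2 * V)).
Proof.
move=> fb fV l0 lb.
(* With this [c] the product of exponentials is at least 1 whenever the deviation occurs. *)
pose c := l * mean f + 4 * l ^+ 2 * V.
apply: (@le_trans _ _ (avg m N (fun w => \prod_(v <- w) expR (l * f v - c)))).
  apply: le_avg => w sw; rewrite -expR_sum.
  case: ltP => h /=; last exact: expR_ge0.
  rewrite -expR0 ler_expR big_split /= -mulr_sumr sumrN.
  rewrite big_const_seq count_predT sw iter_addr_0 -mulr_natl.
  have : l * (N%:R * (mean f + 4 * l * V)) <= l * \sum_(v <- w) f v.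
    by apply: ler_wpM2l => //; exact: ltW.
  by rewrite /c; nra.
rewrite avg_prod -/(mean (fun v => expR (l * f v - c))).
have -> : - (2 * N%:R * l ^+ 2 * V) = N%:R * (- (2 * l ^+ 2 * V)) by ring.
rewrite expRM_natl lerXn2r ?nnegrE ?expR_ge0 //.
  by rewrite mulr_ge0 ?invr_ge0 ?ler0n // sumr_ge0 // => v _; exact: expR_ge0.
have -> : mean (fun v => expR (l * f v - c)) = expR (- c) * mean (fun v => expR (l * f v)).
  by rewrite -meanZ; congr (_ * _); apply: eq_bigr => v _; rewrite -expRD addrC.
have h1 : mean (fun v => expR (l * f v)) <= 1 + l * mean f + 2 * l ^+ 2 * V.
  apply: (@le_trans _ _ (mean (fun v => (1 + l * f v) + 2 * l ^+ 2 * f v ^+ 2))).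
    apply: le_mean => v; have hlf : l * f v <= 2^-1.
      apply: le_trans lb; apply: ler_wpM2l => //.
      exact: le_trans (ler_norm _) (fb v).
    by apply: le_trans (expR_le_quadratic hlf) _; rewrite exprMn mulrA.
  rewrite !meanD mean_cst !meanZ lerD2l.
  by apply: ler_wpM2l => //; rewrite mulr_ge0 ?sqr_ge0.
apply: (@le_trans _ _ (expR (- c) * expR (l * mean f + 2 * l ^+ 2 * V))).
  rewrite ler_wpM2l ?expR_ge0 //; apply: le_trans h1 _.
  by rewrite -addrA; exact: expR_ge1Dx.
by rewrite -expRD ler_expR /c; nra.
Qed.

End Concentration.

(** * The density near its maximum *)

Section Mixture.
Context {R : realType}.
Implicit Types (u x y : R).

Lemma gkE u x : gk u x = expR (- u ^+ 2) * expR (- x ^+ 2).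
Proof. by rewrite /gk opprD expRD. Qed.

(** Compares [expR (- z ^+ 2)] with [2 ^ (- z)], whose sum over both signs is 3; the induction
    carries the missing tail [2 * (2 ^+ Z)^-1]. *)
Lemma gauss_lattice_sum (Z : nat) :
  \sum_(i < Z.*2.+1) expR (- (i%:R - Z%:R) ^+ 2) <= 3 :> R.
Proof.
suff H : \sum_(i < Z.*2.+1) expR (- (i%:R - Z%:R) ^+ 2) <= 3 - 2 * (2 ^+ Z)^-1 :> R.
  by apply: le_trans H _; rewrite lerBlDr lerDl mulr_ge0 // invr_ge0 exprn_ge0.
elim: Z => [|Z IH].
  by rewrite big_ord1 subrr expr0n oppr0 expR0 expr0 invr1 mulr1; lra.
have tail : expR (- (Z.+1%:R) ^+ 2) <= (2 ^+ Z.+1)^-1 :> R.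
  rewrite expRN lef_pV2 ?posrE ?expR_gt0 ?exprn_gt0 //.
  apply: (@le_trans _ _ (expR Z.+1%:R)).
    by have := @expR_nat_ge R Z.+1; rewrite natrX.
  by rewrite ler_expR -natrX ler_nat expnS expn1 leq_pmulr.
rewrite doubleS big_ord_recl big_ord_recr /=.
have -> : \sum_(i < Z.*2.+1) expR (- ((bump 0 i)%:R - Z.+1%:R) ^+ 2) =
          \sum_(i < Z.*2.+1) expR (- (i%:R - Z%:R) ^+ 2) :> R.
  apply: eq_bigr => i _; congr (expR (- _ ^+ 2)).
  by rewrite /bump /= -[Z.+1]add1n !natrD; ring.
have -> : (0 - Z.+1%:R) ^+ 2 = Z.+1%:R ^+ 2 :> R by rewrite sub0r sqrrN.
have -> : ((bump 0 Z.*2.+1)%:R - Z.+1%:R) ^+ 2 = Z.+1%:R ^+ 2 :> R.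
  by congr (_ ^+ 2); rewrite /bump /= -addnn -natrB; [congr (_%:R)|]; lia.
have e : (2 ^+ Z)^-1 = 2 * (2 ^+ Z.+1)^-1 :> R.
  by rewrite exprS invfM mulVKf.
rewrite e in IH; lra.
Qed.

(* [u ^+ 2 / 2 <= z ^+ 2 + (u - z) ^+ 2 <= u ^+ 2 / 2 + 1 / 2] for the integer
   [z] nearest to [u / 2]. *)
Lemma wide_gauss_le (Z : nat) u : `|u| <= Z%:R ->
  expR (- u ^+ 2 / 2) <=
  2 * \sum_(i < Z.*2.+1) expR (- (i%:R - Z%:R) ^+ 2) * expR (- (u - (i%:R - Z%:R)) ^+ 2).
Proof.
rewrite ler_norml => /andP[uZ1 uZ2].
(* Truncating [r] rounds [u / 2] to the nearest integer, in the indexing shifted by [Z]. *)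
pose r := u / 2 + Z%:R + 2^-1.
have r0 : 0 <= r by rewrite /r; lra.
have /andP[h1 h2] := truncn_itv r0.
have hi : (Num.truncn r < Z.*2.+1)%N.
  rewrite -(ltr_nat R); apply: le_lt_trans h1 _.
  by rewrite -addnn -addn1 !natrD /r; lra.
rewrite (bigD1 (Ordinal hi)) //= mulrDr.
set z := _ - Z%:R.
have hz : (z - u / 2) ^+ 2 <= 4^-1.
  have {}h2 : r < (Num.truncn r)%:R + 1 by rewrite natr1.
  have [e1 e2] : z - u / 2 <= 2^-1 /\ - 2^-1 <= z - u / 2.
    rewrite /z /=; move: h1 h2; move: (Num.truncn r)%:R => t; rewrite /r => h1 h2.
    by split; lra.
  nra.
rewrite -expRD; apply: (@le_trans _ _ (2 * expR (- z ^+ 2 + - (u - z) ^+ 2))); last first.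
  rewrite lerDl mulr_ge0 // sumr_ge0 // => i _; by rewrite mulr_ge0 ?expR_ge0.
have h3 : expR 2^-1 <= 2 :> R by apply: le_trans (expR_le_quadratic (lexx _)) _; lra.
apply: (@le_trans _ _ (expR 2^-1 * expR (- z ^+ 2 + - (u - z) ^+ 2))); last first.
  by rewrite ler_wpM2r ?expR_ge0.
rewrite -expRD ler_expR; nra.
Qed.

Variables (m : nat) (X Y : nat -> R).

Definition mix x y : R := mean m (fun v => gk (X v - x) (Y v - y)).
Definition mixw x y : R := mean m (fun v => gkw (X v - x) (Y v - y)).

Variables (top xs ys : R).
Hypothesis mix_le : forall x y, mix x y <= top.
Hypothesis mix_top : mix xs ys = top.

Lemma top_ge0 : 0 <= top.
Proof.
by rewrite -mix_top mulr_ge0 ?invr_ge0 ?ler0n // sumr_ge0 // => v _; exact: gk_ge0.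
Qed.

Lemma bounded_by_nat (f : nat -> R) : exists Z : nat, forall v, (v < m.+1)%N -> `|f v| <= Z%:R.
Proof.
exists (\sum_(v < m.+1) (Num.truncn `|f v|).+1)%N => v vm.
apply: (@le_trans _ _ (Num.truncn `|f v|).+1%:R); first exact/ltW/truncnS_gt.
by rewrite ler_nat (bigD1 (Ordinal vm)) //= leq_addr.
Qed.

(** Per axis, a factor 2 from [wide_gauss_le] and a lattice sum at most 3: 36 is the square of 6.
    The lattice is cut at a radius [Z] that reaches all points, and the bound does not depend on
    it. *)
Lemma mixw_le x y : mixw x y <= 36 * top.
Proof.
have [Z1 h1] := bounded_by_nat (fun v => X v - x).
have [Z2 h2] := bounded_by_nat (fun v => Y v - y).
pose Z := (Z1 + Z2)%N.
pose z (i : 'I_(Z.*2.+1)) : R := i%:R - Z%:R.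
pose a i := expR (- z i ^+ 2).
have a0 i : 0 <= a i by exact: expR_ge0.
have hv (v : nat) : (v < m.+1)%N -> gkw (X v - x) (Y v - y) <=
    \sum_i \sum_j 4 * a i * a j * gk (X v - (x + z i)) (Y v - (y + z j)).
  move=> vm; have hx : `|X v - x| <= Z%:R.
    by apply: le_trans (h1 v vm) _; rewrite ler_nat leq_addr.
  have hy : `|Y v - y| <= Z%:R.
    by apply: le_trans (h2 v vm) _; rewrite ler_nat leq_addl.
  rewrite /gkw opprD mulrDl expRD.
  apply: le_trans (ler_pM (expR_ge0 _) (expR_ge0 _) (wide_gauss_le hx) (wide_gauss_le hy)) _.
  rewrite mulrACA big_distrlr /= mulr_sumr; apply: ler_sum => i _.
  rewrite mulr_sumr; apply: ler_sum => j _.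
  rewrite gkE !opprD !addrA -/(z i) -/(z j) /a.
  by rewrite le_eqVlt; apply/orP; left; apply/eqP; ring.
apply: (@le_trans _ _ (\sum_i \sum_j 4 * a i * a j * mix (x + z i) (y + z j))).
  have -> : \sum_i \sum_j 4 * a i * a j * mix (x + z i) (y + z j) =
     mean m (fun v => \sum_i \sum_j 4 * a i * a j * gk (X v - (x + z i)) (Y v - (y + z j))).
    rewrite mean_sum; apply: eq_bigr => i _; rewrite mean_sum; apply: eq_bigr => j _.
    by rewrite -meanZ.
  by rewrite ler_wpM2l ?invr_ge0 ?ler0n //; apply: ler_sum => v _; rewrite hv.
apply: (@le_trans _ _ (\sum_i \sum_j 4 * a i * a j * top)).
  by apply: ler_sum => i _; apply: ler_sum => j _; rewrite ler_wpM2l ?mulr_ge0.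
have -> : \sum_i \sum_j 4 * a i * a j * top = 4 * ((\sum_i a i) * (\sum_j a j)) * top.
  rewrite big_distrlr /= mulr_sumr mulr_suml; apply: eq_bigr => i _.
  by rewrite mulr_sumr mulr_suml; apply: eq_bigr => j _; rewrite !mulrA.
apply: ler_wpM2r; first exact: top_ge0.
have ha : \sum_i a i <= 3 := gauss_lattice_sum Z.
have ha0 : 0 <= \sum_i a i by apply: sumr_ge0.
nra.
Qed.

Definition near_top (v : nat) : bool := (`|X v - xs| <= 4) && (`|Y v - ys| <= 4).

(** At distance 4 or more the kernel is at most [expR (- 8) <= 1 / 256] times the wide one, so far
    points contribute at most [36 / 256] of [top]; a near point contributes at most 1. *)
Lemma near_top_mass : top / 2 <= mean m (fun v => (near_top v)%:R).
Proof.
have e8 : expR (- 8) <= 256^-1 :> R.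
  rewrite expRN lef_pV2 ?posrE ?expR_gt0 //.
  by have := @expR_nat_ge R 8; rewrite (_ : 2 ^ 8 = 256)%N.
have hv v : gk (X v - xs) (Y v - ys) <=
    (near_top v)%:R + 256^-1 * gkw (X v - xs) (Y v - ys).
  have far : 16 <= (X v - xs) ^+ 2 + (Y v - ys) ^+ 2 ->
      gk (X v - xs) (Y v - ys) <= 256^-1 * gkw (X v - xs) (Y v - ys).
    move=> hf; apply: (@le_trans _ _ (expR (- 8) * gkw (X v - xs) (Y v - ys))).
      by rewrite /gk /gkw -expRD ler_expR; lra.
    by rewrite ler_wpM2r ?gkw_ge0.
  rewrite /near_top; case: (leP `|X v - xs| 4) => hx /=; last first.
    rewrite add0r far //; have := sqr_ge0 (Y v - ys).
    have : 16 <= (X v - xs) ^+ 2 by rewrite -[_ ^+ 2]real_normK ?num_real //; nra.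
    lra.
  case: (leP `|Y v - ys| 4) => hy /=.
    by apply: le_trans (gk_le1 _ _) _; rewrite lerDl mulr_ge0 ?gkw_ge0 // invr_ge0.
  rewrite add0r far //; have := sqr_ge0 (X v - xs).
  have : 16 <= (Y v - ys) ^+ 2 by rewrite -[_ ^+ 2]real_normK ?num_real //; nra.
  lra.
have : top <= mean m (fun v => (near_top v)%:R) + 256^-1 * mixw xs ys.
  by rewrite -{1}mix_top -meanZ -meanD; apply: le_mean.
have := mixw_le xs ys; have := top_ge0; lra.
Qed.

(* At the maximum no gradient is needed: [K (x + d) + K (x - d)] is at least
   [2 (1 - |d| ^ 2) K x] because [cosh >= 1]. *)
Lemma mix_near_top a b : (1 - 2 * (a ^+ 2 + b ^+ 2)) * top <= mix (xs + a) (ys + b).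
Proof.
have hv v : 2 * (1 - (a ^+ 2 + b ^+ 2)) * gk (X v - xs) (Y v - ys) <=
   gk (X v - (xs + a)) (Y v - (ys + b)) + gk (X v - (xs - a)) (Y v - (ys - b)).
  set p := X v - xs; set q := Y v - ys; set d := a ^+ 2 + b ^+ 2.
  have -> : gk (X v - (xs + a)) (Y v - (ys + b)) =
      gk p q * (expR (- d) * expR (2 * (p * a + q * b))).
    by rewrite /gk -!expRD; congr expR; rewrite /p /q /d; ring.
  have -> : gk (X v - (xs - a)) (Y v - (ys - b)) =
      gk p q * (expR (- d) * expR (- (2 * (p * a + q * b)))).
    by rewrite /gk -!expRD; congr expR; rewrite /p /q /d; ring.
  rewrite -mulrDr -mulrDr mulrC ler_wpM2l ?gk_ge0 //.
  set t := 2 * (p * a + q * b).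
  have h1 := expR_ge1Dx (- d); have h2 := expR_ge1Dx t; have h3 := expR_ge1Dx (- t).
  have h4 : expR (- d) * 2 <= expR (- d) * (expR t + expR (- t)).
    by rewrite ler_wpM2l ?expR_ge0 //; lra.
  lra.
have : 2 * (1 - (a ^+ 2 + b ^+ 2)) * mix xs ys <= mix (xs + a) (ys + b) + mix (xs - a) (ys - b).
  by rewrite -meanZ -meanD; apply: le_mean.
have := mix_le (xs - a) (ys - b); rewrite mix_top; lra.
Qed.

End Mixture.

(** * Chaining over dyadic grids *)

Section Chaining.
Context {R : realType}.
Variables (m : nat) (X Y : nat -> R) (top : R).
Hypothesis mix_le : forall x y, mix m X Y x y <= top.

Definition sample_sum (w : seq nat) (x y : R) : R :=
  \sum_(v <- w) gk (X v - x) (Y v - y).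

Variables (eps c : R) (N K : nat) (ax ay : R).
Hypotheses (eps0 : 0 < eps) (c3 : 3 <= c).
Hypothesis sizeN : 2 ^+ 33 * c <= N%:R * eps ^+ 2 * top.
Hypothesis finest : eps * 2 ^+ K <= 2 ^+ 10.

(** The Bernstein parameter of level [l]. Base 3 lies strictly between 2 and 4: the deviation, of
    ratio 3/4, is summable, while the exponent, of ratio 9/4, grows. [finest] keeps the parameter
    admissible down to the last level. *)
Let lam (l : nat) : R := eps / 2 ^+ 25 * 3 ^+ l.
Let var (l : nat) : R := 2 ^+ 16 / 4 ^+ l * top.
Let pt (l : nat) (a : R) (i : nat) : R := grid_pt (2 ^ l) a i.

Let inc (l i j v : nat) : R :=
  gk (X v - pt l ax i) (Y v - pt l ay j) -
  (if l is l'.+1 then gk (X v - pt l' ax i./2) (Y v - pt l' ay j./2) else 0).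

Let exceeds (l i j : nat) (w : seq nat) : bool :=
  N%:R * (mean m (inc l i j) + 4 * lam l * var l) < \sum_(v <- w) inc l i j v.

Lemma top_gt0 : 0 < top.
Proof.
rewrite ltNge; apply/negP => h; move: sizeN; apply/negP; rewrite -ltNge.
apply: (@le_lt_trans _ _ 0).
  by rewrite mulr_ge0_le0 // mulr_ge0 ?sqr_ge0.
by rewrite mulr_gt0 ?exprn_gt0 //; have := c3; lra.
Qed.

Lemma half_dist (i : nat) : 0 <= (i%:R - 2 * (i./2)%:R : R) <= 1.
Proof.
rewrite -{1 3}[i]odd_double_half -mul2n natrD natrM addrK.
by case: odd; rewrite ?lexx ?ler01.
Qed.

(** The offset to the parent is the parity of [i] times the finer step. *)
Lemma pt_parent (l i : nat) (a x : R) :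
  `|(x - pt l.+1 a i) - (x - pt l a i./2)| <= 8 / 2 ^+ l.+1.
Proof.
have e : (x - pt l.+1 a i) - (x - pt l a i./2) =
    - (8 / 2 ^+ l.+1 * (i%:R - 2 * (i./2)%:R)).
  rewrite /pt /grid_pt !natrX exprS invfM; field.
  by rewrite expf_neq0.
have /andP[h1 h2] := half_dist i.
have p0 : 0 <= 8 / 2 ^+ l.+1 :> R by rewrite divr_ge0 ?exprn_ge0.
by rewrite e normrN normrM !ger0_norm // ler_piMr.
Qed.

Lemma inc_sqr_le (l i j v : nat) : inc l.+1 i j v ^+ 2 <=
  268 * (8 / 2 ^+ l.+1) ^+ 2 *
  (gk (X v - pt l.+1 ax i) (Y v - pt l.+1 ay j) +
   gk (X v - pt l ax i./2) (Y v - pt l ay j./2)).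
Proof.
apply: gk_lipschitz; try exact: pt_parent.
rewrite ler_pdivrMr ?exprn_gt0 // exprS.
have : 1 <= 2 ^+ l :> R by rewrite exprn_ege1 // ler1n.
lra.
Qed.

Lemma inc_bound (l i j v : nat) : `|inc l i j v| <= 2 ^+ 8 / 2 ^+ l.
Proof.
case: l => [|l].
  rewrite /inc subr0 expr0 divr1 ger0_norm ?gk_ge0 //.
  by apply: le_trans (gk_le1 _ _) _; rewrite exprn_ege1 // ler1n.
have p0 : 0 <= (2 ^+ l.+1)^-1 :> R by rewrite invr_ge0 exprn_ge0.
rewrite -(@ler_pXn2r _ 2) ?nnegrE ?normr_ge0 ?divr_ge0 ?exprn_ge0 //.
rewrite real_normK ?num_real //; apply: le_trans (inc_sqr_le _ _ _ _) _.
rewrite !exprMn; have := gk_le1 (X v - pt l.+1 ax i) (Y v - pt l.+1 ay j).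
have := gk_le1 (X v - pt l ax i./2) (Y v - pt l ay j./2).
have : 0 <= (2 ^+ l.+1)^-1 ^+ 2 :> R by exact: sqr_ge0.
nra.
Qed.

(** A squared increment is at most the squared step times the kernels at both ends, not merely the
    squared step; each kernel averages to at most [top], and this makes the error relative to the
    density. The constant: 268 times 64 times 2 is below [2 ^+ 16]. *)
Lemma inc_var (l i j : nat) : mean m (fun v => inc l i j v ^+ 2) <= var l.
Proof.
have t0 := ltW top_gt0.
case: l => [|l].
  rewrite /var expr0 divr1; apply: (@le_trans _ _ (mix m X Y (pt 0 ax i) (pt 0 ay j))).
    apply: le_mean => v; rewrite /inc subr0 expr2 ler_piMl ?gk_ge0 //.
    exact: gk_le1.
  by apply: le_trans (mix_le _ _) _; rewrite ler_peMl // exprn_ege1 // ler1n.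
apply: le_trans (le_mean m (inc_sqr_le l i j)) _.
rewrite meanZ meanD -/(mix _ _ _ _ _) -/(mix _ _ _ _ _).
have h1 := mix_le (pt l.+1 ax i) (pt l.+1 ay j).
have h2 := mix_le (pt l ax i./2) (pt l ay j./2).
have -> : var l.+1 = 2 ^+ 16 * top * ((2 ^+ l.+1)^-1 ^+ 2).
  by rewrite /var exprVn -exprM mulnC exprM (_ : 2 ^+ 2 = 4) //; ring.
rewrite exprMn; have : 0 <= (2 ^+ l.+1)^-1 ^+ 2 :> R by exact: sqr_ge0.
nra.
Qed.

Lemma dev_eq (l : nat) : 4 * lam l * var l = eps * top / 2 ^+ 7 * (3 / 4) ^+ l.
Proof.
rewrite /lam /var expr_div_n; field.
by rewrite expf_neq0.
Qed.

Lemma lam_small (l : nat) : (l <= K)%N -> lam l * (2 ^+ 8 / 2 ^+ l) <= 2^-1.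
Proof.
move=> lK.
have -> : lam l * (2 ^+ 8 / 2 ^+ l) = eps * (3 / 2) ^+ l / 2 ^+ 17.
  by rewrite /lam expr_div_n; field; rewrite expf_neq0.
have h1 : (3 / 2) ^+ l <= 2 ^+ K :> R.
  apply: (@le_trans _ _ (2 ^+ l)); last by rewrite ler_eXn2l // ltr1n.
  by rewrite lerXn2r ?nnegrE //; lra.
rewrite ler_pdivrMr ?exprn_gt0 //.
have : eps * (3 / 2) ^+ l <= eps * 2 ^+ K by rewrite ler_wpM2l // ltW.
move: finest; lra.
Qed.

(** The exponent is [N eps ^+ 2 top / 2 ^+ 33] times [(9 / 4) ^+ l]. The first factor is at least
    [c] by [sizeN], the second at least [1 + l]. *)
Lemma exceeds_prob (l i j : nat) : (l <= K)%N ->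
  avg m N (fun w => (exceeds l i j w)%:R) <= expR (- c) * expR (- c) ^+ l.
Proof.
move=> lK; have l0 : 0 <= lam l by rewrite mulr_ge0 ?exprn_ge0 // divr_ge0 ?exprn_ge0 // ltW.
apply: le_trans (bernstein N (inc_bound l i j) (inc_var l i j) l0 (lam_small lK)) _.
rewrite -expRM_natl -expRD ler_expR.
have -> : 2 * N%:R * lam l ^+ 2 * var l =
    N%:R * eps ^+ 2 * top / 2 ^+ 33 * (9 / 4) ^+ l.
  rewrite /lam /var expr_div_n (_ : 9 = 3 ^+ 2) ?[(3 ^+ 2) ^+ l]exprAC; last by ring.
  by field; rewrite expf_neq0.
have h1 : c <= N%:R * eps ^+ 2 * top / 2 ^+ 33 by rewrite ler_pdivlMr ?exprn_gt0 // mulrC.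
have h2 : 1 + l%:R <= (9 / 4) ^+ l :> R.
  elim: (l) => [|n IH]; first by rewrite addr0 expr0.
  by rewrite exprS -natr1; have := ler0n R n; nra.
have : c * (1 + l%:R) <= N%:R * eps ^+ 2 * top / 2 ^+ 33 * (9 / 4) ^+ l.
  by apply: ler_pM => //; have := c3; lra.
lra.
Qed.

Definition grid_ok (w : seq nat) : Prop :=
  forall i j, (i < 2 ^ K)%N -> (j < 2 ^ K)%N ->
  sample_sum w (grid_pt (2 ^ K) ax i) (grid_pt (2 ^ K) ay j) <=
  N%:R * (mix m X Y (grid_pt (2 ^ K) ax i) (grid_pt (2 ^ K) ay j) + eps * top / 32).

(** Telescoping along the ancestors of a grid point: the deviations sum to at most 4 times
    [eps * top / 2 ^+ 7], which is [eps * top / 32]. *)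
Lemma grid_okP (w : seq nat) :
  (forall l i j, (l <= K)%N -> (i < 2 ^ l)%N -> (j < 2 ^ l)%N -> ~~ exceeds l i j w) ->
  grid_ok w.
Proof.
move=> ok.
have geo n : \sum_(l < n) (3 / 4) ^+ l = 4 - 4 * (3 / 4) ^+ n :> R.
  elim: n => [|n IH]; first by rewrite big_ord0 expr0; ring.
  by rewrite big_ord_recr /= IH exprS; field.
suff H l : forall i j, (l <= K)%N -> (i < 2 ^ l)%N -> (j < 2 ^ l)%N ->
    sample_sum w (pt l ax i) (pt l ay j) <=
    N%:R * (mix m X Y (pt l ax i) (pt l ay j) +
            eps * top / 2 ^+ 7 * \sum_(k < l.+1) (3 / 4) ^+ k).
  move=> i j hi hj; apply: le_trans (H K i j (leqnn K) hi hj) _.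
  rewrite ler_wpM2l // lerD2l geo.
  have h1 : 0 <= eps * top by rewrite mulr_ge0 ?ltW ?top_gt0.
  have h2 : 0 <= (3 / 4) ^+ K.+1 :> R by rewrite exprn_ge0 // divr_ge0.
  have h3 : 0 <= eps * top * (3 / 4) ^+ K.+1 by rewrite mulr_ge0.
  nra.
elim: l => [|l IH] i j lK hi hj.
  move: (ok 0%N i j lK hi hj); rewrite /exceeds -leNgt dev_eq /inc.
  rewrite big_ord1; congr (_ <= _); first by apply: eq_bigr => v _; rewrite subr0.
  congr (_ * (_ + _)); apply: congr1; apply: funext => v; exact: subr0.
have hi' : (i./2 < 2 ^ l)%N by rewrite expnS in hi; lia.
have hj' : (j./2 < 2 ^ l)%N by rewrite expnS in hj; lia.
have := IH _ _ (ltnW lK) hi' hj'.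
move: (ok l.+1 i j lK hi hj); rewrite /exceeds -leNgt dev_eq /inc.
rewrite meanB -/(mix _ _ _ _ _) -/(mix _ _ _ _ _) sumrB.
rewrite -/(sample_sum _ _ _) -/(sample_sum _ _ _) [\sum_(k < l.+2) _]big_ord_recr /=.
nra.
Qed.

(** With [c >= 3], [expR (- c)] is at most 1/8, so the [4 ^ l] candidates of level [l] fail with
    total probability at most [expR (- c) / 2 ^ l]. *)
Lemma grid_fail_prob : avg m N (fun w => (~~ `[< grid_ok w >])%:R) <= 2 * expR (- c).
Proof.
have e8 : expR (- c) <= 8^-1.
  apply: (@le_trans _ _ (expR (- 3))); first by rewrite ler_expR lerN2; exact: c3.
  rewrite expRN lef_pV2 ?posrE ?expR_gt0 //.
  by have := @expR_nat_ge R 3; rewrite (_ : 2 ^ 3 = 8)%N.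
have geo n : \sum_(l < n) (2^-1) ^+ l = 2 - 2 * (2^-1) ^+ n :> R.
  elim: n => [|n IH]; first by rewrite big_ord0 expr0; ring.
  by rewrite big_ord_recr /= IH exprS; field.
pose bad w : R := \sum_(l < K.+1) \sum_(i < 2 ^ l) \sum_(j < 2 ^ l) (exceeds l i j w)%:R.
apply: (@le_trans _ _ (avg m N bad)).
  apply: le_avg => w _; case: asboolP => /= nok.
    by apply: sumr_ge0 => l _; apply: sumr_ge0 => i _; apply: sumr_ge0.
  have [l [i [j [hl [hi [hj ex]]]]]] : exists l i j, (l < K.+1)%N /\ (i < 2 ^ l)%N /\
      (j < 2 ^ l)%N /\ exceeds l i j w.
    apply: contrapT => no; apply: nok; apply: grid_okP => l i j hl hi hj.
    by apply/negP => ex; apply: no; exists l, i, j.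
  rewrite /bad (bigD1 (Ordinal hl)) //= (bigD1 (Ordinal hi)) //= (bigD1 (Ordinal hj)) //= ex.
  rewrite -!addrA lerDl !addr_ge0 //.
  - by apply: sumr_ge0.
  - by apply: sumr_ge0 => i' _; apply: sumr_ge0.
  - by apply: sumr_ge0 => l' _; apply: sumr_ge0 => i' _; apply: sumr_ge0.
rewrite /bad avg_sum.
apply: (@le_trans _ _ (\sum_(l < K.+1) expR (- c) * (2^-1) ^+ l)); last first.
  rewrite -mulr_sumr geo mulrC ler_wpM2r ?expR_ge0 // lerBlDr lerDl.
  by rewrite mulr_ge0 // exprn_ge0 // invr_ge0.
apply: ler_sum => l _; rewrite avg_sum.
apply: (@le_trans _ _ (\sum_(i < 2 ^ l) \sum_(j < 2 ^ l) expR (- c) * expR (- c) ^+ l)).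
  apply: ler_sum => i _; rewrite avg_sum; apply: ler_sum => j _.
  by apply: exceeds_prob; rewrite -ltnS.
rewrite !sumr_const !card_ord -mulrnA -[_ *+ (_ * _)]mulr_natl -expnMn natrX.
rewrite mulrCA ler_wpM2l ?expR_ge0 // -exprMn lerXn2r ?nnegrE ?mulr_ge0 ?expR_ge0 ?invr_ge0 //.
rewrite (_ : (2 * 2)%:R = 4) //; lra.
Qed.

End Chaining.

(** * Replacing clusters by centroids *)

Section Centroid.
Context {R : realType}.
Variables (N : nat) (P : pred 'I_N) (a b : 'I_N -> R) (h x y : R).
Let W : R := \sum_(i | P i) 1.
Let ca : R := (\sum_(i | P i) a i) / W.
Let cb : R := (\sum_(i | P i) b i) / W.
Hypotheses (W0 : 0 < W) (h0 : 0 <= h).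
Hypothesis a_near : forall i, P i -> `|a i - ca| <= h.
Hypothesis b_near : forall i, P i -> `|b i - cb| <= h.

Let t i := - (2 * (a i - ca) * (ca - x) + 2 * (b i - cb) * (cb - y) +
              ((a i - ca) ^+ 2 + (b i - cb) ^+ 2)).

Let da2 i : P i -> (a i - ca) ^+ 2 + (b i - cb) ^+ 2 <= 2 * h ^+ 2.
Proof.
move=> Pi; have h1 : (a i - ca) ^+ 2 <= h ^+ 2.
  by rewrite -[_ ^+ 2]real_normK ?num_real // lerXn2r ?nnegrE // a_near.
have h2 : (b i - cb) ^+ 2 <= h ^+ 2.
  by rewrite -[_ ^+ 2]real_normK ?num_real // lerXn2r ?nnegrE // b_near.
lra.
Qed.

Let gk_shift i : gk (a i - x) (b i - y) = gk (ca - x) (cb - y) * expR (t i).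
Proof. by rewrite /gk -expRD; congr expR; rewrite /t; ring. Qed.

(* The linear terms cancel because [(ca, cb)] is the centroid. *)
Let sum_t : \sum_(i | P i) t i = - \sum_(i | P i) ((a i - ca) ^+ 2 + (b i - cb) ^+ 2).
Proof.
have hW : W != 0 by rewrite gt_eqF.
have sc (z : R) : \sum_(i | P i) z = z * W.
  by rewrite /W mulr_sumr; apply: eq_bigr => i _; rewrite mulr1.
have sa : \sum_(i | P i) (a i - ca) = 0 by rewrite sumrB sc divfK ?subrr.
have sb : \sum_(i | P i) (b i - cb) = 0 by rewrite sumrB sc divfK ?subrr.
rewrite /t sumrN big_split /= big_split /=.
under eq_bigr do rewrite mulrAC.
rewrite -mulr_sumr sa mulr0 add0r.
under eq_bigr do rewrite mulrAC.
by rewrite -mulr_sumr sb mulr0 add0r.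
Qed.

(** [expR t >= 1 + t], and the [t i] sum to minus the squared deviations, each at most [2 h ^+ 2].
    Valid at any distance from the candidate. *)
Lemma centroid_le_sum :
  (1 - 2 * h ^+ 2) * (W * gk (ca - x) (cb - y)) <= \sum_(i | P i) gk (a i - x) (b i - y).
Proof.
under [leRHS]eq_bigr do rewrite gk_shift.
rewrite -mulr_sumr; set g := gk _ _.
rewrite (_ : _ * (W * g) = g * ((1 - 2 * h ^+ 2) * W)); last by ring.
rewrite ler_wpM2l ?gk_ge0 //.
apply: (@le_trans _ _ (\sum_(i | P i) (1 + t i))); last first.
  by apply: ler_sum => i _; exact: expR_ge1Dx.
rewrite big_split /= -/W sum_t.
have : \sum_(i | P i) ((a i - ca) ^+ 2 + (b i - cb) ^+ 2) <= 2 * h ^+ 2 * W.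
  by rewrite /W mulr_sumr; apply: ler_sum => i Pi; rewrite mulr1 da2.
lra.
Qed.

Variable B : R.
Hypotheses (xB : `|ca - x| <= B) (yB : `|cb - y| <= B).
Hypotheses (hB : h * B <= 10^-1) (h1 : h <= 10^-1).

Let t_small i : P i -> `|t i| <= 2^-1.
Proof.
move=> Pi; rewrite /t normrN; apply: le_trans (ler_normD _ _) _.
have p1 : `|(a i - ca) * (ca - x)| <= 10^-1.
  apply: le_trans hB; rewrite normrM; apply: ler_pM => //; exact: a_near.
have p2 : `|(b i - cb) * (cb - y)| <= 10^-1.
  apply: le_trans hB; rewrite normrM; apply: ler_pM => //; exact: b_near.
have p3 := ler_normD (2 * (a i - ca) * (ca - x)) (2 * (b i - cb) * (cb - y)).
have p4 : `|(a i - ca) ^+ 2 + (b i - cb) ^+ 2| <= 2 * h ^+ 2.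
  by rewrite ger0_norm ?addr_ge0 ?sqr_ge0 // da2.
have p5 : h ^+ 2 <= 100^-1 by have := h0; have := h1; nra.
move: p3; rewrite -!mulrA !(normrM 2) ger0_norm //; lra.
Qed.

(** The quadratic remainder [t i ^+ 2] is of order [h ^+ 2] times the squared distance to the
    candidate; this distance is absorbed by passing from the kernel to the wide kernel. The bound
    [B] keeps [t i] small enough for the quadratic estimate of [expR]. *)
Lemma sum_le_centroid : \sum_(i | P i) gk (a i - x) (b i - y) <=
  W * gk (ca - x) (cb - y) + 512 * h ^+ 2 * \sum_(i | P i) gkw (a i - x) (b i - y).
Proof.
have h2 : h ^+ 2 <= 100^-1 by have := h0; have := h1; nra.
have h20 : 0 <= h ^+ 2 by exact: sqr_ge0.
have key i : P i -> gk (a i - x) (b i - y) <= gk (ca - x) (cb - y) +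
    gk (ca - x) (cb - y) * t i + 512 * h ^+ 2 * gkw (a i - x) (b i - y).
  move=> Pi; have ts := t_small Pi; have d2 := da2 Pi.
  have hq : gk (a i - x) (b i - y) <= gk (ca - x) (cb - y) * (1 + t i + 2 * t i ^+ 2).
    rewrite gk_shift ler_wpM2l ?gk_ge0 //; apply: expR_le_quadratic.
    exact: le_trans (ler_norm _) ts.
  set g := gk (ca - x) (cb - y) in hq *.
  set q := gk (a i - x) (b i - y) in hq *; set qw := gkw (a i - x) (b i - y).
  set D := (ca - x) ^+ 2 + (cb - y) ^+ 2.
  set d := (a i - ca) ^+ 2 + (b i - cb) ^+ 2 in d2.
  set Dq := (a i - x) ^+ 2 + (b i - y) ^+ 2.
  have D0 : 0 <= D by rewrite addr_ge0 ?sqr_ge0.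
  have d0 : 0 <= d by rewrite addr_ge0 ?sqr_ge0.
  have Dq0 : 0 <= Dq by rewrite addr_ge0 ?sqr_ge0.
  have g0 : 0 <= g := gk_ge0 _ _.
  have t2 : t i ^+ 2 <= 16 * h ^+ 2 * D + 8 * h ^+ 2 * h ^+ 2.
    set r := (a i - ca) * (ca - x) + (b i - cb) * (cb - y).
    have e1 : t i = - (2 * r + d) by rewrite /t /r /d; ring.
    (* Cauchy-Schwarz, by Lagrange's identity. *)
    have e2 : r ^+ 2 <= d * D.
      rewrite -subr_ge0 (_ : _ - _ =
        ((a i - ca) * (cb - y) - (b i - cb) * (ca - x)) ^+ 2) ?sqr_ge0 //.
      by rewrite /r /d /D; ring.
    have e3 : d * D <= 2 * h ^+ 2 * D by rewrite ler_wpM2r.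
    have e4 : d ^+ 2 <= (2 * h ^+ 2) ^+ 2 by rewrite lerXn2r ?nnegrE ?mulr_ge0.
    have e5 := sqr_ge0 (2 * r - d).
    rewrite e1 sqrrN; nra.
  have gq : g <= 2 * q.
    have e1 : q = g * expR (t i) by exact: gk_shift.
    have e2 : 2^-1 <= expR (t i).
      apply: le_trans (expR_ge1Dx _).
      by move: ts; rewrite ler_norml => /andP[]; lra.
    rewrite e1; nra.
  have DDq : D <= 2 * Dq + 4 * h ^+ 2.
    have e1 := sqr_ge0 (a i - x + (a i - ca)); have e2 := sqr_ge0 (b i - y + (b i - cb)).
    rewrite /D /Dq; rewrite /d in d2; nra.
  (* One of the two wide factors of [q] absorbs the squared distance. *)
  have qDq : q * Dq <= 2 * qw.
    have e1 : q = qw * qw by rewrite /q /qw /gk /gkw -expRD; congr expR; lra.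
    have e2 : qw * (1 + Dq / 2) <= 1.
      have := expR_ge1Dx (Dq / 2); rewrite /qw /gkw -/Dq mulNr expRN => e.
      by rewrite mulrC ler_pdivrMr ?expR_gt0 // mul1r.
    have e3 : 0 <= qw := gkw_ge0 _ _.
    rewrite e1; nra.
  have qqw : q <= qw by rewrite /q /qw /gk /gkw ler_expR -/Dq; lra.
  have qw0 : 0 <= qw := gkw_ge0 _ _.
  have q0 : 0 <= q := gk_ge0 _ _.
  have gD : g * D <= 8 * qw + 8 * h ^+ 2 * qw.
    apply: (@le_trans _ _ (2 * q * (2 * Dq + 4 * h ^+ 2))).
      by apply: ler_pM.
    have : q * h ^+ 2 <= qw * h ^+ 2 by rewrite ler_wpM2r.
    nra.
  have gt2 : g * (2 * t i ^+ 2) <= 512 * h ^+ 2 * qw.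
    have e1 : g * t i ^+ 2 <= g * (16 * h ^+ 2 * D + 8 * h ^+ 2 * h ^+ 2) by rewrite ler_wpM2l.
    have e2 : h ^+ 2 * (g * D) <= h ^+ 2 * (8 * qw + 8 * h ^+ 2 * qw) by rewrite ler_wpM2l.
    have e3 : h ^+ 2 * (h ^+ 2 * g) <= h ^+ 2 * (2 * qw).
      by rewrite ler_wpM2l //; nra.
    have e4 : h ^+ 2 * (h ^+ 2 * qw) <= h ^+ 2 * (100^-1 * qw).
      by rewrite ler_wpM2l //; nra.
    have e5 : 0 <= h ^+ 2 * qw by rewrite mulr_ge0.
    lra.
  lra.
apply: le_trans (ler_sum _ key) _.
rewrite !big_split /= -!mulr_sumr sum_t lerD2r.
have : 0 <= gk (ca - x) (cb - y) *
    \sum_(i | P i) ((a i - ca) ^+ 2 + (b i - cb) ^+ 2).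
  by rewrite mulr_ge0 ?gk_ge0 // sumr_ge0 // => i _; rewrite addr_ge0 ?sqr_ge0.
rewrite (_ : \sum_(i | P i) gk (ca - x) (cb - y) = W * gk (ca - x) (cb - y)); first lra.
by rewrite /W mulr_suml; apply: eq_bigr => i _; rewrite mul1r.
Qed.

End Centroid.

(** * Accuracy of the windowed estimate *)

Section Accuracy.
Context {R : realType}.
Variables (M Rr A N : nat) (idx : nat -> nat) (X Y : nat -> R).
Variables (L : nat -> R) (m : nat).
Let h : R := 1 / M%:R.
Let qx := sx A idx X.
Let qy := sy A idx Y.
Let col := kx A idx X L m.
Let row := ky A idx Y L m.
Let ctab := tab A idx X Y L m.
Hypotheses (M0 : (0 < M)%N) (spL : spaced h L m).
Hypotheses (netx : forall i, (i < N)%N -> netted h L m (qx i)).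
Hypotheses (nety : forall i, (i < N)%N -> netted h L m (qy i)).
Hypotheses (h_small : h <= 10^-1) (hR : h * (Rr%:R + 5) <= 10^-1) (R5 : 5 <= Rr%:R :> R).

Let h0 : 0 < h. Proof. by rewrite divr_gt0 // ltr0n. Qed.

Definition sample_total (g : nat -> R) : R := \sum_(i < N) g i.

Let sum_pick (k lo hi : nat) (F : nat -> R) :
  \sum_(lo <= u < hi) (if k == u then F u else 0) = if (lo <= k < hi)%N then F k else 0.
Proof.
rewrite -big_mkcond /=; transitivity (\sum_(lo <= u < hi | u == k) F u).
  by apply: eq_bigl => u; exact: eq_sym.
exact: big_nat1_eq.
Qed.

Lemma window_tab (g : nat -> R) (lox hix loy hiy : nat) :
  \sum_(lox <= u < hix) \sum_(loy <= v < hiy) ctab g N u v =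
  \sum_(i < N) (if (lox <= col i < hix)%N && (loy <= row i < hiy)%N then g i else 0).
Proof.
under eq_bigr do rewrite exchange_big /=.
rewrite exchange_big /=; apply: eq_bigr => i _.
transitivity (\sum_(lox <= u < hix)
    (if col i == u then (if (loy <= row i < hiy)%N then g i else 0) else 0)).
  apply: eq_bigr => u _; rewrite -/col -/row; case: eqP => _ /=; first exact: sum_pick.
  by rewrite big1.
by rewrite sum_pick; case: ifP.
Qed.

Let kx_spec i : (i < N)%N -> (col i < m)%N /\ L (col i) <= qx i < L (col i) + h.
Proof. by move=> /netx; apply: is_rank_netted => //; exact: rankP (ltW h0) spL. Qed.

Let ky_spec i : (i < N)%N -> (row i < m)%N /\ L (row i) <= qy i < L (row i) + h.
Proof. by move=> /nety; apply: is_rank_netted => //; exact: rankP (ltW h0) spL. Qed.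

Let cell (u v : nat) : pred 'I_N := fun i => (col i == u) && (row i == v).

Let tabE (g : nat -> R) u v : ctab g N u v = \sum_(i < N | cell u v i) g i.
Proof. by rewrite /ctab /tab -big_mkcond. Qed.

Let centroid_in (g : nat -> R) (P : pred 'I_N) (z : R) :
  0 < \sum_(i | P i) (1 : R) -> (forall i, P i -> z <= g i <= z + h) ->
  z <= (\sum_(i | P i) g i) / (\sum_(i | P i) 1) <= z + h.
Proof.
move=> W0 hg; rewrite ler_pdivlMr // ler_pdivrMr // !mulr_sumr.
by apply/andP; split; apply: ler_sum => i /hg /andP[]; rewrite mulr1.
Qed.

Let cell_cases u v : \sum_(i < N | cell u v i) (1 : R) = 0 \/
  0 < \sum_(i < N | cell u v i) (1 : R).
Proof.
have : 0 <= \sum_(i < N | cell u v i) (1 : R) by apply: sumr_ge0.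
by rewrite le_eqVlt => /orP[/eqP <-|]; [left|right].
Qed.

Let cell_empty u v (g : nat -> R) : \sum_(i < N | cell u v i) (1 : R) = 0 ->
  \sum_(i < N | cell u v i) g i = 0.
Proof.
move=> e; apply: big1 => i ci; move: e; rewrite (bigD1 i) //= => e.
have : 0 <= \sum_(j < N | cell u v j && (j != i)) (1 : R) by apply: sumr_ge0.
by move: e; lra.
Qed.

Let cell_termE u v x y : cell_term (ctab (fun=> 1) N u v) (ctab qx N u v) (ctab qy N u v) x y =
  (\sum_(i < N | cell u v i) 1) *
  gk ((\sum_(i < N | cell u v i) qx i) / \sum_(i < N | cell u v i) 1 - x)
     ((\sum_(i < N | cell u v i) qy i) / \sum_(i < N | cell u v i) 1 - y).
Proof.
by rewrite !tabE /cell_term sub0r /gk !expr2.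
Qed.

Let sample_near (u v : nat) : 0 < \sum_(i < N | cell u v i) (1 : R) ->
  [/\ forall i, cell u v i ->
        `|qx i - (\sum_(i < N | cell u v i) qx i) / \sum_(i < N | cell u v i) 1| <= h,
      forall i, cell u v i ->
        `|qy i - (\sum_(i < N | cell u v i) qy i) / \sum_(i < N | cell u v i) 1| <= h,
      L u <= (\sum_(i < N | cell u v i) qx i) / (\sum_(i < N | cell u v i) 1) <= L u + h &
      L v <= (\sum_(i < N | cell u v i) qy i) / (\sum_(i < N | cell u v i) 1) <= L v + h].
Proof.
move=> W0.
have hx i : cell u v i -> L u <= qx i <= L u + h.
  by move=> /andP[/eqP <- _]; have [_ /andP[-> /ltW ->]] := kx_spec (ltn_ord i).
have hy i : cell u v i -> L v <= qy i <= L v + h.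
  by move=> /andP[_ /eqP <-]; have [_ /andP[-> /ltW ->]] := ky_spec (ltn_ord i).
have cx := centroid_in W0 hx; have cy := centroid_in W0 hy.
split=> // i ci; rewrite ler_norml.
  by have := hx i ci; move: cx => /andP[? ?] /andP[? ?]; apply/andP; split; lra.
by have := hy i ci; move: cy => /andP[? ?] /andP[? ?]; apply/andP; split; lra.
Qed.

Let est := local_estimate Rr A N idx X Y L m.

(** The window only discards samples, and in each cell the centroid term shrunk by [1 - 2 h ^+ 2]
    stays below the kernel sum. Hence it holds for every anchor and candidate. *)
Lemma local_estimate_le ax ay x y :
  (1 - 2 * h ^+ 2) * est ax ay x y <= sample_total (fun i => gk (qx i - x) (qy i - y)).
Proof.
rewrite /est /local_estimate /window_sum mulr_sumr.
pose g i := gk (qx i - x) (qy i - y).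
set lox := rank _ _ _; set hix := rank _ _ _; set loy := rank _ _ _; set hiy := rank _ _ _.
apply: (@le_trans _ _ (\sum_(lox <= u < hix) \sum_(loy <= v < hiy) ctab g N u v)).
  apply: ler_sum => u _; rewrite mulr_sumr; apply: ler_sum => v _.
  rewrite cell_termE [leRHS]tabE.
  have [e|W0] := cell_cases u v.
    by rewrite e mul0r mulr0 sumr_ge0 // => i _; exact: gk_ge0.
  have [nx ny _ _] := sample_near W0.
  exact: (centroid_le_sum x y W0 (ltW h0) nx ny).
rewrite window_tab; apply: ler_sum => i _; case: ifP => // _; exact: gk_ge0.
Qed.

Let win_rank (z c : R) (k : nat) : (k < m)%N ->
  (rank L m (c - z) <= k < rank L m (c + z))%N = (c - z < L k <= c + z).
Proof.
move=> km; have [_ h1] := rankP (c - z) (ltW h0) spL.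
have [_ h2] := rankP (c + z) (ltW h0) spL.
by rewrite leqNgt h1 // h2 // ltNge.
Qed.

(** The window reaches [Rr] from the anchor, the candidate is within 4 of the anchor and a cell is
    at most 1 wide. So a sample outside is at least [Rr - 5] away in one coordinate, and one wide
    factor of its kernel is at most the exponential; inside, centroids are within [Rr + 5]. *)
Lemma local_estimate_ge ax ay x y : `|x - ax| <= 4 -> `|y - ay| <= 4 ->
  sample_total (fun i => gk (qx i - x) (qy i - y)) <= est ax ay x y +
  (512 * h ^+ 2 + expR (- (Rr%:R - 5) ^+ 2 / 2)) *
    sample_total (fun i => gkw (qx i - x) (qy i - y)).
Proof.
move=> hx hy; rewrite /est /local_estimate /window_sum.
pose g i := gk (qx i - x) (qy i - y); pose gw i := gkw (qx i - x) (qy i - y).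
have rm z : (rank L m z <= m)%N by have [] := rankP z (ltW h0) spL.
set lox := rank _ _ _; set hix := rank _ _ _; set loy := rank _ _ _; set hiy := rank _ _ _.
pose win i := (lox <= col i < hix)%N && (loy <= row i < hiy)%N.
have h1 : h <= 1 by have := h_small; lra.
have c0 : 0 <= 512 * h ^+ 2 by apply: mulr_ge0; [exact: ler0n|exact: sqr_ge0].
have inside : \sum_(i < N) (if win i then g i else 0) <=
    \sum_(lox <= u < hix) \sum_(loy <= v < hiy)
      cell_term (ctab (fun=> 1) N u v) (ctab qx N u v) (ctab qy N u v) x y +
    512 * h ^+ 2 * \sum_(i < N) (if win i then gw i else 0).
  rewrite -!window_tab mulr_sumr -big_split /= !big_nat; apply: ler_sum => u hu.
  rewrite mulr_sumr -big_split /= !big_nat; apply: ler_sum => v hv.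
  rewrite cell_termE [leLHS]tabE tabE.
  have [e|W0] := cell_cases u v.
    have -> : \sum_(i < N | cell u v i) g i = 0 by exact: cell_empty.
    rewrite e mul0r add0r; apply: mulr_ge0 => //.
    by apply: sumr_ge0 => i _; exact: gkw_ge0.
  have [nx ny cx cy] := sample_near W0.
  have um : (u < m)%N by move: hu => /andP[_ hu]; exact: leq_trans hu (rm _).
  have vm : (v < m)%N by move: hv => /andP[_ hv]; exact: leq_trans hv (rm _).
  rewrite win_rank // in hu; rewrite win_rank // in hv.
  apply: (sum_le_centroid W0 (ltW h0) nx ny _ _ hR h_small).
    move: hx cx hu; set c := (_ / _); rewrite !ler_norml => /andP[? ?] /andP[? ?] /andP[? ?].
    by apply/andP; split; lra.
  move: hy cy hv; set c := (_ / _); rewrite !ler_norml => /andP[? ?] /andP[? ?] /andP[? ?].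
  by apply/andP; split; lra.
set e' := expR _; have e'0 : 0 <= e' by exact: expR_ge0.
have outside i : (i < N)%N -> ~~ win i -> g i <= e' * gw i.
  move=> iN; rewrite /win.
  have [kxm /andP[kx1 kx2]] := kx_spec iN; have [kym /andP[ky1 ky2]] := ky_spec iN.
  rewrite !win_rank // negb_and => hw.
  have : (Rr%:R - 5) ^+ 2 <= (qx i - x) ^+ 2 + (qy i - y) ^+ 2.
    case/orP: hw => hw.
      apply: (@le_trans _ _ ((qx i - x) ^+ 2)); last by rewrite lerDl sqr_ge0.
      rewrite -[leRHS]real_normK ?num_real // lerXn2r ?nnegrE ?subr_ge0 //.
      move: hx hw; rewrite ler_norml negb_and -leNgt -ltNge ler_normr => /andP[? ?].
      by case/orP => ?; apply/orP; [right|left]; lra.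
    apply: (@le_trans _ _ ((qy i - y) ^+ 2)); last by rewrite lerDr sqr_ge0.
    rewrite -[leRHS]real_normK ?num_real // lerXn2r ?nnegrE ?subr_ge0 //.
    move: hy hw; rewrite ler_norml negb_and -leNgt -ltNge ler_normr => /andP[? ?].
    by case/orP => ?; apply/orP; [right|left]; lra.
  by rewrite /g /gw /e' /gk /gkw -expRD ler_expR; lra.
apply: (@le_trans _ _ (\sum_(i < N) (if win i then g i else 0) +
    e' * \sum_(i < N) (if win i then 0 else gw i))).
  rewrite mulr_sumr -big_split; apply: ler_sum => i _ /=.
  case: ifPn => [_|/outside]; first by rewrite mulr0 addr0.
  by rewrite add0r; apply.
have gw0 i : 0 <= gw i := gkw_ge0 _ _.
have s1 : \sum_(i < N) (if win i then gw i else 0) <= sample_total gw.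
  by apply: ler_sum => i _; case: ifP.
have s2 : \sum_(i < N) (if win i then 0 else gw i) <= sample_total gw.
  by apply: ler_sum => i _; case: ifP.
have s3 : 512 * h ^+ 2 * \sum_(i < N) (if win i then gw i else 0) <= 512 * h ^+ 2 * sample_total gw.
  exact: ler_wpM2l.
have s4 : e' * \sum_(i < N) (if win i then 0 else gw i) <= e' * sample_total gw.
  by rewrite ler_wpM2l.
rewrite mulrDl; lra.
Qed.

End Accuracy.

Lemma grid_pt_near {R : realType} (M : nat) (c z : R) : (0 < M)%N -> `|z - c| <= 4 ->
  exists2 i, (i < M)%N & `|z - grid_pt M c i| <= 8 / M%:R /\ `|grid_pt M c i - c| <= 4.
Proof.
move=> M0; rewrite ler_norml => /andP[z1 z2].
have M0' : 0 < M%:R :> R by rewrite ltr0n.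
pose r := (z - c + 4) / 8 * M%:R.
have r0 : 0 <= r by rewrite mulr_ge0 ?divr_ge0 //; lra.
have rM : r <= M%:R by rewrite /r ler_piMl ?(ltW M0') //; lra.
have /andP[t1 t2] := truncn_itv r0.
have ez : z = c - 4 + 8 * (r / M%:R) by rewrite /r; field; rewrite gt_eqF.
have [i iM [d1 d2]] : exists2 i, (i < M)%N & i%:R <= r /\ r <= i%:R + 1.
  case: (ltnP (Num.truncn r) M) => hM.
    by exists (Num.truncn r) => //; split=> //; rewrite natr1 ltW.
  (* Truncation reaches [M] only at the right end of the square; the last grid point is still within
     one step. *)
  exists M.-1; first by rewrite prednK.
  have e : M.-1%:R + 1 = M%:R :> R by rewrite natr1 prednK.
  split; last by rewrite e.
  apply: le_trans t1; rewrite ler_nat; lia.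
exists i => //; rewrite /grid_pt.
have i1 : 0 <= i%:R / M%:R :> R by rewrite divr_ge0.
have i2 : i%:R / M%:R <= 1 :> R by rewrite ler_pdivrMr // mul1r ler_nat ltnW.
have f1 : i%:R / M%:R <= r / M%:R by rewrite ler_pM2r ?invr_gt0.
have f2 : r / M%:R <= i%:R / M%:R + 1 / M%:R by rewrite -mulrDl ler_pM2r ?invr_gt0.
have f3 : 0 < 1 / M%:R :> R by rewrite divr_gt0.
clearbody r; set a := i%:R / M%:R in i1 i2 f1 f2 *; set b := r / M%:R in ez f1 f2.
have -> : 8 / M%:R = 8 * (1 / M%:R) :> R by rewrite mulrA mulr1.
set e := 1 / M%:R in f2 f3 *; clearbody a b e.
by split; rewrite ler_norml; apply/andP; split; lra.
Qed.

(** * Success probability *)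

(** The error budget. [H] is the squared cell width; [m], [S], [E] are density, sample sum and
    estimate, at the good candidate for index 0 and at the reported one for index 1; [Sw] is the
    wide sum. Losses: [256 H] for the grid offset, [eps / 2 ^+ 7] for sampling, [37 (512 H + e')]
    for centroids and window, then [2 H] and [eps / 32] on the way back. *)
Lemma accuracy_bound {R : realType} (eps top n H e' dist S0 S1 Sw E0 E1 m0 m1 : R) :
  0 < eps -> eps < 1 -> 0 < top -> 0 < n -> 0 <= H -> H <= eps / 2 ^+ 16 ->
  0 <= e' -> e' <= eps / 128 -> dist <= 128 * H ->
  (1 - 2 * dist) * top <= m0 -> n * (m0 - eps * top / 2 ^+ 7) <= S0 ->
  Sw <= n * (37 * top) -> S1 <= n * (m1 + eps * top / 32) ->
  S0 <= E0 + (512 * H + e') * Sw -> (1 - 2 * H) * E1 <= S1 -> E0 <= E1 ->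
  (1 - eps) * top <= m1.
Proof.
move=> eps0 eps1 top0 n0 H0 hH e0 he hd near h1 h2 ok low high ge.
have p1 : (1 - 256 * H) * top <= m0.
  by apply: le_trans near; apply: ler_wpM2r; [exact: ltW|lra].
have p2 : (512 * H + e') * Sw <= (512 * H + e') * (n * (37 * top)).
  have q0 : 0 <= 512 * H + e' by clear - H0 e0; lra.
  exact: ler_wpM2l.
have p3 : n * ((1 - 256 * H) * top) <= n * m0 by rewrite ler_wpM2l // ltW.
have nt : 0 <= n * top by rewrite mulr_ge0 // ltW.
pose kap := 256 * H + eps / 2 ^+ 7 + 37 * (512 * H + e').
have p4 : n * top * (1 - kap) <= E0.
  by clear - h1 h2 low p2 p3; rewrite /kap; lra.
have p5 : (1 - 2 * H) * (n * top * (1 - kap)) <= (1 - 2 * H) * E1.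
  apply: ler_wpM2l; last exact: le_trans ge.
  by clear - hH eps1; lra.
have kap0 : 0 <= kap by clear - H0 e0 eps0; rewrite /kap; lra.
have p6 : 1 - kap - 2 * H <= (1 - 2 * H) * (1 - kap).
  have : 0 <= H * kap by rewrite mulr_ge0.
  by clear; lra.
have p7 : n * top * (1 - kap - 2 * H) <= n * top * ((1 - 2 * H) * (1 - kap)).
  exact: ler_wpM2l.
have p8 : n * (top * (1 - kap - 2 * H)) <= n * (m1 + eps * top / 32).
  by clear - p5 p7 high ok; lra.
rewrite ler_pM2l // in p8.
have p9 : kap + 2 * H + eps / 32 <= eps.
  by clear - he hH eps0; rewrite /kap; lra.
have p10 : top * (kap + 2 * H + eps / 32) <= top * eps by rewrite ler_wpM2l // ltW.
by clear - p8 p10; lra.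
Qed.

Section GoodRuns.
Context {R : realType}.
Variables (m : nat) (X Y : nat -> R) (top xs ys : R).
Hypothesis mix_le : forall x y, mix m X Y x y <= top.
Hypothesis mix_top : mix m X Y xs ys = top.
Variables (eps rho delta : R) (kM Rr A N : nat).
Hypotheses (eps0 : 0 < eps) (eps1 : eps < 1) (top0 : 0 < top).
Let M := (2 ^ kM)%N.
Let h : R := 1 / M%:R.

Definition sample_sumw (w : seq nat) (x y : R) : R :=
  \sum_(v <- w) gkw (X v - x) (Y v - y).

(** Asked at a single grid point. In 37, the 36 bounds the wide density relative to [top] and 1
    covers its sampling error. *)
Definition well_sampled (w : seq nat) (x y : R) : Prop :=
  N%:R * (mix m X Y x y - eps * top / 2 ^+ 7) <= sample_sum X Y w x y /\
  sample_sumw w x y <= N%:R * (37 * top).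

Definition anchor_x (w : seq nat) (a i : nat) := grid_pt M (X (nth 0%N w a)) i.
Definition anchor_y (w : seq nat) (a i : nat) := grid_pt M (Y (nth 0%N w a)) i.

Definition good_center (w : seq nat) (a i j : nat) : Prop :=
  [/\ [&& a < A, i < M & j < M]%N,
      `|xs - anchor_x w a i| <= 8 / M%:R /\ `|ys - anchor_y w a j| <= 8 / M%:R &
      `|anchor_x w a i - X (nth 0%N w a)| <= 4 /\ `|anchor_y w a j - Y (nth 0%N w a)| <= 4].

Definition good_run (w1 w2 : seq nat) : Prop :=
  (exists a i j, good_center w1 a i j /\ well_sampled w2 (anchor_x w1 a i) (anchor_y w1 a j)) /\
  forall a, (a < A)%N ->
    grid_ok m X Y top eps N kM (X (nth 0%N w1 a)) (Y (nth 0%N w1 a)) w2.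

Lemma accuracy (w1 w2 : seq nat) (idx : nat -> nat) s' :
  2 ^+ 16 <= eps * M%:R ^+ 2 -> h * (Rr%:R + 5) <= 10^-1 -> 5 <= Rr%:R :> R ->
  expR (- (Rr%:R - 5) ^+ 2 / 2) <= eps / 128 -> (0 < N)%N ->
  size w1 = A -> size w2 = N ->
  (forall i, (i < A + N)%N -> idx i = nth 0%N (w1 ++ w2) i) ->
  process_post M Rr A N idx X Y s' -> good_run w1 w2 ->
  (1 - eps) * top <= mix m X Y (rmem s' 0 0) (rmem s' 0 1).
Proof.
move=> hM hR R5 hexp N0 s1 s2 hidx [L [n [sp netx nety]]].
move=> [a [i [j [/and3P[aA iM jM] -> -> best]]]].
move=> [[a0 [i0 [j0 [[hb0 [dx dy] [ex ey]] [E1 E2]]]]] E3].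
have M0 : (0 < M)%N by rewrite expn_gt0.
have M0' : 0 < M%:R :> R by rewrite ltr0n.
have h0 : 0 < h by rewrite divr_gt0.
have hh : h ^+ 2 <= eps / 2 ^+ 16.
  rewrite /h expr_div_n expr1n ler_pdivrMr ?exprn_gt0 //.
  by move: hM; rewrite mulrAC ler_pdivlMr // mul1r.
have h_small : h <= 10^-1.
  apply: le_trans hR; rewrite ler_peMr ?ltW //; lra.
have eidx b : (b < A)%N -> idx b = nth 0%N w1 b.
  by move=> bA; rewrite hidx ?(ltn_addr _ bA) // nth_cat s1 bA.
have tot (g : nat -> R) : sample_total N (fun k => g (idx (A + k)%N)) = \sum_(v <- w2) g v.
  rewrite (big_nth 0%N) s2 big_mkord; apply: eq_bigr => k _; congr g.
  rewrite hidx; last by rewrite ltn_add2l.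
  by rewrite nth_cat s1 ltnNge leq_addr /= addKn.
have up x y ax ay := local_estimate_le Rr M0 sp netx nety ax ay x y.
have lo ax ay x y := local_estimate_ge M0 sp netx nety h_small hR R5 (ax := ax) (ay := ay) (x := x) (y := y).
have /and3P[a0A i0M j0M] := hb0.
have := best a0 i0 j0 hb0; rewrite /cand_value (eidx a aA) (eidx a0 a0A).
rewrite -/(anchor_x w1 a i) -/(anchor_y w1 a j) -/(anchor_x w1 a0 i0) -/(anchor_y w1 a0 j0).
have := up (anchor_x w1 a i) (anchor_y w1 a j) (X (nth 0%N w1 a)) (Y (nth 0%N w1 a)).
have := lo _ _ _ _ ex ey.
rewrite /sx /sy (tot (fun v => gk (X v - anchor_x w1 a0 i0) (Y v - anchor_y w1 a0 j0))).
rewrite (tot (fun v => gk (X v - anchor_x w1 a i) (Y v - anchor_y w1 a j))).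
rewrite (tot (fun v => gkw (X v - anchor_x w1 a0 i0) (Y v - anchor_y w1 a0 j0))).
have := E3 a aA i j iM jM; rewrite -/M -/(anchor_x w1 a i) -/(anchor_y w1 a j) /sample_sum.
move: E1 E2; rewrite /sample_sum /sample_sumw -/h.
have := mix_near_top mix_le mix_top (anchor_x w1 a0 i0 - xs) (anchor_y w1 a0 j0 - ys).
rewrite ![_ + (_ - _)]addrC !subrK.
have e8 : 8 / M%:R = 8 * h by rewrite /h mulrA mulr1.
have dd : (anchor_x w1 a0 i0 - xs) ^+ 2 + (anchor_y w1 a0 j0 - ys) ^+ 2 <= 128 * h ^+ 2.
  move: dx dy; rewrite e8 !(distrC xs) !(distrC ys) => dx dy.
  have t1 : (anchor_x w1 a0 i0 - xs) ^+ 2 <= (8 * h) ^+ 2.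
    by rewrite -[leLHS]real_normK ?num_real // lerXn2r ?nnegrE ?mulr_ge0 // ltW.
  have t2 : (anchor_y w1 a0 j0 - ys) ^+ 2 <= (8 * h) ^+ 2.
    by rewrite -[leLHS]real_normK ?num_real // lerXn2r ?nnegrE ?mulr_ge0 // ltW.
  by move: t1 t2; rewrite exprMn; lra.
set dist := _ ^+ 2 + _ ^+ 2 in dd *.
set e' := expR _ in hexp *; have e'0 : 0 <= e' by exact: expR_ge0.
set S0 := \sum_(v <- w2) gk _ _; set S1 := \sum_(v <- w2) gk _ _.
set Sw := \sum_(v <- w2) gkw _ _.
set e0 := local_estimate _ _ _ _ _ _ _ _ _ _ _ _; set e1 := local_estimate _ _ _ _ _ _ _ _ _ _ _ _.
set m0 := mix _ _ _ _ _; set m1 := mix _ _ _ _ _.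
set H := h ^+ 2 in hh dd *.
have H0 : 0 <= H by exact: sqr_ge0.
have N0' : 0 < N%:R :> R by rewrite ltr0n.
move=> near E1 E2 ok low high ge.
exact: (accuracy_bound eps0 eps1 top0 N0' H0 hh e'0 hexp dd near E1 E2 ok low high ge).
Qed.

End GoodRuns.

Section GoodProbability.
Context {R : realType}.
Variables (m : nat) (X Y : nat -> R) (top xs ys : R).
Hypothesis mix_le : forall x y, mix m X Y x y <= top.
Hypothesis mix_top : mix m X Y xs ys = top.
Variables (eps c : R) (kM A N : nat).
Hypotheses (eps0 : 0 < eps) (eps1 : eps < 1) (top0 : 0 < top) (c3 : 3 <= c).
Hypothesis sizeN : 2 ^+ 33 * c <= N%:R * eps ^+ 2 * top.
Hypothesis finest : eps * 2 ^+ kM <= 2 ^+ 10.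

(** Bernstein with the parameter of chaining level 0; the variance is enlarged to [2 ^+ 16 * top] to
    obtain the exponent that [sizeN] controls. *)
Let base_dev (f : nat -> R) : (forall v, `|f v| <= 1) ->
  mean m (fun v => f v ^+ 2) <= 36 * top ->
  avg m N (fun w => (N%:R * (mean m f + eps * top / 2 ^+ 7) < \sum_(v <- w) f v)%R%:R) <=
  expR (- c).
Proof.
move=> f1 f2.
have l0 : 0 <= eps / 2 ^+ 25 by rewrite divr_ge0 ?exprn_ge0 // ltW.
have lb : eps / 2 ^+ 25 * 1 <= 2^-1.
  rewrite mulr1 ler_pdivrMr ?exprn_gt0 // exprS mulKf //.
  by apply: le_trans (ltW eps1) _; rewrite exprn_ege1 // ler1n.
have fV : mean m (fun v => f v ^+ 2) <= 2 ^+ 16 * top.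
  apply: le_trans f2 _; apply: ler_wpM2r; first exact: ltW.
  by apply: (@le_trans _ _ (2 ^+ 6)); [lra|rewrite ler_eXn2l // ltr1n].
have := bernstein N f1 fV l0 lb.
have -> : 4 * (eps / 2 ^+ 25) * (2 ^+ 16 * top) = eps * top / 2 ^+ 7 by field.
move/le_trans; apply; rewrite ler_expR lerN2.
have -> : 2 * N%:R * (eps / 2 ^+ 25) ^+ 2 * (2 ^+ 16 * top) =
  N%:R * eps ^+ 2 * top / 2 ^+ 33 by field.
by rewrite ler_pdivlMr ?exprn_gt0 // mulrC.
Qed.

Lemma undersampled_prob x y :
  avg m N (fun w => (~~ `[< well_sampled m X Y top eps N w x y >])%:R) <= 2 * expR (- c).
Proof.
pose f v := - gk (X v - x) (Y v - y); pose g v := gkw (X v - x) (Y v - y).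
have bf v : `|f v| <= 1 by rewrite normrN ger0_norm ?gk_ge0 // gk_le1.
have bg v : `|g v| <= 1 by rewrite ger0_norm ?gkw_ge0 // gkw_le1.
have vf : mean m (fun v => f v ^+ 2) <= 36 * top.
  apply: (@le_trans _ _ (mix m X Y x y)).
    by apply: le_mean => v; rewrite sqrrN expr2 ler_piMl ?gk_ge0 // gk_le1.
  by apply: le_trans (mix_le x y) _; have := top0; lra.
have vg : mean m (fun v => g v ^+ 2) <= 36 * top.
  apply: le_trans (mixw_le mix_le mix_top x y).
  by apply: le_mean => v; rewrite expr2 ler_piMl ?gkw_ge0 // gkw_le1.
have pf := base_dev bf vf; have pg := base_dev bg vg.
rewrite mulrDl mul1r; apply: le_trans _ (lerD pf pg); rewrite -avgD.
apply: le_avg => w _; case: asboolP => //= nw; first by rewrite addr_ge0.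
case: ltP => h1; first by rewrite lerDl.
case: ltP => h2; first by rewrite lerDr.
exfalso; apply: nw; split.
  move: h1; rewrite /f sumrN -/(sample_sum X Y w x y).
  rewrite (_ : mean m f = - mix m X Y x y); first by lra.
  by rewrite /mean /f sumrN mulrN.
apply: le_trans h2 _; rewrite ler_wpM2l ?ler0n //.
have e1 : mean m g <= 36 * top := mixw_le mix_le mix_top x y.
have e2 : eps * top / 2 ^+ 7 <= top.
  rewrite ler_pdivrMr ?exprn_gt0 //; apply: (@le_trans _ _ top).
    by rewrite ler_piMl ?ltW.
  by rewrite ler_peMr ?(ltW top0) // exprn_ege1 // ler1n.
by apply: le_trans (lerD e1 e2) _; lra.
Qed.

Let hit (w : seq nat) : bool := has (near_top X Y xs ys) w.

(** The indicator of a miss is a product over the draws, so independence gives a power of [1 - p]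
    with [p] at least [top / 2]. *)
Lemma miss_prob (k : nat) : avg m k (fun w => (~~ hit w)%:R) <= expR (- (k%:R * (top / 2))).
Proof.
rewrite (eq_avg m (F2 := fun w => \prod_(v <- w) (1 - (near_top X Y xs ys v)%:R))); last first.
  move=> w _; elim: w => [|v w IH]; first by rewrite big_nil.
  rewrite big_cons -IH /hit /= negb_or.
  by case: near_top => /=; rewrite ?subrr ?mul0r // subr0 mul1r.
rewrite avg_prod -/(mean m (fun v => 1 - (near_top X Y xs ys v)%:R)) meanB mean_cst.
have -> : - (k%:R * (top / 2)) = k%:R * (- (top / 2)) by ring.
rewrite expRM_natl lerXn2r ?nnegrE ?expR_ge0 //.
  have : 0 <= mean m (fun v => 1 - (near_top X Y xs ys v)%:R) :> R.
    apply: mulr_ge0; first by rewrite invr_ge0 ler0n.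
    apply: sumr_ge0 => v _; by case: near_top; rewrite ?subrr // subr0.
  by rewrite meanB mean_cst.
apply: le_trans _ (expR_ge1Dx _).
by rewrite lerD2l lerN2 (near_top_mass mix_le mix_top).
Qed.

Let good (w1 w2 : seq nat) := good_run m X Y top xs ys eps kM A N w1 w2.

(** Once the anchors are fixed, the good grid point is determined before the samples are drawn.
    Failure costs [2 expR (- c)] at that point and as much for the grid of each anchor. *)
Lemma hit_good_prob (w1 : seq nat) : size w1 = A -> (0 < A)%N -> hit w1 ->
  1 - 4 * A%:R * expR (- c) <= avg m N (fun w2 => (`[< good w1 w2 >])%:R).
Proof.
move=> s1 A0 /(has_nthP 0%N)[a]; rewrite s1 => aA /andP[hx hy].
have M0 : (0 < 2 ^ kM)%N by rewrite expn_gt0.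
have [i iM [dx ex]] : exists2 i, (i < 2 ^ kM)%N &
    `|xs - grid_pt (2 ^ kM) (X (nth 0%N w1 a)) i| <= 8 / (2 ^ kM)%:R /\
    `|grid_pt (2 ^ kM) (X (nth 0%N w1 a)) i - X (nth 0%N w1 a)| <= 4.
  by apply: grid_pt_near => //; rewrite distrC.
have [j jM [dy ey]] : exists2 j, (j < 2 ^ kM)%N &
    `|ys - grid_pt (2 ^ kM) (Y (nth 0%N w1 a)) j| <= 8 / (2 ^ kM)%:R /\
    `|grid_pt (2 ^ kM) (Y (nth 0%N w1 a)) j - Y (nth 0%N w1 a)| <= 4.
  by apply: grid_pt_near => //; rewrite distrC.
set x0 := grid_pt _ _ i in dx ex; set y0 := grid_pt _ _ j in dy ey.
pose ok b w2 := `[< grid_ok m X Y top eps N kM (X (nth 0%N w1 b)) (Y (nth 0%N w1 b)) w2 >].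
pose ws w2 := `[< well_sampled m X Y top eps N w2 x0 y0 >].
have goodP w2 : 1 - ((~~ ws w2)%:R + \sum_(b < A) (~~ ok b w2)%:R) <= (`[< good w1 w2 >])%:R :> R.
  have s0 : 0 <= \sum_(b < A) (~~ ok b w2)%:R :> R by apply: sumr_ge0.
  case: asboolP => g; first by rewrite gerBl addr_ge0.
  rewrite subr_le0; case: (boolP (ws w2)) => /= hw; last by rewrite lerDl.
  rewrite add0r; case: (pselect (forall b, (b < A)%N -> ok b w2)) => hb.
    exfalso; apply: g; split; last by move=> b bA; exact/asboolP/hb.
    exists a, i, j; split; last exact/asboolP.
    by split=> //; rewrite aA iM jM.
  have [b [bA nb]] : exists b, (b < A)%N /\ ~~ ok b w2.
    apply: contrapT => no; apply: hb => b bA; apply/negP => /negP nb.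
    by apply: no; exists b.
  by rewrite (bigD1 (Ordinal bA)) //= nb lerDl; apply: sumr_ge0.
apply: le_trans (le_avg m (fun w2 _ => goodP w2)).
rewrite (eq_avg m (F2 := fun w2 => 1 + (-1) * ((~~ ws w2)%:R + \sum_(b < A) (~~ ok b w2)%:R)));
  last by move=> w _; rewrite mulN1r.
rewrite avgD avg_cst avgZ mulN1r avgD avg_sum lerD2l lerN2.
have p1 := undersampled_prob x0 y0.
have p2 : \sum_(b < A) avg m N (fun w2 => (~~ ok b w2)%:R) <= A%:R * (2 * expR (- c)).
  rewrite -[A in A%:R]card_ord mulr_natl -sumr_const; apply: ler_sum => b _.
  exact: (grid_fail_prob mix_le).
have A1 : 1 <= A%:R :> R by rewrite ler1n.
have p3 : 2 * expR (- c) <= A%:R * (2 * expR (- c)).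
  by rewrite ler_peMl // mulr_ge0 ?expR_ge0.
apply: le_trans (lerD p1 p2) _; move: p3; lra.
Qed.

Lemma good_prob (delta : R) : (0 < A)%N ->
  4 * A%:R * expR (- c) <= delta / 2 -> expR (- (A%:R * (top / 2))) <= delta / 2 ->
  1 - delta <= avg m (A + N) (fun u => (`[< good (take A u) (drop A u) >])%:R).
Proof.
move=> A0 h1 h2; rewrite avg_cat.
rewrite (eq_avg m (F2 := fun w1 => avg m N (fun w2 => (`[< good w1 w2 >])%:R))); last first.
  by move=> w1 s1; apply: eq_avg => w2 _; rewrite -s1 take_size_cat // drop_size_cat.
apply: (@le_trans _ _ (avg m A (fun w1 => (1 - delta / 2) + (-1) * (~~ hit w1)%:R))).
  rewrite avgD avg_cst avgZ; have := miss_prob A; move: h2; lra.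
apply: le_avg => w1 s1; case: (boolP (hit w1)) => hw /=.
  rewrite mulr0 addr0; apply: le_trans (hit_good_prob s1 A0 hw).
  by move: h1; lra.
(* Without a hit the bound to prove is [- delta / 2]. *)
apply: (@le_trans _ _ 0).
  have := expR_ge0 (- (A%:R * (top / 2))); move: h2; lra.
rewrite -(avg_cst m N 0); apply: le_avg => w2 _; exact: ler0n.
Qed.

End GoodProbability.

(** * Sizes and running time *)

(** The two dominant costs: sorting and searching, with about [kN] rounds, and the scan, where each
    anchor has [M ^ 2] candidates and each of these at most [(2 Rr M) ^ 2] cells. *)
Lemma run_time_le (kM kR kA kN : nat) :
  (run_time kM kR kA kN <= 2000 * ((2 ^ kA + 2 ^ kN) * kN.+1 +
     2 ^ kA * ((2 ^ kM) ^ 4 * (2 ^ kR) ^ 2)))%N.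
Proof.
rewrite /run_time.
have gM : (kM < 2 ^ kM)%N by exact: ltn_expl.
have gR : (kR < 2 ^ kR)%N by exact: ltn_expl.
have gA : (kA < 2 ^ kA)%N by exact: ltn_expl.
have eN : (2 ^ kN.+1 = 2 * 2 ^ kN)%N by rewrite expnS.
have N0 : (0 < 2 ^ kN)%N by rewrite expn_gt0.
rewrite eN; move: N0 gM gR gA; clear eN.
move: (2 ^ kM)%N (2 ^ kR)%N (2 ^ kA)%N (2 ^ kN)%N => M r A N N0 gM gR gA.
have M0 : (0 < M)%N by lia.
have r0 : (0 < r)%N by lia.
have A0 : (0 < A)%N by lia.
set w := (2 * r * M)%N; set te := (w * (w * 8 + 8) + 8)%N.
set P := (M ^ 4 * r ^ 2)%N.
have eP : P = (M * (M * ((r * M) * (r * M))))%N by rewrite /P; ring.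
have q0 : (0 < r * M)%N by rewrite muln_gt0 r0.
have hte : (te <= 96 * ((r * M) * (r * M)))%N.
  have ew : w = (2 * (r * M))%N by rewrite /w mulnA.
  rewrite /te ew; move: q0; move: (r * M)%N => q q0.
  have qq : (q <= q * q)%N by rewrite leq_pmulr.
  have -> : (2 * q * (2 * q * 8 + 8) + 8 = 32 * (q * q) + 16 * q + 8)%N by ring.
  by move: (q * q)%N qq => x; lia.
have Mq : (M <= r * M)%N by rewrite leq_pmull.
have rq : (r <= r * M)%N by rewrite leq_pmulr.
set q2 := ((r * M) * (r * M))%N in eP hte.
have q21 : (r * M <= q2)%N by rewrite leq_pmulr.
clearbody te; clear w.
have q20 : (0 < q2)%N by exact: leq_trans q0 q21.
have Mq2 : (M <= M * q2)%N by rewrite leq_pmulr.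
have Mte : (M * te <= M * (96 * q2))%N by rewrite leq_mul.
have h1 : (M * (te + 20) + 15 <= 131 * (M * q2))%N.
  by move: Mte; rewrite mulnDr mulnCA; move: (M * te)%N (M * q2)%N Mq2 M0 => x y; lia.
have h2 : (M * (M * (te + 20) + 15) <= 131 * P)%N.
  by rewrite eP mulnCA leq_mul2l h1 orbT.
have P0 : (0 < P)%N by rewrite /P muln_gt0 !expn_gt0 M0 r0.
have MP : (M <= P)%N by rewrite eP leq_pmulr // muln_gt0 M0.
have rP : (r <= P)%N.
  by rewrite eP mulnA (leq_trans rq) // (leq_trans q21) // leq_pmull // muln_gt0 M0.
have h3 : (A * (kN.+2 * 80 + M * (M * (te + 20) + 15) + 60) <=
    160 * (A * kN.+1) + 191 * (A * P))%N.
  have : (kN.+2 * 80 + M * (M * (te + 20) + 15) + 60 <= 160 * kN.+1 + 191 * P)%N by lia.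
  move: (kN.+2 * 80 + _ + 60)%N => x hx; clear - hx.
  by have := leq_mul (leqnn A) hx; rewrite mulnDr; lia.
have AP : (P <= A * P)%N by rewrite leq_pmull.
have AAk : (A <= A * kN.+1)%N by rewrite leq_pmulr.
have NNk : (N <= N * kN.+1)%N by rewrite leq_pmulr.
have kNk : (kN.+1 <= N * kN.+1)%N by rewrite leq_pmull.
have h4 : (kN.+2 * (200 * (2 * N)) <= 800 * (N * kN.+1))%N by nia.
rewrite mulnDl; lia.
Qed.

Section Sizes.
Context {R : realType}.
Implicit Types x : R.

Definition time_const : R :=
  2000 * ((16 + 4 * expR 40) * 89 + 16 * (16 * (2 ^+ 32)) * 336).

Lemma time_const_ge0 : 0 <= time_const.
Proof.
apply: mulr_ge0; first exact: ler0n.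
apply: addr_ge0; (apply: mulr_ge0; last exact: ler0n).
  by apply: addr_ge0; [exact: ler0n | apply: mulr_ge0; [exact: ler0n | exact: expR_ge0]].
by do 2 (apply: mulr_ge0; first exact: ler0n); apply: exprn_ge0; exact: ler0n.
Qed.

Lemma least_pow2_ge1 x J : least_pow2 x J -> 1 <= x -> (2 ^ J)%:R <= 2 * x.
Proof.
move=> [_ minJ] x1; case: J minJ => [|J] minJ; first by rewrite expn0; lra.
by rewrite expnS natrM ler_pM2l // ltW // minJ.
Qed.

Lemma expR_half_sqr x : expR (x / 2) ^+ 2 = expR x.
Proof. by rewrite -expRM_natl mulrC divfK. Qed.

Lemma ln_inv_ge0 x : 0 < x -> x <= 1 -> 0 <= ln (1 / x).
Proof. by move=> x0 x1; rewrite ln_ge0 // ler_pdivlMr // mul1r. Qed.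

Lemma ln_inv_lt x : 0 < x -> 1 + ln (1 / x) <= 1 / x.
Proof.
move=> x0; have p : 0 < 1 / x by rewrite divr_gt0.
by rewrite -{2}(lnK (x := 1 / x)) ?posrE // expR_ge1Dx.
Qed.

Lemma expR_ln_inv x : 0 < x -> expR (- ln (1 / x)) = x.
Proof. by move=> x0; rewrite expRN lnK ?posrE ?divr_gt0 // invf_div divr1. Qed.

Variables (eps rho delta : R).
Hypotheses (eps0 : 0 < eps) (eps1 : eps < 1) (rho0 : 0 < rho) (rho1 : rho <= 1).
Hypotheses (delta0 : 0 < delta) (delta1 : delta < 1).
Variables (kM kR kA kN : nat).
Hypothesis hM : least_pow2 (real_M eps) kM.
Hypothesis hR : least_pow2 (real_R eps) kR.
Hypothesis hA : least_pow2 (real_A rho delta) kA.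
Hypothesis hN : least_pow2 (real_N eps rho delta) kN.
Let M : R := (2 ^ kM)%:R.
Let Rr : R := (2 ^ kR)%:R.
Let A : R := (2 ^ kA)%:R.
Let N : R := (2 ^ kN)%:R.
Let le_ : R := ln (1 / eps).
Let lr : R := ln (1 / rho).
Let ld : R := ln (1 / delta).
Let le0 : 0 <= le_. Proof. exact: ln_inv_ge0 (ltW eps1). Qed.
Let lr0 : 0 <= lr. Proof. exact: ln_inv_ge0. Qed.
Let ld0 : 0 <= ld. Proof. exact: ln_inv_ge0 (ltW delta1). Qed.

Let real_M_sqr : real_M eps ^+ 2 = 2 ^+ 16 / eps.
Proof.
rewrite /real_M expr_div_n expR_half_sqr lnK ?posrE //; congr (_ / _); ring.
Qed.

Let real_M_gt0 : 0 < real_M eps.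
Proof. by rewrite /real_M divr_gt0 ?expR_gt0 ?ltr0n. Qed.

Let real_M_ge : 256 <= real_M eps.
Proof.
rewrite -(@ler_pXn2r _ 2) ?nnegrE ?ler0n ?(ltW real_M_gt0) // real_M_sqr.
rewrite ler_pdivlMr //; apply: (@le_trans _ _ (256 ^+ 2)).
  by apply: ler_piMr; [rewrite exprn_ge0 ?ler0n | exact: ltW].
by rewrite le_eqVlt; apply/orP; left; apply/eqP; ring.
Qed.

Let M_le : M <= 2 * real_M eps.
Proof. by apply: least_pow2_ge1 hM _; apply: le_trans real_M_ge; rewrite ler1n. Qed.

Lemma M_fine : 2 ^+ 16 <= eps * M ^+ 2.
Proof.
have h1 : real_M eps ^+ 2 <= M ^+ 2.
  by rewrite lerXn2r ?nnegrE ?(ltW real_M_gt0) ?ler0n //; case: hM.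
by move: h1; rewrite real_M_sqr ler_pdivrMr // mulrC.
Qed.

(** Rounding up at most doubles, so [eps * M] is at most 512 times the square root of [eps]. This
    limits the depth of the chain. *)
Lemma M_coarse : eps * 2 ^+ kM <= 2 ^+ 10.
Proof.
rewrite -natrX -/M; have h1 : eps * real_M eps <= 256.
  have e0 : 0 <= eps * real_M eps by rewrite mulr_ge0 ?(ltW eps0) ?(ltW real_M_gt0).
  rewrite -(@ler_pXn2r _ 2) ?nnegrE ?ler0n ?e0 //.
  rewrite exprMn real_M_sqr (_ : _ * _ = eps * 2 ^+ 16); last by field; rewrite gt_eqF.
  apply: (@le_trans _ _ (1 * 2 ^+ 16)); first by rewrite ler_pM2r ?exprn_gt0 // ltW.
  by rewrite le_eqVlt; apply/orP; left; apply/eqP; ring.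
have h2 : eps * M <= eps * (2 * real_M eps) by rewrite ler_pM2l.
apply: le_trans h2 _; rewrite mulrCA.
apply: (@le_trans _ _ (2 * 256)); first by rewrite ler_pM2l.
apply: (@le_trans _ _ (2 ^+ 9)); last by rewrite ler_eXn2l // ltr1n.
by rewrite le_eqVlt; apply/orP; left; apply/eqP; ring.
Qed.

Let Q : R := 80 + 4 * le_.
Let Q80 : 80 <= Q. Proof. by rewrite /Q; have := le0; lra. Qed.

Let real_R_sqr : real_R eps ^+ 2 = Q.
Proof.
rewrite /real_R expR_half_sqr lnK // posrE -/le_ -/Q.
by have := Q80; lra.
Qed.

Let real_R_gt0 : 0 < real_R eps. Proof. exact: expR_gt0. Qed.

Let real_R_ge8 : 8 <= real_R eps.
Proof.
rewrite -(@ler_pXn2r _ 2) ?nnegrE ?ler0n ?(ltW real_R_gt0) // real_R_sqr.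
by have := Q80; lra.
Qed.

Let R_ge : real_R eps <= Rr. Proof. by case: hR. Qed.

Let R_le : Rr <= 2 * real_R eps.
Proof. by apply: least_pow2_ge1 hR _; have := real_R_ge8; lra. Qed.

Lemma R_ge5 : 5 <= Rr.
Proof. by have := R_ge; have := real_R_ge8; lra. Qed.

Let R_sqr_ge : Q <= Rr ^+ 2.
Proof. by rewrite -real_R_sqr lerXn2r ?nnegrE ?(ltW real_R_gt0) ?ler0n. Qed.

Let R_sqr_le : Rr ^+ 2 <= 4 * Q.
Proof.
have : Rr ^+ 2 <= (2 * real_R eps) ^+ 2.
  by rewrite lerXn2r ?nnegrE ?mulr_ge0 ?(ltW real_R_gt0) ?ler0n.
by rewrite exprMn real_R_sqr; lra.
Qed.

(** [(Rr - 10) ^+ 2 >= 0] gives [(Rr - 5) ^+ 2 >= Rr ^+ 2 / 2 - 25]; with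
    [Rr ^+ 2 >= 80 + 4 ln (1 / eps)] the exponent exceeds [7 + ln (1 / eps)]. *)
Lemma tail_small : expR (- (Rr - 5) ^+ 2 / 2) <= eps / 128.
Proof.
have h1 : 7 + le_ <= (Rr - 5) ^+ 2 / 2.
  have := sqr_ge0 (Rr - 10); have := R_sqr_ge; rewrite /Q; have := le0; lra.
apply: (@le_trans _ _ (expR (- 7) * expR (- le_))).
  by rewrite -expRD ler_expR; lra.
rewrite /le_ expR_ln_inv // mulrC ler_pM2l // expRN lef_pV2 ?posrE ?expR_gt0 //.
by have := @expR_nat_ge R 7; rewrite (_ : 2 ^ 7 = 128)%N.
Qed.

(** [eps ln (1 / eps) <= 1] gives [eps Rr ^+ 2 <= 336], while [eps M ^+ 2 >= 2 ^+ 16]: hence [Rr] is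
    at most 8/100 of [M], and 5 at most 2/100 since [M >= 256]. *)
Lemma window_fine : 1 / M * (Rr + 5) <= 10^-1.
Proof.
have M0 : 0 < M by rewrite ltr0n expn_gt0.
have R0 : 0 <= Rr by rewrite ler0n.
have M256 : 256 <= M by apply: le_trans real_M_ge _; case: hM.
rewrite mul1r mulrC ler_pdivrMr //.
have h1 : eps * le_ <= 1.
  have := ln_inv_lt eps0; rewrite ler_pdivlMr // -/le_.
  by have := eps0; lra.
have h2 : eps * Rr ^+ 2 <= eps * (4 * Q) by rewrite ler_pM2l.
have h3 : eps * Rr ^+ 2 <= 336.
  by apply: le_trans h2 _; rewrite /Q; have := eps1; move: h1; lra.
have h4 : eps * Rr ^+ 2 <= eps * (8 / 100 * M) ^+ 2.
  apply: le_trans h3 _; rewrite exprMn; have := M_fine.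
  by set e := eps * M ^+ 2; rewrite (_ : eps * (_ * M ^+ 2) = (8 / 100) ^+ 2 * e); [lra|rewrite /e; ring].
have h5 : Rr <= 8 / 100 * M.
  rewrite ler_pM2l // in h4.
  by rewrite -(@ler_pXn2r _ 2) ?nnegrE // mulr_ge0 ?divr_ge0 // ltW.
lra.
Qed.

Let real_A_ge1 : 1 <= real_A rho delta.
Proof.
by rewrite /real_A -/ld ler_pdivlMr // mul1r; have := rho1; have := ld0; lra.
Qed.

Let A_le : A <= 2 * real_A rho delta.
Proof. exact: least_pow2_ge1 hA real_A_ge1. Qed.

Let mass : R := 1 + (lr + ld).
Let mass1 : 1 <= mass. Proof. by rewrite /mass; have := lr0; have := ld0; lra. Qed.

Let er0 : 0 < eps * eps * rho. Proof. by rewrite !mulr_gt0. Qed.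

Let expR_mass : expR (- mass) <= rho * delta.
Proof.
apply: (@le_trans _ _ (expR (- lr) * expR (- ld))); last by rewrite !expR_ln_inv.
by rewrite -expRD ler_expR /mass; lra.
Qed.

Lemma N_large (top : R) : rho <= top ->
  2 ^+ 33 * (2 ^+ 7 * mass) <= N * eps ^+ 2 * top.
Proof.
move=> rt; have h1 : real_N eps rho delta <= N by case: hN.
rewrite /real_N ler_pdivrMr // -/lr -/ld -/mass in h1.
have h2 : N * (eps * eps * rho) <= N * eps ^+ 2 * top.
  rewrite (_ : N * eps ^+ 2 * top = N * (eps * eps * top)); last by ring.
  by rewrite ler_wpM2l ?ler0n // ler_wpM2l // mulr_ge0 // ltW.
apply: le_trans h2; apply: le_trans h1; rewrite mulrA -exprD ler_pM2r; last by have := mass1; lra.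
by have := @expR_nat_ge R 40; rewrite natrX.
Qed.

Let A_mass : A * rho <= 8 * (1 + ld).
Proof.
have := A_le; rewrite /real_A mulrA -/ld => h1.
by move: h1; rewrite ler_pdivlMr //; lra.
Qed.

(** [expR (- mass)] is at most [rho * delta] and is used twice: one [rho] cancels the [1 / rho] in
    [A], one [delta] its logarithm, and the other [delta] remains. *)
Lemma grids_fail_small : 4 * A * expR (- (2 ^+ 7 * mass)) <= delta / 2.
Proof.
have h1 : expR (- (2 ^+ 7 * mass)) <= expR (- 7) * (expR (- mass) * expR (- mass)).
  rewrite -!expRD ler_expR; have := mass1.
  have -> : 2 ^+ 7 = 128 :> R by ring.
  lra.
have h2 : expR (- 7) <= 128^-1 :> R.
  rewrite expRN lef_pV2 ?posrE ?expR_gt0 //.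
  by have := @expR_nat_ge R 7; rewrite (_ : 2 ^ 7 = 128)%N.
have h3 : expR (- mass) * expR (- mass) <= (rho * delta) * (rho * delta).
  by apply: ler_pM; rewrite ?expR_ge0.
have h4 : expR (- (2 ^+ 7 * mass)) <= 128^-1 * ((rho * delta) * (rho * delta)).
  by apply: le_trans h1 _; apply: ler_pM; rewrite ?mulr_ge0 ?expR_ge0.
have A0 : 0 <= A by rewrite ler0n.
have h5 : 4 * A * expR (- (2 ^+ 7 * mass)) <=
    4 * A * (128^-1 * ((rho * delta) * (rho * delta))).
  by rewrite ler_wpM2l // mulr_ge0.
apply: le_trans h5 _.
have h6 : (1 + ld) * delta <= 1.
  by have := ln_inv_lt delta0; rewrite ler_pdivlMr.
have h7 : A * rho * delta <= 8.
  have : A * rho * delta <= 8 * (1 + ld) * delta by rewrite ler_pM2r.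
  by move: h6; lra.
have h8 : rho * delta <= delta by rewrite ler_piMl // ltW.
have h9 : A * rho * delta * (rho * delta) <= 8 * delta.
  by apply: ler_pM; rewrite ?mulr_ge0 // ltW.
have -> : 4 * A * (128^-1 * ((rho * delta) * (rho * delta))) =
  32^-1 * (A * rho * delta * (rho * delta)) by field.
by have := delta0; move: h9; lra.
Qed.

Lemma anchors_fail_small (top : R) : rho <= top -> expR (- (A * (top / 2))) <= delta / 2.
Proof.
move=> rt; have h1 : real_A rho delta <= A by case: hA.
rewrite /real_A ler_pdivrMr // -/ld in h1.
have A0 : 0 <= A by rewrite ler0n.
have h2 : A * rho <= A * top by rewrite ler_wpM2l.
apply: (@le_trans _ _ (expR (- 1) * expR (- ld))).
  by rewrite -expRD ler_expR; have := ld0; lra.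
rewrite expR_ln_inv // mulrC ler_pM2l // expRN lef_pV2 ?posrE ?expR_gt0 //.
by have := @expR_nat_ge R 1.
Qed.

Let lg_r : R := log1 (1 / rho).
Let lg_d : R := log1 (1 / delta).
Let W : R := log1 (1 / (eps * rho) * log1 (1 / delta)).
Let U : R := 1 / (eps ^+ 2 * rho) * (lg_r + lg_d).
Let Z : R := 1 / (eps * rho) * lg_d.

Let lg_r_ge : 1 <= lg_r /\ lr <= lg_r.
Proof. by rewrite /lg_r /log1; split; rewrite le_max ?lexx ?orbT. Qed.

Let lg_d_ge : 1 <= lg_d /\ ld <= lg_d.
Proof. by rewrite /lg_d /log1; split; rewrite le_max ?lexx ?orbT. Qed.

Let W_ge : 1 <= W /\ ln Z <= W.
Proof. by rewrite /W /log1; split; rewrite le_max ?lexx ?orbT. Qed.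

Let ie0 : 0 < 1 / eps. Proof. by rewrite divr_gt0. Qed.
Let ir0 : 0 < 1 / rho. Proof. by rewrite divr_gt0. Qed.
Let ie1 : 1 <= 1 / eps. Proof. by rewrite ler_pdivlMr // mul1r ltW. Qed.
Let ir1 : 1 <= 1 / rho. Proof. by rewrite ler_pdivlMr // mul1r. Qed.

Let ZE : Z = 1 / eps * (1 / rho) * lg_d.
Proof. by rewrite /Z; field; rewrite !gt_eqF. Qed.

Let UE : U = (1 / eps) ^+ 2 * (1 / rho) * (lg_r + lg_d).
Proof. by rewrite /U; field; rewrite !gt_eqF. Qed.

Let Z_ge : 1 / eps <= Z.
Proof.
rewrite ZE -mulrA ler_peMr ?(ltW ie0) //.
by apply: mulr_ege1; [exact: ir1 | case: lg_d_ge].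
Qed.

Let Z_gt0 : 0 < Z. Proof. exact: lt_le_trans Z_ge. Qed.

Let Z_le_expR : Z <= expR W.
Proof. by rewrite -[leLHS]lnK ?posrE // ler_expR; case: W_ge. Qed.

Let Q_le : Q <= 84 * W.
Proof.
have : le_ <= W.
  by case: W_ge => _; apply: le_trans; rewrite ler_ln ?posrE.
by rewrite /Q; have [] := W_ge; lra.
Qed.

Let N_le : N <= 2 * real_N eps rho delta.
Proof.
apply: least_pow2_ge1 hN _; rewrite /real_N -/lr -/ld -/mass ler_pdivlMr // mul1r.
have e1 : 1 <= expR 40 :> R.
  by apply: le_trans (expR_ge1Dx _); rewrite lerDl.
apply: (@le_trans _ _ 1); last exact: mulr_ege1.
by rewrite !mulr_ile1 // ?mulr_ge0 // ltW.
Qed.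

Let real_N_E : real_N eps rho delta = expR 40 * mass * ((1 / eps) ^+ 2 * (1 / rho)).
Proof. by rewrite /real_N -/lr -/ld -/mass; field; rewrite !gt_eqF. Qed.

Let k0 : 0 < (1 / eps) ^+ 2 * (1 / rho). Proof. by rewrite mulr_gt0 ?exprn_gt0. Qed.

Let N_le_U : N <= 4 * expR 40 * U.
Proof.
apply: le_trans N_le _; rewrite real_N_E UE.
have h1 : mass <= 2 * (lg_r + lg_d).
  by have [] := lg_r_ge; have [] := lg_d_ge; rewrite /mass; lra.
have h2 : 0 <= expR 40 * ((1 / eps) ^+ 2 * (1 / rho)) by rewrite mulr_ge0 ?expR_ge0 // ltW.
have := ler_wpM2l h2 h1.
by move: (expR 40) ((1 / eps) ^+ 2 * (1 / rho)) => a b; lra.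
Qed.

Let A_le_lg : A <= 16 * (1 / rho * lg_d).
Proof.
have := A_mass; rewrite -ler_pdivlMr // => h1; apply: le_trans h1 _.
have -> : 8 * (1 + ld) / rho = 8 * (1 / rho * (1 + ld)) by field; rewrite gt_eqF.
have : 1 / rho * (1 + ld) <= 1 / rho * (2 * lg_d).
  by rewrite ler_pM2l //; have [] := lg_d_ge; lra.
lra.
Qed.

Let A_le_U : A <= 16 * U.
Proof.
apply: le_trans A_le_lg _; rewrite ler_pM2l // UE.
rewrite -[leRHS](mulrA ((1 / eps) ^+ 2)).
have [r1 _] := lg_r_ge; have [d1 _] := lg_d_ge.
have h1 : 1 / rho * lg_d <= 1 / rho * (lg_r + lg_d) by rewrite ler_pM2l //; lra.
apply: le_trans h1 _; rewrite ler_peMl ?exprn_ege1 //.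
by rewrite mulr_ge0 ?(ltW ir0) //; lra.
Qed.

(** [mass] is at most a product of the two logarithmic terms, and [1 + lr <= 1 / rho]. So [N] is at
    most a constant times [Z ^+ 2], and its logarithm fits into [W]. *)
Let kN_le : kN.+1%:R <= 89 * W.
Proof.
have [W1 _] := W_ge; have [d1 d2] := lg_d_ge.
have h1 : mass <= 1 / rho * (2 * lg_d).
  apply: (@le_trans _ _ ((1 + lr) * (1 + ld))).
    have ll : 0 <= lr * ld by rewrite mulr_ge0.
    by rewrite /mass; lra.
  apply: ler_pM; rewrite ?addr_ge0 //; last lra.
  exact: ln_inv_lt.
have h2 : N <= expR (42 + 2 * W).
  apply: le_trans N_le _; rewrite real_N_E.
  apply: (@le_trans _ _ (4 * (expR 40 * Z ^+ 2))).
    have h3 : 0 <= expR 40 * ((1 / eps) ^+ 2 * (1 / rho)) by rewrite mulr_ge0 ?expR_ge0 // ltW.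
    have := ler_wpM2l h3 h1.
    have h4 : expR 40 * ((1 / eps) ^+ 2 * (1 / rho)) * (1 / rho * lg_d) <= expR 40 * Z ^+ 2.
      rewrite -mulrA ler_pM2l ?expR_gt0 // ZE.
      have -> : (1 / eps) ^+ 2 * (1 / rho) * (1 / rho * lg_d) =
        ((1 / eps) ^+ 2 * (1 / rho) ^+ 2) * lg_d by ring.
      rewrite !exprMn ler_pM2l ?mulr_gt0 ?exprn_gt0 ?invr_gt0 //.
      by rewrite expr2 ler_peMl //; lra.
    move: h4; move: (expR 40) ((1 / eps) ^+ 2 * (1 / rho)) => a b; lra.
  have e4 : 4 <= expR 2 :> R by have := @expR_nat_ge R 2.
  have hZ : Z ^+ 2 <= expR W ^+ 2.
    by rewrite lerXn2r ?nnegrE ?expR_ge0 // ltW.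
  have -> : expR (42 + 2 * W) = expR 2 * (expR 40 * expR W ^+ 2).
    by rewrite -expRM_natl -!expRD; congr expR; ring.
  apply: ler_pM => //; first by rewrite mulr_ge0 ?expR_ge0 ?sqr_ge0.
  by rewrite ler_pM2l ?expR_gt0.
(* [expR 2^-1 <= 2], so [kN] is at most twice the logarithm of [N]. *)
have h3 : expR (kN%:R * 2^-1) <= N.
  rewrite expRM_natl /N natrX lerXn2r ?nnegrE ?expR_ge0 //.
  by apply: le_trans (expR_le_quadratic (lexx _)) _; lra.
have : kN%:R * 2^-1 <= 42 + 2 * W by rewrite -ler_expR; apply: le_trans h2.
by rewrite -(natr1 kN); lra.
Qed.

Let scan_const : R := 16 * (16 * (2 ^+ 32)) * 336.

(** [M ^+ 4] accounts for [1 / eps ^+ 2], and [Rr ^+ 2], of order [ln (1 / eps)], goes into [W]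
    because [Z >= 1 / eps]. *)
Let scan_le : A * (M ^+ 4 * Rr ^+ 2) <= scan_const * (U * W).
Proof.
have [W1 _] := W_ge; have [r1 _] := lg_r_ge; have [d1 _] := lg_d_ge.
have M0 : 0 <= M by rewrite ler0n.
have h1 : M ^+ 4 <= 16 * 2 ^+ 32 * (1 / eps) ^+ 2.
  have h : M ^+ 2 <= (2 * real_M eps) ^+ 2.
    have e0 : 0 <= 2 * real_M eps by apply: mulr_ge0; [exact: ler0n | exact: ltW].
    by rewrite lerXn2r ?nnegrE ?e0.
  rewrite exprMn real_M_sqr in h.
  have h' : (M ^+ 2) ^+ 2 <= (2 ^+ 2 * (2 ^+ 16 / eps)) ^+ 2.
    by apply: lerXn2r => //; rewrite nnegrE; [exact: sqr_ge0 | exact: le_trans (sqr_ge0 M) h].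
  rewrite -exprM in h'; apply: le_trans h' _; rewrite le_eqVlt; apply/orP; left.
  by apply/eqP; field; rewrite gt_eqF.
have h2 : Rr ^+ 2 <= 336 * W by have := R_sqr_le; have := Q_le; lra.
have h3 : A <= 16 * (1 / rho * (lg_r + lg_d)).
  apply: le_trans A_le_lg _; rewrite ler_pM2l // ler_pM2l //.
  by move: r1; lra.
have h4 : M ^+ 4 * Rr ^+ 2 <= 16 * 2 ^+ 32 * (1 / eps) ^+ 2 * (336 * W).
  by apply: ler_pM; rewrite ?exprn_ge0 ?ler0n.
have -> : scan_const * (U * W) =
    16 * (1 / rho * (lg_r + lg_d)) * (16 * 2 ^+ 32 * (1 / eps) ^+ 2 * (336 * W)).
  by rewrite UE /scan_const; ring.
by apply: ler_pM => //; rewrite ?mulr_ge0 ?exprn_ge0 ?ler0n.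
Qed.

Lemma run_time_bound (n : nat) : (run_time kM kR kA kN)%:R <=
  time_const *
  time_bound n eps rho delta.
Proof.
have [W1 _] := W_ge.
have h1 : (A + N) * kN.+1%:R <= ((16 + 4 * expR 40) * U) * (89 * W).
  apply: ler_pM; last exact: kN_le.
  - by rewrite addr_ge0 ?ler0n.
  - exact: ler0n.
  - by rewrite mulrDl lerD.
have h2 := scan_le; rewrite /scan_const in h2.
have h3 : (run_time kM kR kA kN)%:R <=
    2000 * ((A + N) * kN.+1%:R + A * (M ^+ 4 * Rr ^+ 2)).
  by have := run_time_le kM kR kA kN; rewrite -(ler_nat R) /M /Rr /A /N !(natrM, natrD, natrX).
apply: (@le_trans _ _ (time_const * (U * W))).
  apply: le_trans h3 _; rewrite /time_const -mulrA ler_wpM2l ?ler0n //.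
  by rewrite [leRHS]mulrDl; apply: lerD h2; rewrite mulrACA in h1.
by rewrite ler_wpM2l ?time_const_ge0 // /time_bound -/lg_r -/lg_d -/W lerDr ler0n.
Qed.

End Sizes.

(** * From the kernel density estimate to coordinates, and the theorem *)

Local Open Scope fset_scope.

Section Kde.
Context {R : realType}.

Lemma gaussian_kernelE (p x : 'rV[R]_2) :
  gaussian_kernel p x = gk (p ord0 ord0 - x ord0 ord0) (p ord0 ord_max - x ord0 ord_max).
Proof.
rewrite /gaussian_kernel /gk /euclidean_norm sqr_sqrtr; last first.
  by apply: sumr_ge0 => i _; exact: sqr_ge0.
have e0 : widen_ord (leqnSn 1) ord0 = ord0 by apply: val_inj.
rewrite big_ord_recr big_ord1 e0 !mxE.
by [].
Qed.

Lemma kde_mix (P : {fset 'rV[R]_2}) (s : seq 'rV[R]_2) (x : 'rV[R]_2) :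
  perm_eq s (enum_fset P) -> s != [::] ->
  kde P x = mix (size s).-1 (point_coord s ord0) (point_coord s ord_max) (x ord0 ord0) (x ord0 ord_max).
Proof.
move=> ps s0; rewrite /kde /mix /mean prednK ?lt0n ?size_eq0 //.
rewrite -(perm_big _ ps) /= -(perm_size ps); congr (_ * _).
rewrite (big_nth 0) big_mkord; apply: eq_bigr => i _; exact: gaussian_kernelE.
Qed.

Lemma kde_le1 (P : {fset 'rV[R]_2}) (x : 'rV[R]_2) : kde P x <= 1.
Proof.
rewrite /kde; have [->|P0] := eqVneq P fset0.
  by rewrite cardfs0 invr0 mul0r.
rewrite ler_pdivrMl ?ltr0n ?cardfs_gt0 // mulr1.
apply: (@le_trans _ _ (\sum_(p <- enum_fset P) 1)).
  by apply: ler_sum => p _; rewrite gaussian_kernelE gk_le1.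
by rewrite big_const_seq count_predT iter_addr_0.
Qed.

Lemma kde_ge0 (P : {fset 'rV[R]_2}) (x : 'rV[R]_2) : 0 <= kde P x.
Proof.
rewrite mulr_ge0 ?invr_ge0 ?ler0n // sumr_ge0 // => p _; exact: expR_ge0.
Qed.

End Kde.

Theorem theorem3 (R : realType) :
  exists (A : cmd) (C : R),
    forall (eps rho delta : R), 0 < eps -> 0 < rho -> 0 < delta < 1 ->
    forall (P : {fset 'rV[R]_2}), P != fset0 ->
    forall (s : seq 'rV[R]_2), perm_eq s (enum_fset P) ->
    exists T : nat,
      [/\ T%:R <= C * time_bound #|` P| eps rho delta,
          halts_within T (start A eps rho delta s)
        & forall xstar : 'rV[R]_2, is_argmax (kde P) xstar ->
            rho <= kde P xstar ->
            1 - delta <= prob T (start A eps rho delta s)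
              (fun s' => (1 - eps) * kde P xstar <= kde P (output s'))].
Proof.
(* The summand 2 pays for the two steps of an immediate stop, since the bound is at least the number
   of points, hence at least 1. *)
exists mode_finder, (2 + time_const)%R => eps rho delta eps0 rho0 /andP[delta0 delta1] P P0 s ps.
have C0 := @time_const_ge0 R.
have tb1 : 1 <= time_bound #|` P| eps rho delta.
  rewrite /time_bound; apply: (@le_trans _ _ #|` P|%:R).
    by rewrite ler1n cardfs_gt0.
  have l1 x : 0 <= log1 x :> R by rewrite /log1 le_max ler01.
  by rewrite lerDl !(mulr_ge0, addr_ge0) // invr_ge0 mulr_ge0 ?sqr_ge0 // ltW.
have s0 : s != [::].
  by rewrite -size_eq0 (perm_size ps) -lt0n cardfs_gt0.
case: (boolP ((eps < 1) && (rho <= 1))) => [/andP[eps1 rho1]|hno]; last first.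
  have [h1 h2] := start_reject delta s hno.
  exists 2; split=> //.
    apply: (@le_trans _ _ (2 * 1)); first by rewrite mulr1.
    by apply: ler_pM => //; rewrite lerDl.
  move=> xstar _ hx; rewrite h2; first by rewrite gerBl ltW.
  have rho1 : rho <= 1 := le_trans hx (kde_le1 P xstar).
  move: hno; rewrite rho1 andbT -leNgt => eps1.
  apply: le_trans (kde_ge0 _ _); rewrite mulr_le0_ge0 ?kde_ge0 // subr_le0 //.
have [kM hM] := least_pow2_exists (real_M eps).
have [kR hR] := least_pow2_exists (real_R eps).
have [kA hA] := least_pow2_exists (real_A rho delta).
have [kN hN] := least_pow2_exists (real_N eps rho delta).
exists (run_time kM kR kA kN); split.
- apply: le_trans (run_time_bound eps0 eps1 rho0 rho1 delta0 delta1 hM hR hA hN #|` P|) _.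
  by rewrite ler_wpM2r ?lerDr // (le_trans ler01).
(* Halting does not depend on the draws, so the empty set of good sequences serves here. *)
- exact: (proj1 (run_spec hM hR hA hN (good := fun=> false) (E := fun=> True)
    eps1 rho1 s0 (fun _ _ _ _ _ _ _ => I))).
move=> xstar xmax hrho.
set X := point_coord s ord0; set Y := point_coord s ord_max.
set m := (size s).-1; set top := kde P xstar.
have kdeE x : kde P x = mix m X Y (x ord0 ord0) (x ord0 ord_max) by exact: kde_mix.
have mix_le x y : mix m X Y x y <= top.
  pose z : 'rV[R]_2 := \row_j (if j == ord0 then x else y).
  by have := xmax z; rewrite kdeE !mxE /=.
have mix_top : mix m X Y (xstar ord0 ord0) (xstar ord0 ord_max) = top by rewrite -kdeE.
have top0 : 0 < top := lt_le_trans rho0 hrho.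
pose L : R := (1 + (ln (1 / rho) + ln (1 / delta)))%R.
have c3 : 3 <= 2 ^+ 7 * L.
  have h1 : 1 <= L.
    by rewrite lerDl addr_ge0 // ln_inv_ge0 // ltW.
  apply: (@le_trans _ _ (2 ^+ 7 * 1)); last by rewrite ler_pM2l ?exprn_gt0.
  by rewrite mulr1; apply: (@le_trans _ _ (2 ^+ 2)); [lra|rewrite ler_eXn2l // ltr1n].
have A0 : (0 < 2 ^ kA)%N by rewrite expn_gt0.
have N0 : (0 < 2 ^ kN)%N by rewrite expn_gt0.
apply: (le_trans (good_prob mix_le mix_top eps0 eps1 top0 c3
  (N_large eps0 rho0 rho1 delta0 delta1 hN hrho)
  (M_coarse eps0 eps1 hM) A0
  (grids_fail_small rho0 rho1 delta0 delta1 hA) (anchors_fail_small rho0 delta0 delta1 hA hrho))).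
pose good (u : seq nat) := `[< good_run m X Y top (xstar ord0 ord0) (xstar ord0 ord_max)
  eps kM (2 ^ kA) (2 ^ kN) (take (2 ^ kA) u) (drop (2 ^ kA) u) >].
apply: (proj2 (run_spec hM hR hA hN (s0 := s) (good := good) eps1 rho1 s0 _)).
move=> u idx s' su hidx hpost /asboolP hgood.
rewrite -/top kdeE !mxE.
have s1 : size (take (2 ^ kA) u) = (2 ^ kA)%N by rewrite size_takel // su leq_addr.
have s2 : size (drop (2 ^ kA) u) = (2 ^ kN)%N by rewrite size_drop su addKn.
have hi i : (i < 2 ^ kA + 2 ^ kN)%N ->
    idx i = nth 0%N (take (2 ^ kA) u ++ drop (2 ^ kA) u) i.
  by move=> ?; rewrite cat_take_drop hidx.
have acc := (accuracy mix_le mix_top eps0 eps1 top0 (M_fine eps0 hM)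
  (window_fine eps0 eps1 hM hR) (R_ge5 eps0 eps1 hR) (tail_small eps0 eps1 hR) N0
  s1 s2 hi hpost hgood).

exact: acc.
Qed.
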